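(* Let $\{X_n\}_{n\ge 1}$, $X_n=\phi\circ T^{n-1}$, be a centered integer-valued stationary process on $(\Omega,\mathcal F,P)$. Suppose it has a conditional local limit theorem at $0$ with constant $g(0)>0$ and scaling constants $B_n=n^{\beta}L(n)>0$, where $\beta\in[\tfrac12,1)$ and $L$ is a slowly varying function. Put $a_n:=g(0)\sum_{k=1}^n \frac1{B_k}$ (so $a_n\to\infty$). Let $\ell_n=\#\{1\le i\le n: S_i=0\}$ with $S_i=X_1+\dots+X_i$. Then $\ell_n/a_n$ converges strongly in distribution to a random variable $Y_\alpha$ having the normalized Mittag-Leffler distribution of order $\alpha=1-\beta$, i.e. $$\int_\Omega f\Big(\frac{\ell_n(\omega)}{a_n}\Big)H(\omega)\,dP(\omega)\longrightarrow E[f(Y_\alpha)]\qquad (n\to\infty)$$ for every bounded continuous function $f:\mathbb R\to\mathbb R$ and every probability density function $H$ on $(\Omega,\mathcal F,P)$ (i.e. measurable $H\ge 0$ with $\int_\Omega H\,dP=1$).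
   Context: Representation: $\Omega=\mathbb Z^{\mathbb N}$, $\mathcal F$ is the $\sigma$-algebra generated by the coordinate projections, $T:\Omega\to\Omega$ is the shift $T(x_1,x_2,\dots)=(x_2,x_3,\dots)$, $P$ is a $T$-invariant probability measure (the law of the process), $\phi:\Omega\to\mathbb Z$ is the first coordinate, and $X_n=\phi\circ T^{n-1}$. Centered means $\int_\Omega\phi\,dP=0$. Transfer operator: $P_T:L^1(P)\to L^1(P)$ is defined by $\int (P_T f)\,h\,dP=\int f\,(h\circ T)\,dP$ for all $f\in L^1(P)$, $h\in L^\infty(P)$. Conditional local limit theorem at $0$: a centered integer-valued stationary process $\{X_n\}$ has a conditional local limit theorem at $0$ with constant $g(0)>0$ and positive scaling constants $B_n$ if for all $x\in\mathbb Z$, $$\lim_{n\to\infty}B_n\,P\big(S_n=x\mid (X_{n+1},X_{n+2},\dots)=\cdot\big)=g(0)\quad P\text{-almost surely},$$ equivalently $\lim_{n\to\infty}B_n P_T^n(\mathbb 1_{\{S_n=x\}})=g(0)$ $P$-a.s. for all $x\in\mathbb Z$. Normalized Mittag-Leffler distribution of order $\alpha\in(0,1)$: the distribution of a nonnegative random variable $Y_\alpha$ with $E[e^{zY_\alpha}]=\sum_{p=0}^\infty \frac{\Gamma(1+\alpha)^p z^p}{\Gamma(1+p\alpha)}$ for all $z\in\mathbb C$ (so $E[Y_\alpha]=1$). *)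

(* Defs.v *)
From HB Require Import structures.
From mathcomp Require Import all_boot all_order all_algebra.
From mathcomp Require Import all_classical all_reals all_analysis.
From mathcomp Require Import complex.

Set Implicit Arguments.
Unset Strict Implicit.
Unset Printing Implicit Defensive.

Import Order.TTheory GRing.Theory Num.Theory.
Import numFieldTopology.Exports numFieldNormedType.Exports.

Local Open Scope classical_set_scope.
Local Open Scope ring_scope.

HB.instance Definition _ := isPointed.Build int 0.

(* Z^N with N = {1, 2, ...}: the coordinate x_k is stored at index k - 1.  The
   sigma-algebra is generated by the preimages of arbitrary sets of integers
   under the coordinates. *)
Definition coordinate_sets : set (set (nat -> int)) :=
  \bigcup_k preimage_set_system setT (fun w : nat -> int => w k) [set: set int].

Definition path_space := g_sigma_algebraType coordinate_sets.

Definition path_shift (w : path_space) : path_space := fun k => w k.+1.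

Definition phi (w : path_space) : int := w 0%N.

(* X_n = phi o T^(n-1) is only meant for n >= 1. *)
Definition coord_X (n : nat) (w : path_space) : int :=
  phi (iter n.-1 path_shift w).

Definition sum_S (n : nat) (w : path_space) : int :=
  \sum_(1 <= i < n.+1) coord_X i w.

(* (X_{n+1}, X_{n+2}, ...) *)
Definition future (n : nat) (w : path_space) : path_space :=
  fun k => coord_X (n + k.+1) w.

Definition ell (n : nat) (w : path_space) : nat :=
  count (fun i => sum_S i w == 0) (iota 1 n).

Section process.
Context {R : realType} (P : probability path_space R).

Definition stationary :=
  forall A : set path_space, measurable A -> P (path_shift @^-1` A) = P A.

Definition centered :=
  P.-integrable setT (fun w => ((phi w)%:~R : R)%:E) /\
  (\int[P]_w ((phi w)%:~R : R)%:E = 0)%E.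

Definition probability_density (H : path_space -> R) :=
  [/\ measurable_fun setT H, forall w, 0 <= H w &
      (\int[P]_w (H w)%:E = 1)%E].

End process.

(* q is a version of y |-> P(E | Y = y). *)
Definition conditional_probability d d' (T : measurableType d)
    (T' : measurableType d') (R : realType) (P : probability T R)
    (E : set T) (Y : T -> T') (q : T' -> R) :=
  [/\ measurable_fun setT q,
      P.-integrable setT (fun w => (q (Y w))%:E) &
      forall A : set T', measurable A ->
        (\int[P]_(w in Y @^-1` A) (q (Y w))%:E = P (E `&` Y @^-1` A))%E].

(* Conditional probabilities are only determined almost surely; since countably
   many of them are involved, the property does not depend on the versions q. *)
Definition conditional_LLT (R : realType) (P : probability path_space R)
    (B : nat -> R) (g0 : R) :=
  exists q : nat -> int -> path_space -> R,
    (forall n x, (0 < n)%N ->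
       conditional_probability P [set w | sum_S n w = x] (future n) (q n x)) /\
    (forall x, {ae P, forall w, B n * q n x w @[n --> \oo] --> g0}).

Definition slowly_varying (R : realType) (L : R -> R) :=
  (exists x0 : R,
     measurable_fun `[x0, +oo[ L /\ {in `[x0, +oo[, forall x, 0 < L x}) /\
  (forall c : R, 0 < c -> L (c * x) / L x @[x --> +oo] --> (1 : R)).

Definition gamma_fun (R : realType) (x : R) : R :=
  \int[lebesgue_measure]_(t in `]0, +oo[) (t `^ (x - 1) * expR (- t)).

Definition cexp (R : realType) (z : R[i]) : R[i] :=
  ((expR (complex.Re z))%:C * (cos (complex.Im z) +i* sin (complex.Im z)))%C.

Section complex_expectation.
Context d (T : measurableType d) (R : realType) (Q : probability T R).
Implicit Type Z : T -> R[i].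

Definition cintegrable Z :=
  Q.-integrable setT (fun w => (complex.Re (Z w))%:E) /\
  Q.-integrable setT (fun w => (complex.Im (Z w))%:E).

Definition cexpectation Z : R[i] :=
  (fine 'E_Q[fun w => complex.Re (Z w)]
   +i* fine 'E_Q[fun w => complex.Im (Z w)])%C.

End complex_expectation.

(* R[i]^o carries the topology of the complex modulus. *)
Definition mittag_leffler d (T : measurableType d) (R : realType)
    (Q : probability T R) (Y : {RV Q >-> R}) (alpha : R) :=
  {ae Q, forall w, 0 <= Y w} /\
  forall z : R[i],
    cintegrable Q (fun w => cexp (z * (Y w)%:C%C)) /\
    \sum_(0 <= p < n)
       (gamma_fun (1 + alpha) ^+ p / gamma_fun (1 + p%:R * alpha))%:C%C * z ^+ p
      @[n --> \oo]
      --> (cexpectation Q (fun w => cexp (z * (Y w)%:C%C)) : R[i]^o).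

(* Main.v *)
Require Import Defs.
From mathcomp Require Import all_boot all_order all_algebra.
From mathcomp Require Import all_classical all_reals all_analysis.
From mathcomp Require Import measurable_realfun.
From mathcomp Require Import ring lra zify complex.

(** The zeros of S form a renewal-like process without independence, and the
    conditional local limit theorem supplies what replaces independence.

    Put u_i = g(0) / B_i, so that a_n = u_1 + ... + u_n.  By Egorov's argument,
    for every delta there is a set A of probability at least 1 - delta such
    that for large i and every measurable subset C of A the event that S_i = 0
    and that the shifted path lies in C has probability (1 +- delta) u_i P(C)
    ([local_limit_uniform_arrivals]): the past and the future of a zero nearly
    decouple as long as the future stays in A.

    Let N_m be the number of zeros up to time m, fix lambda > 0 and let
    x = exp (- lambda / a_n).  Every zero contributes (1 - x) x^r to 1 - x^N_m,
    where r is the number of zeros after it.  Taking means, with a weight h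
    that does not change when a path is restarted at a zero, decoupling gives
    for V(m) = E[h x^N_m] the approximate renewal equation
      E[h] - V(m) = (1 - x) (u_1 V(m - 1) + ... + u_m V(0))
    ([renewal_ineq]).  Exponential means over the time scale n turn the
    convolution into a product ([renewal_transform]).  Since a is regularly
    varying of index alpha = 1 - beta, the mean of a at rate c is equivalent to
    Gamma (1 + alpha) c^-alpha a_n ([abel_partial_sums]), and (1 - x) a_n tends
    to lambda; hence the mean of V at rate c converges to
      E[h] / (1 + lambda Gamma (1 + alpha) c^-alpha)
    ([cvg_visits_transform]).  For c large this is also the mean at rate c of
    t |-> E[h] E[exp (- lambda t^alpha Y)], as one sees by integrating the
    moment series of the Mittag-Leffler law term by term
    ([mittag_leffler_laplace]).  As V is monotone in m, convergence of the
    means implies convergence of V(n) to the value at t = 1 ([tauberian]).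

    Two points need the map that restarts a path at its first zero
    ([return_map]).  It preserves P ([return_map_preserving]), because almost
    every path has a zero and the first return can be inverted by looking back
    to the preceding zero.  The zeros of a path are an orbit of this map, so
    the maximal ergodic theorem bounds the proportion of zeros at which the
    future leaves A, uniformly in time; this is why counting only the zeros
    with future in A changes V little ([laplace_visits_restrict]).  Restarting
    also changes the number of zeros by a bounded amount only.  A density H may
    therefore be replaced by its averages along the orbit, which converge to an
    invariant weight h with the same mean, and the limit does not depend on H
    ([cvg_mean_density]).

    Finally, the Laplace transforms at the integers determine convergence in
    law on the half-line, by polynomial approximation in exp (- x)
    ([laplace_continuity]). *)

Set Implicit Arguments.
Unset Strict Implicit.
Unset Printing Implicit Defensive.

Import Order.TTheory GRing.Theory Num.Theory.
Import numFieldTopology.Exports numFieldNormedType.Exports.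

Local Open Scope classical_set_scope.
Local Open Scope ring_scope.

(** * Bounded measurable functions and their means *)

Section bounded_measurable.
Context d (T : measurableType d) (R : realType).
Implicit Types f g : T -> R.

Definition bounded_measurable f :=
  measurable_fun setT f /\ exists M, forall x, `|f x| <= M.

Lemma bounded_measurable_cst (k : R) : bounded_measurable (fun _ : T => k).
Proof. by split=> //; exists `|k|. Qed.

Lemma bounded_measurableD f g : bounded_measurable f -> bounded_measurable g ->
  bounded_measurable (fun x => f x + g x).
Proof.
move=> [mf [M fM]] [mg [N gN]]; split; first exact: measurable_funD.
by exists (M + N) => x; rewrite (le_trans (ler_normD _ _))// lerD.
Qed.

Lemma bounded_measurableM f g : bounded_measurable f -> bounded_measurable g ->
  bounded_measurable (fun x => f x * g x).
Proof.
move=> [mf [M fM]] [mg [N gN]]; split; first exact: measurable_funM.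
by exists (M * N) => x; rewrite normrM ler_pM.
Qed.

Lemma bounded_measurableZ (k : R) f : bounded_measurable f ->
  bounded_measurable (fun x => k * f x).
Proof. exact/bounded_measurableM/bounded_measurable_cst. Qed.

Lemma bounded_measurableB f g : bounded_measurable f -> bounded_measurable g ->
  bounded_measurable (fun x => f x - g x).
Proof.
move=> [mf [M fM]] [mg [N gN]]; split; first exact: measurable_funB.
by exists (M + N) => x; rewrite (le_trans (ler_normB _ _))// lerD.
Qed.

Lemma bounded_measurable_indic (A : set T) : measurable A ->
  bounded_measurable (\1_A : T -> R).
Proof.
move=> mA; split; first exact: measurable_indic.
exists 1 => x; rewrite indicE; case: (x \in A); by rewrite ?normr1 ?normr0.
Qed.

Lemma bounded_measurable_sum (I : Type) (r : seq I) (F : I -> T -> R) :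
  (forall i, bounded_measurable (F i)) ->
  bounded_measurable (fun x => \sum_(i <- r) F i x).
Proof.
move=> mF; elim: r => [|i r IH].
  under eq_fun do rewrite big_nil; exact: bounded_measurable_cst.
under eq_fun do rewrite big_cons; exact: bounded_measurableD.
Qed.

End bounded_measurable.

Lemma bounded_measurable_comp d d' (T : measurableType d) (T' : measurableType d')
    (R : realType) (h : T' -> T) (f : T -> R) :
  measurable_fun setT h -> bounded_measurable f ->
  bounded_measurable (fun x => f (h x)).
Proof.
by move=> mh [mf [M fM]]; split; [exact: measurableT_comp | exists M].
Qed.

Section mean.
Context d (T : measurableType d) (R : realType).
Implicit Types f g : T -> R.
Context (P : probability T R).

Lemma bounded_measurable_integrable f : bounded_measurable f ->
  P.-integrable setT (EFin \o f).
Proof.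
move=> [mf [M fM]]; apply: measurable_bounded_integrable => //.
  by rewrite (le_lt_trans (probability_le1 P measurableT))// ltry.
exists M; split; first exact: num_real.
by move=> y My x _ /=; rewrite (le_trans (fM x))// ltW.
Qed.
Hint Resolve bounded_measurable_integrable : core.

Lemma mean_cst (k : R) : \int[P]_x k = k.
Proof.
rewrite Rintegral_cst// -[RHS]mulr1; congr (_ * _).
by rewrite -[RHS]/(fine 1%E); congr fine; exact: probability_setT.
Qed.

Lemma meanD f g : bounded_measurable f -> bounded_measurable g ->
  \int[P]_x (f x + g x) = \int[P]_x f x + \int[P]_x g x.
Proof. by move=> *; rewrite RintegralD//; exact: bounded_measurable_integrable. Qed.

Lemma meanB f g : bounded_measurable f -> bounded_measurable g ->
  \int[P]_x (f x - g x) = \int[P]_x f x - \int[P]_x g x.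
Proof. by move=> *; rewrite RintegralB//; exact: bounded_measurable_integrable. Qed.

Lemma meanZ k f : bounded_measurable f ->
  \int[P]_x (k * f x) = k * \int[P]_x f x.
Proof. by move=> *; rewrite RintegralZl//; exact: bounded_measurable_integrable. Qed.

Lemma mean_le f g : bounded_measurable f -> bounded_measurable g ->
  (forall x, f x <= g x) -> \int[P]_x f x <= \int[P]_x g x.
Proof. by move=> *; rewrite le_Rintegral//; exact: bounded_measurable_integrable. Qed.

Lemma mean_norm f : bounded_measurable f ->
  `|\int[P]_x f x| <= \int[P]_x `|f x|.
Proof. by move=> *; apply: le_normr_Rintegral => //; exact: bounded_measurable_integrable. Qed.

Lemma bounded_measurable_norm f : bounded_measurable f ->
  bounded_measurable (fun x => `|f x|).
Proof.
move=> [mf [M fM]]; split; first exact: measurableT_comp.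
by exists M => x; rewrite normr_id.
Qed.

Lemma mean_indic (A : set T) : measurable A ->
  \int[P]_x (\1_A x : R) = fine (P A).
Proof. by move=> mA; rewrite /Rintegral integral_indic// setIT. Qed.

Lemma mean_sum (I : Type) (r : seq I) (F : I -> T -> R) :
  (forall i, bounded_measurable (F i)) ->
  \int[P]_x (\sum_(i <- r) F i x) = \sum_(i <- r) \int[P]_x F i x.
Proof.
move=> mF; elim: r => [|i r IH].
  rewrite big_nil -[RHS](mean_cst 0).
  by apply: eq_Rintegral => x _; rewrite big_nil.
rewrite big_cons -IH -meanD//; last exact: bounded_measurable_sum.
by apply: eq_Rintegral => x _; rewrite big_cons.
Qed.

Lemma mean_preserving (h : T -> T) f : measurable_fun setT h ->
  (forall A, measurable A -> P (h @^-1` A) = P A) ->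
  bounded_measurable f -> \int[P]_x f (h x) = \int[P]_x f x.
Proof.
move=> mh hP bf.
have ifh := bounded_measurable_integrable (bounded_measurable_comp mh bf).
rewrite /Rintegral; congr fine.
have := integral_pushforward mh (mu := P) (D := setT) (f := EFin \o f).
rewrite preimage_setT => <-//; last by apply/measurable_EFinP; case: bf.
by apply: eq_measure_integral => A mA _; first [exact: hP | exact: (esym (hP A mA))].
Qed.

Lemma mean_cvg (F : nat -> T -> R) (f : T -> R) (M : R) :
  (forall n, measurable_fun setT (F n)) -> measurable_fun setT f ->
  (forall n x, `|F n x| <= M) ->
  {ae P, forall x, F n x @[n --> \oo] --> f x} ->
  \int[P]_x F n x @[n --> \oo] --> \int[P]_x f x.
Proof.
move=> mF mf FM Ff.
have := @dominated_convergence _ T R P setT measurableT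
   (fun n => EFin \o F n) (EFin \o f) (cst M%:E).
case.
- by move=> n; apply/measurable_EFinP.
- exact/measurable_EFinP.
- by apply: filterS Ff => x Ffx _; apply: cvg_EFin => //; near=> n.
- exact: (bounded_measurable_integrable (bounded_measurable_cst T M)).
- by apply: aeW => x n _ /=; rewrite lee_fin.
move=> intf _ Fcvg.
apply: (@fine_cvg _ _ _ _ (fun n => (\int[P]_x (F n x)%:E)%E)).
by rewrite /Rintegral fineK//; exact: integrable_fin_num.
Unshelve. all: by end_near. Qed.

End mean.

(** * Real sequences *)

(** This lemma and the following ones are instances of general limit rules at
    sequences of reals, which lets limits be computed from proof terms. *)
Lemma cvg_eventually_eq (R : realType) (f h : nat -> R) (l : R) :
  (\forall n \near \oo, f n = h n) -> f n @[n --> \oo] --> l -> h n @[n --> \oo] --> l.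
Proof. by move=> fh; apply: cvg_trans; apply: near_eq_cvg. Qed.

Lemma cvg_seqM (R : realType) (f h : nat -> R) (a b : R) :
  f n @[n --> \oo] --> a -> h n @[n --> \oo] --> b -> f n * h n @[n --> \oo] --> a * b.
Proof. exact: cvgM. Qed.

Lemma cvg_seq_cst (R : realType) (k : R) : (fun=> k) n @[n --> \oo] --> k.
Proof. exact: cvg_cst. Qed.

Lemma cvg_seqD (R : realType) (f h : nat -> R) (a b : R) :
  f n @[n --> \oo] --> a -> h n @[n --> \oo] --> b -> f n + h n @[n --> \oo] --> a + b.
Proof. exact: cvgD. Qed.

Lemma cvg_seqB (R : realType) (f h : nat -> R) (a b : R) :
  f n @[n --> \oo] --> a -> h n @[n --> \oo] --> b -> f n - h n @[n --> \oo] --> a - b.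
Proof. exact: cvgB. Qed.

Lemma cvg_seqV (R : realType) (f : nat -> R) (a : R) : a != 0 ->
  f n @[n --> \oo] --> a -> (f n)^-1 @[n --> \oo] --> a^-1.
Proof. exact: cvgV. Qed.

Lemma cvg_seq_le (R : realType) (f h : nat -> R) (a b : R) : (forall n, f n <= h n) ->
  f n @[n --> \oo] --> a -> h n @[n --> \oo] --> b -> a <= b.
Proof.
move=> fh fa hb; rewrite -(cvg_lim _ fa)// -(cvg_lim _ hb)//.
by apply: ler_lim; [exact: cvgP fa|exact: cvgP hb|exact: nearW].
Qed.

Lemma cvg_seq_norm (R : realType) (f : nat -> R) (a : R) :
  f n @[n --> \oo] --> a -> `|f n| @[n --> \oo] --> `|a|.
Proof. exact: cvg_norm. Qed.

Lemma cvg_finite_sum (R : realType) (I : Type) (r : seq I) (F : I -> nat -> R) (l : I -> R) :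
  (forall i, F i n @[n --> \oo] --> l i) ->
  \sum_(i <- r) F i n @[n --> \oo] --> \sum_(i <- r) l i.
Proof.
move=> Fl; elim: r => [|i r IH].
  by under eq_fun do rewrite big_nil; rewrite big_nil; exact: cvg_cst.
by under eq_fun do rewrite big_cons; rewrite big_cons; exact: cvgD.
Qed.

(** Stolz-Cesaro: the finitely many terms at which the ratio is not yet close
    to its limit are negligible against a divergent sum. *)
Lemma ratio_of_sums (R : realType) (w v : nat -> R) (l : R) :
  (forall j, 0 < v j) -> w j / v j @[j --> \oo] --> l ->
  \sum_(j < n) v j @[n --> \oo] --> +oo ->
  (\sum_(j < n) w j) / (\sum_(j < n) v j) @[n --> \oo] --> l.
Proof.
move=> v0 wv Voo; apply/cvgrPdist_le => e e0; have e20 : 0 < e / 2 by rewrite divr_gt0.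
move/cvgrPdist_le : wv => /(_ _ e20)[N _ hN].
pose C := \sum_(j < N) `|l * v j - w j|.
have C0 : 0 <= C by exact: sumr_ge0.
move/cvgryPge : Voo => Voo; near=> n.
have Vn : 2 * C / e + 1 <= \sum_(j < n) v j by near: n; exact: Voo.
have nN : (N <= n)%N by near: n; exact: nbhs_infty_ge.
set V := \sum_(j < n) v j in Vn *; set W := \sum_(j < n) w j.
have CE0 : 0 <= 2 * C / e by rewrite divr_ge0 ?(ltW e0)// mulr_ge0.
have V0 : 0 < V by lra.
have -> : l - W / V = (l * V - W) / V by field; rewrite gt_eqF.
rewrite normrM (@ger0_norm _ V^-1) ?invr_ge0 ?(ltW V0)// ler_pdivrMr//.
have : `|l * V - W| <= C + e / 2 * V.
  rewrite /V /W big_distrr/= -sumrB (le_trans (ler_norm_sum _ _ _))//.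
  rewrite -(big_mkord xpredT (fun i => `|l * v i - w i|)) (big_cat_nat (leq0n N) nN)/=.
  rewrite big_mkord lerD2l -(big_mkord xpredT v) (big_cat_nat (leq0n N) nN)/= mulrDr.
  apply: ler_wpDl; first by rewrite mulr_ge0 ?(ltW e20)// sumr_ge0// => i _; exact: ltW.
  rewrite big_distrr/= big_nat_cond [leRHS]big_nat_cond.
  apply: ler_sum => i /andP[/andP[Ni _] _].
  have := hN i Ni => /=; have -> : l - w i / v i = (l * v i - w i) / v i by field; rewrite gt_eqF.
  by rewrite normrM (@ger0_norm _ (v i)^-1) ?invr_ge0 ?(ltW (v0 i))// ler_pdivrMr.
move/le_trans; apply.
have : C <= e / 2 * V.
  have /(ler_wpM2l (ltW e20)) := Vn.
  have -> : e / 2 * (2 * C / e + 1) = C + e / 2 by field; rewrite gt_eqF.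
  lra.
lra.
Unshelve. all: by end_near. Qed.

Section limsup_bounded.
Context {R : realType}.
Implicit Types u v : R^nat.

Lemma norm_bounded_fun u M : (forall n, `|u n| <= M) -> bounded_fun u.
Proof.
by move=> uM; exists M; split; [exact: num_real|move=> y My n _ /=; rewrite (le_trans (uM n))// ltW].
Qed.

Lemma limn_sup_near u M e : (forall n, `|u n| <= M) -> 0 < e ->
  \forall n \near \oo, u n < limn_sup u + e.
Proof.
move=> uM e0.
have bu := norm_bounded_fun uM.
have ub := bounded_fun_has_ubound bu; have lb := bounded_fun_has_lbound bu.
have := cvg_sups_inf ub lb; rewrite -limn_supE// => /cvgrPdist_lt/(_ e e0) cu.
near=> n.
have : `|limn_sup u - sups u n| < e by near: n.
rewrite ltr_distlC => /andP[_]; apply: le_lt_trans.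
apply: ub_le_sup; last by exists n => /=.
exact: has_ubound_sdrop.
Unshelve. all: by end_near. Qed.

Lemma limn_sup_frequently u M e N : (forall n, `|u n| <= M) -> 0 < e ->
  exists2 n, (N <= n)%N & limn_sup u - e < u n.
Proof.
move=> uM e0.
have bu := norm_bounded_fun uM.
have ub := bounded_fun_has_ubound bu; have lb := bounded_fun_has_lbound bu.
have lesup : limn_sup u <= sups u N.
  rewrite limn_supE//; apply: ge_inf; last by exists N.
  exact: bounded_fun_has_lbound_sups.
have : limn_sup u - e < sups u N by rewrite (lt_le_trans _ lesup)// ltrBlDr ltrDl.
move=> /sup_gt[|y [n /= Nn <-] ley]; last by exists n.
by exists (u N), N => /=.
Qed.

Lemma limn_sup_le u M K : (forall n, `|u n| <= M) -> (forall n, u n <= K) ->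
  limn_sup u <= K.
Proof.
move=> uM uK; apply/ler_addgt0Pr => e e0.
have [n _] := limn_sup_frequently 0 uM e0.
by rewrite ltrBlDr => /ltW/le_trans; apply; rewrite lerD2r.
Qed.

Lemma limn_sup_ge u M K : (forall n, `|u n| <= M) -> (forall n, K <= u n) ->
  K <= limn_sup u.
Proof.
move=> uM uK; apply/ler_addgt0Pr => e e0.
have [n _ /(_ n (leqnn n))] := limn_sup_near uM e0.
by move=> /ltW; exact: le_trans.
Qed.

Lemma limn_sup_eq u v M : (forall n, `|u n| <= M) -> (forall n, `|v n| <= M) ->
  u n - v n @[n --> \oo] --> 0 -> limn_sup u = limn_sup v.
Proof.
move=> uM vM uv.
have aux (a b : R^nat) : (forall n, `|a n| <= M) -> (forall n, `|b n| <= M) ->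
   a n - b n @[n --> \oo] --> 0 -> limn_sup a <= limn_sup b.
  move=> aM bM ab; apply/ler_addgt0Pr => e e0; have e20 : 0 < e / 2 by rewrite divr_gt0.
  have e30 : 0 < e / 2 / 2 by rewrite divr_gt0.
  have [N _ HN] := limn_sup_near bM e30.
  move/cvgrPdist_lt : ab => /(_ _ e30)[N' _ HN'].
  have [n nN nlt] := limn_sup_frequently (maxn N N') aM e20.
  have := HN n; have := HN' n; rewrite /= !(leq_trans _ nN) ?leq_maxl ?leq_maxr//.
  move=> /(_ isT) h1 /(_ isT) h2; move: h1; rewrite sub0r normrN ltr_norml; lra.
apply/eqP; rewrite eq_le; apply/andP; split; apply: aux => //.
rewrite -[X in _ --> X]oppr0; have -> : (fun n => v n - u n) = (fun n => - (u n - v n)).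
  by apply/funext => n; rewrite opprB.
exact: cvgN.
Qed.

(** For values in a bounded set, 1 - limsup (1 - u) is the lower limit of u. *)
Lemma limn_sup_cvg u M : (forall n, `|u n| <= M) ->
  limn_sup u <= 1 - limn_sup (fun n => 1 - u n) ->
  u n @[n --> \oo] --> limn_sup u.
Proof.
move=> uM le; apply/cvgrPdist_lt => e e0.
have uM' n : `|1 - u n| <= 1 + M.
  by rewrite (le_trans (ler_normB _ _))// normr1 lerD2l.
near=> n.
have h1 : u n < limn_sup u + e by near: n; exact: limn_sup_near uM e0.
have h2 : 1 - u n < limn_sup (fun n => 1 - u n) + e.
  by near: n; exact: limn_sup_near uM' e0.
by rewrite ltr_norml; apply/andP; split; lra.
Unshelve. all: by end_near. Qed.

End limsup_bounded.

(** * The maximal ergodic theorem *)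

Section maximal_ergodic.
Context d (T : measurableType d) (R : realType) (P : probability T R).
Variables (g : T -> T) (mg : measurable_fun setT g).
Hypothesis gP : forall A, measurable A -> P (g @^-1` A) = P A.
Implicit Types f : T -> R.

Definition orbit_sum f n x : R := \sum_(i < n) f (iter i g x).

Lemma orbit_sumS f n x : orbit_sum f n.+1 x = f x + orbit_sum f n (g x).
Proof.
by rewrite /orbit_sum big_ord_recl; congr (_ + _); apply: eq_bigr => i _; rewrite -iterSr.
Qed.

(** The maximum of the sums [orbit_sum f k x] for k <= n, the empty sum
    included. *)
Fixpoint orbit_max f n x : R :=
  if n is m.+1 then Num.max 0 (f x + orbit_max f m (g x)) else 0.

Lemma orbit_max_ge0 f n x : 0 <= orbit_max f n x.
Proof. by case: n => //= n; rewrite le_max lexx. Qed.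

Lemma orbit_max_leS f n x : orbit_max f n x <= orbit_max f n.+1 x.
Proof.
elim: n x => [|n IH] x; first exact: orbit_max_ge0.
by rewrite [leLHS]/= [leRHS]/= ge_max !le_max lexx/= lerD2l IH orbT.
Qed.

Lemma orbit_sum_le_max f n x : orbit_sum f n x <= orbit_max f n x.
Proof.
elim: n x => [|n IH] x; first by rewrite /orbit_sum big_ord0.
by rewrite orbit_sumS /= le_max lerD2l IH orbT.
Qed.

Lemma orbit_max_attained f n x : exists k, orbit_max f n x = orbit_sum f k x.
Proof.
elim: n x => [|n IH] x; first by exists 0%N; rewrite /orbit_sum big_ord0.
rewrite /=; case: (leP (f x + orbit_max f n (g x)) 0) => _.
  by exists 0%N; rewrite /orbit_sum big_ord0.
by have [k ->] := IH (g x); exists k.+1; rewrite orbit_sumS.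
Qed.

Lemma iter_preserving i : measurable_fun setT (iter i g) /\
  forall A, measurable A -> P (iter i g @^-1` A) = P A.
Proof.
elim: i => [|i [IH1 IH2]]; first by split => //=; exact: measurable_id.
have -> : iter i.+1 g = g \o iter i g by [].
split; first exact: measurableT_comp.
by move=> A mA; rewrite comp_preimage IH2 ?gP// -[X in measurable X]setTI; exact: mg.
Qed.

Lemma bounded_measurable_iter f i : bounded_measurable f ->
  bounded_measurable (fun x => f (iter i g x)).
Proof. by move=> bf; apply: bounded_measurable_comp => //; case: (iter_preserving i). Qed.

Lemma bounded_measurable_orbit_max f n : bounded_measurable f ->
  bounded_measurable (orbit_max f n).
Proof.
move=> bf; elim: n => [|n IH]; first exact: bounded_measurable_cst.
have [mh [M hM]] := bounded_measurableD bf (bounded_measurable_comp mg IH).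
split; first by apply: measurable_maxr.
exists M => x /=; have := hM x; rewrite /=.
case: (leP (f x + _) 0) => // _; first by rewrite normr0; exact: le_trans.
Qed.

(** Garsia's argument.  Where the maximal function M_n is positive it equals
    f + M_(n-1) o g, so that f >= M_n - M_n o g there; elsewhere M_n vanishes and
    M_n - M_n o g <= 0.  The mean of M_n - M_n o g is zero. *)
Lemma maximal_ergodic f : bounded_measurable f ->
  0 <= \int[P]_x (f x * \1_[set y | exists n, 0 < orbit_sum f n y] x).
Proof.
move=> bf.
pose E n := [set x | 0 < orbit_max f n x].
have mE n : measurable (E n).
  rewrite -[E n]setTI.
  have [mm _] := bounded_measurable_orbit_max n bf.
  rewrite (_ : E n = orbit_max f n @^-1` `]0, +oo[); first exact: mm.
  by apply/seteqP; split => x /=; rewrite in_itv/= andbT.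
have EU : [set y | exists n, 0 < orbit_sum f n y] = \bigcup_n E n.
  apply/seteqP; split => x /=.
    by move=> [n n0]; exists n => //; exact: lt_le_trans (orbit_sum_le_max f n x).
  by move=> [n _]; rewrite /E /=; have [k ->] := orbit_max_attained f n x; exists k.
have mU : measurable (\bigcup_n E n) by exact: bigcup_measurable.
have ge0 n : 0 <= \int[P]_x (f x * \1_(E n) x).
  have bm := bounded_measurable_orbit_max n bf.
  have -> : 0 = \int[P]_x (orbit_max f n x - orbit_max f n (g x)).
    rewrite meanB// ?(mean_preserving mg gP)// ?subrr//.
    exact: bounded_measurable_comp mg bm.
  apply: mean_le.
  - apply: bounded_measurableB => //; exact: bounded_measurable_comp mg bm.
  - by apply: bounded_measurableM => //; exact: bounded_measurable_indic.
  move=> x; rewrite indicE; case: (boolP (x \in E n)) => [|/negP].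
    rewrite inE /E /= mulr1; case: n bm => [|n] bm /=; first by rewrite ltxx.
    have := orbit_max_leS f n (g x); rewrite /= [in Num.max 0 (f x + _)]maxEle.
    by case: ifP => _ h; rewrite ?ltxx// => _; lra.
  rewrite inE mulr0 /E /= => /negP; rewrite -leNgt => h.
  have := orbit_max_ge0 f n (g x); lra.
rewrite EU.
have : \int[P]_x (f x * \1_(E n) x) @[n --> \oo] --> \int[P]_x (f x * \1_(\bigcup_n E n) x).
  case: (bf) => _ [M fM]; apply: (@mean_cvg _ _ _ _ _ _ M).
  - move=> n; by have [] := bounded_measurableM bf (bounded_measurable_indic R (mE n)).
  - by have [] := bounded_measurableM bf (bounded_measurable_indic R mU).
  - move=> n x; rewrite normrM (le_trans _ (fM x))// ler_piMr// indicE.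
    by case: (x \in _); rewrite ?normr1 ?normr0.
  apply: aeW => x; apply: cvgMr; rewrite indicE.
  have [[N _ EN]|nE] := pselect ((\bigcup_n E n) x); last first.
    rewrite memNset//; apply: cvg_near_cst; apply: nearW => n.
    by rewrite indicE memNset// => En; apply: nE; exists n.
  rewrite mem_set; last by exists N.
  apply: cvg_near_cst; exists N => //= n /= Nn; rewrite indicE mem_set// /E /=.
  apply: lt_le_trans EN _.
  have : {homo orbit_max f ^~ x : a b / (a <= b)%N >-> a <= b}.
    by apply: homo_leq => //; [exact: le_trans | move=> k; exact: orbit_max_leS].
  exact.
move=> cv; rewrite -(cvg_lim _ cv)//; apply: limr_ge; first by apply/cvg_ex; eexists; exact: cv.
exact: nearW.
Qed.

(** The maximal ergodic theorem for \1_B - eta: the points whose orbit visits B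
    with frequency above eta at some time have probability at most P B / eta, for eta > 0. *)
Lemma maximal_frequency (B : set T) (eta : R) : measurable B ->
  eta * fine (P [set x | exists n, n%:R * eta < orbit_sum \1_B n x]) <= fine (P B).
Proof.
move=> mB; have bB := bounded_measurable_indic R mB.
set E := [set x | _].
have bh := bounded_measurableB bB (bounded_measurable_cst _ eta).
have sumE n x : orbit_sum (fun x => \1_B x - eta) n x = orbit_sum \1_B n x - n%:R * eta.
  by rewrite /orbit_sum sumrB sumr_const card_ord mulr_natl.
have EE : [set y | exists n, 0 < orbit_sum (fun x => \1_B x - eta) n y] = E.
  by apply/seteqP; split => x /= [n]; exists n; move: p; rewrite sumE subr_gt0.
have mE : measurable E.
  have -> : E = \bigcup_n [set x | n%:R * eta < orbit_sum \1_B n x].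
    by apply/seteqP; split => x /=; [move=> [n h]; exists n | move=> [n _ h]; exists n].
  apply: bigcup_measurable => n _.
  have [ms _] : bounded_measurable (orbit_sum \1_B n).
    by apply: bounded_measurable_sum => i; exact: bounded_measurable_iter.
  rewrite (_ : [set _ | _] = orbit_sum \1_B n @^-1` `]n%:R * eta, +oo[).
    by rewrite -[X in measurable X]setTI; exact: ms.
  by apply/seteqP; split => x /=; rewrite in_itv/= andbT.
have bE := bounded_measurable_indic R mE.
have := maximal_ergodic bh; rewrite EE => h.
rewrite -[X in _ * X]mean_indic// -mean_indic// -meanZ//.
apply: le_trans (_ : \int[P]_x (\1_B x * \1_E x) <= _).
  rewrite -subr_ge0 -meanB; last 2 first.
  - exact: bounded_measurableM.
  - exact: bounded_measurableZ.
  by apply: le_trans h _; rewrite le_eqVlt; apply/orP; left; apply/eqP; apply: eq_Rintegral => x _; rewrite mulrBl.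
apply: mean_le => //; first exact: bounded_measurableM.
by move=> x; rewrite !indicE; case: (x \in B); case: (x \in E); rewrite ?mulr0 ?mulr1 ?mul0r.
Qed.

End maximal_ergodic.

(** * The pointwise ergodic theorem *)

Section birkhoff.
Context d (T : measurableType d) (R : realType) (P : probability T R).
Variables (g : T -> T) (mg : measurable_fun setT g).
Hypothesis gP : forall A, measurable A -> P (g @^-1` A) = P A.
Implicit Types f : T -> R.

Definition orbit_mean f n x : R := n.+1%:R^-1 * orbit_sum g f n.+1 x.

Definition limsup_mean f x : R := limn_sup (orbit_mean f ^~ x).

Section unit_interval.
Variable f : T -> R.
Hypotheses (mf : measurable_fun setT f) (f01 : forall x, 0 <= f x <= 1).

Let bf : bounded_measurable f.
Proof.
split=> //; exists 1 => x; have /andP[f0 f1] := f01 x; by rewrite ger0_norm.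
Qed.

Lemma orbit_mean01 n x : 0 <= orbit_mean f n x <= 1.
Proof.
have n0 : 0 < (n.+1%:R : R) by rewrite ltr0n.
have s0 : 0 <= orbit_sum g f n.+1 x.
  by apply: sumr_ge0 => i _; case/andP: (f01 (iter i g x)).
apply/andP; split; first by apply: mulr_ge0 => //; rewrite invr_ge0 ltW.
rewrite /orbit_mean ler_pdivrMl// mulr1.
apply: (@le_trans _ _ (\sum_(i < n.+1) 1)).
  by apply: ler_sum => i _; case/andP: (f01 (iter i g x)).
by rewrite sumr_const card_ord.
Qed.

Lemma norm_orbit_mean n x : `|orbit_mean f n x| <= 1.
Proof. by have /andP[h0 h1] := orbit_mean01 n x; rewrite ger0_norm. Qed.

Lemma bounded_measurable_orbit_mean n : bounded_measurable (orbit_mean f n).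
Proof.
apply: bounded_measurableZ; apply: bounded_measurable_sum => i.
exact: bounded_measurable_iter mg gP f i bf.
Qed.

Lemma limsup_mean01 x : 0 <= limsup_mean f x <= 1.
Proof.
apply/andP; split.
  by apply: limn_sup_ge (norm_orbit_mean ^~ x) _ => n; case/andP: (orbit_mean01 n x).
by apply: limn_sup_le (norm_orbit_mean ^~ x) _ => n; case/andP: (orbit_mean01 n x).
Qed.

Lemma bounded_measurable_limsup_mean : bounded_measurable (limsup_mean f).
Proof.
split; last first.
  by exists 1 => x; have /andP[h0 h1] := limsup_mean01 x; rewrite ger0_norm.
apply: measurable_fun_limn_sup => [t _|t _|n].
- by exists 1 => _ [n _ <-]; case/andP: (orbit_mean01 n t).
- by exists 0 => _ [n _ <-]; case/andP: (orbit_mean01 n t).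
- by case: (bounded_measurable_orbit_mean n).
Qed.

Lemma limsup_mean_invariant x : limsup_mean f (g x) = limsup_mean f x.
Proof.
apply: (@limn_sup_eq _ _ _ 1) => [n|n|]; try exact: norm_orbit_mean.
apply/cvgr0Pnorm_lt => e e0; near=> n.
have -> : orbit_mean f n (g x) - orbit_mean f n x =
    n.+1%:R^-1 * (f (iter n.+1 g x) - f x).
  rewrite /orbit_mean -mulrBr; congr (_ * _).
  rewrite [X in _ - X]orbit_sumS /orbit_sum big_ord_recr/= -iterSr/=; lra.
rewrite normrM ger0_norm ?invr_ge0//.
apply: (@le_lt_trans _ _ (n.+1%:R^-1 * 1)).
  rewrite ler_wpM2l ?invr_ge0// ler_norml.
  have /andP[a0 a1] := f01 (iter n.+1 g x); have /andP[b0 b1] := f01 x.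
  by apply/andP; split; lra.
rewrite mulr1; near: n; exact: near_infty_natSinv_lt (PosNum e0).
Unshelve. all: by end_near. Qed.

(** The upper limit fs of the averages is invariant, so the sums of f - fs + e
    along any orbit are positive at some time: the maximal ergodic theorem then
    applies on the whole space. *)
Lemma mean_limsup_mean_le :
  \int[P]_x limsup_mean f x <= \int[P]_x f x.
Proof.
apply/ler_addgt0Pr => e e0.
have bs := bounded_measurable_limsup_mean.
have bh := bounded_measurableB bf bs.
have bhe := bounded_measurableD bh (bounded_measurable_cst T e).
have := maximal_ergodic mg gP bhe.
rewrite (_ : [set y | _] = setT); last first.
  apply/seteqP; split => // x _ /=.
  (* Some average exceeds its upper limit minus e; by invariance of the upper
     limit, the sum of f - fs + e is then positive. *)
  have [n _ hn] := limn_sup_frequently 0 (norm_orbit_mean ^~ x) e0.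
  exists n.+1.
  have -> : orbit_sum g (fun x => f x - limsup_mean f x + e) n.+1 x =
            n.+1%:R * (orbit_mean f n x - limsup_mean f x + e).
    have inv i : limsup_mean f (iter i g x) = limsup_mean f x.
      by elim: i => //= i IH; rewrite limsup_mean_invariant.
    rewrite /orbit_sum big_split/= sumrB [X in _ - X](eq_bigr (fun=> limsup_mean f x))//.
    rewrite !sumr_const card_ord mulrDr mulrBr.
    by rewrite /orbit_mean mulVKf// !mulr_natl.
  rewrite mulr_gt0// ?ltr0n//; move: hn; rewrite /limsup_mean; lra.
under eq_Rintegral do rewrite indicT mulr1.
rewrite (meanD P bh)//; last exact: bounded_measurable_cst.
by rewrite meanB// mean_cst; lra.
Qed.

End unit_interval.

(** The bound of the mean of the upper limit, applied to f and to 1 - f, shows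
    that the upper and the lower limit of the averages have the same mean. *)
Lemma birkhoff f : measurable_fun setT f -> (forall x, 0 <= f x <= 1) ->
  exists fs : T -> R, [/\ measurable_fun setT fs, forall x, 0 <= fs x <= 1,
    forall x, fs (g x) = fs x &
    {ae P, forall x, orbit_mean f n x @[n --> \oo] --> fs x}].
Proof.
move=> mf f01; exists (limsup_mean f).
have bs := bounded_measurable_limsup_mean mf f01.
split; [by case: bs|exact: limsup_mean01|exact: limsup_mean_invariant|].
pose f' x := 1 - f x.
have mf' : measurable_fun setT f' by exact: measurable_funB.
have f'01 x : 0 <= f' x <= 1.
  by rewrite /f'; have /andP[h0 h1] := f01 x; apply/andP; split; lra.
have bf : bounded_measurable f.
  by split=> //; exists 1 => x; have /andP[f0 f1] := f01 x; rewrite ger0_norm.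
have bs' := bounded_measurable_limsup_mean mf' f'01.
have orbit_mean' n x : orbit_mean f' n x = 1 - orbit_mean f n x.
  rewrite /orbit_mean /orbit_sum sumrB sumr_const card_ord mulrBr.
  by rewrite mulVf.
(* The upper limit minus the lower limit of the averages. *)
pose k x := limsup_mean f x - (1 - limsup_mean f' x).
have bk : bounded_measurable k.
  by apply: bounded_measurableB => //; apply: bounded_measurableB => //; exact: bounded_measurable_cst.
have k_ge0 x : 0 <= k x.
  rewrite subr_ge0; apply/ler_addgt0Pr => e e0; have e20 : 0 < e / 2 by rewrite divr_gt0.
  have bb n : `|orbit_mean f' n x| <= 1 by exact: norm_orbit_mean.
  have bb1 n : `|orbit_mean f n x| <= 1 by exact: norm_orbit_mean.
  have [N _ /(_ N (leqnn N))] := limn_sup_near bb1 e20.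
  move=> /= hN.
  have [N1 _ H1] := limn_sup_near bb1 e20.
  have [N2 _ H2] := limn_sup_near bb e20.
  have := H1 (maxn N1 N2) (leq_maxl _ _); have := H2 (maxn N1 N2) (leq_maxr _ _).
  rewrite /= orbit_mean' /limsup_mean; lra.
have k0 : \int[P]_x k x = 0.
  apply/eqP; rewrite eq_le Rintegral_ge0// andbT.
  have b1 := bounded_measurable_cst T (1 : R).
  have b2 := bounded_measurableB b1 bs'.
  rewrite /k (meanB P bs b2) (meanB P b1 bs') mean_cst.
  have h1 := mean_limsup_mean_le mf f01; have h2 := mean_limsup_mean_le mf' f'01.
  move: h2; rewrite (meanB P b1 bf) mean_cst; lra.
have : ae_eq P setT (EFin \o k) (cst 0%E).
  apply/(ae_eq_integral_abs P measurableT) => //.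
    by apply/measurable_EFinP; case: bk.
  have := k0; rewrite /Rintegral => kk.
  have ik := bounded_measurable_integrable P bk.
  under eq_integral do rewrite /= ger0_norm//.
  rewrite -[LHS]fineK; first by rewrite kk.
  exact: integrable_fin_num.
apply: filterS => x /(_ I) [] kx0.
rewrite /limsup_mean. apply: (@limn_sup_cvg _ _ 1) => [n|]; first exact: norm_orbit_mean.
have -> : (fun n => 1 - orbit_mean f n x) = orbit_mean f' ^~ x.
  by apply/funext => n; rewrite orbit_mean'.
by rewrite -subr_le0 -[leLHS]/(k x) kx0.
Qed.

End birkhoff.

(** * Visits and the return map *)

(** The map [s] is to be read as the shift, and [z i w] as the event that the
    walk with steps [w] is back at its starting point at time [i]; the
    hypothesis says that the walk then starts afresh. *)
Section return_times.
Context d (T : measurableType d).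
Variables (s : T -> T) (z : nat -> T -> bool).
Hypothesis zD : forall i j w, z i w -> z (i + j) w = z j (iter i s w).
Implicit Types (A : set T) (w : T).

Definition visits A n w : nat :=
  (\sum_(i < n) (z i.+1 w && (iter i.+1 s w \in A)))%N.

Definition first_return n w := z n.+1 w && [forall i : 'I_n, ~~ z i.+1 w].

(** A trajectory without return is left fixed, so that the map is total. *)
Definition return_map w : T :=
  if pselect (exists n, z n.+1 w) is left e then iter (ex_minn e).+1 s w else w.

Lemma first_return_exists w n : z n.+1 w -> exists2 t, (t <= n)%N & first_return t w.
Proof.
move=> zn; have [t zt tmin] := ex_minnP (ex_intro (fun n => z n.+1 w) n zn).
exists t; first exact: tmin.
rewrite /first_return zt/=; apply/forallP => i; apply/negP => /tmin.
by rewrite leqNgt ltn_ord.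
Qed.

Lemma return_mapE w n : first_return n w -> return_map w = iter n.+1 s w.
Proof.
move=> /andP[zn /forallP first]; rewrite /return_map.
case: pselect => [e|]; last by move=> ne; exfalso; apply: ne; exists n.
case: ex_minnP => m zm mmin; congr (iter _.+1 s w).
apply/eqP; rewrite eqn_leq mmin//= leqNgt; apply/negP => mn.
by have := first (Ordinal mn); rewrite zm.
Qed.

Lemma return_map_id w : (forall n, ~~ z n.+1 w) -> return_map w = w.
Proof.
move=> nz; rewrite /return_map; case: pselect => // -[n zn].
by have := nz n; rewrite zn.
Qed.

Lemma visitsD A k m w : z k w ->
  visits A (k + m) w = (visits A k w + visits A m (iter k s w))%N.
Proof.
move=> zk; rewrite /visits big_split_ord/=; congr addn.
apply: eq_bigr => i _; congr (nat_of_bool (_ && _)).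
  by rewrite -addnS zD.
by rewrite addnC iterD.
Qed.

Lemma visitsS A n w :
  visits A n.+1 w = (visits A n w + (z n.+1 w && (iter n.+1 s w \in A)))%N.
Proof. by rewrite /visits big_ord_recr. Qed.

Lemma visits_le A n m w : (n <= m)%N -> (visits A n w <= visits A m w)%N.
Proof.
apply: (@homo_leq _ (visits A ^~ w) leq) => // [|k]; first exact: leq_trans.
by rewrite visitsS leq_addr.
Qed.

Lemma visits_lipschitz A n k w : (visits A (k + n) w <= visits A n w + k)%N.
Proof.
elim: k => [|k IH]; first by rewrite addn0.
by rewrite addSn visitsS addnS -[(_ + k).+1]addn1 leq_add// leq_b1.
Qed.

Lemma visits_first n w : first_return n w -> visits setT n.+1 w = 1%N.
Proof.
move=> /andP[zn /forallP first]; rewrite visitsS zn in_setT/=.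
rewrite /visits big1 ?add0n// => i _.
by have /negbTE -> := first i.
Qed.

(** The visits of a trajectory form an orbit of [return_map]: a visit at time n
    is reached after as many returns as there are visits up to time n. *)
Lemma iter_return_map n w : z n w -> iter n s w = iter (visits setT n w) return_map w.
Proof.
elim/ltn_ind: n w => -[|n] IH w zn; first by rewrite /visits big_ord0.
have [t tn ft] := first_return_exists zn.
have zt : z t.+1 w by case/andP: ft.
have e : n.+1 = (t.+1 + (n - t))%N by rewrite addSn subnKC.
rewrite {2}e visitsD// visits_first// add1n [in RHS]iterSr (return_mapE ft).
rewrite -IH; first by rewrite -iterD addnS subnK.
  by rewrite ltnS leq_subr.
by rewrite -zD// -e.
Qed.

Lemma visits_return_map A n w :
  visits A n w = (\sum_(j < visits setT n w) (iter j.+1 return_map w \in A))%N.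
Proof.
elim: n => [|n IH]; first by rewrite /visits !big_ord0.
rewrite visitsS IH; case: (boolP (z n.+1 w)) => zn; last first.
  by rewrite (visitsS setT) (negbTE zn)/= !addn0.
have := iter_return_map zn; rewrite (visitsS setT) zn in_setT/= addn1 => ->.
by rewrite big_ord_recr.
Qed.

(** Restarting at the first return deletes one visit and shifts time by a
    number of steps which does not depend on n. *)
Lemma visits_of_return_map w : exists C : nat, forall n,
  (visits setT n (return_map w) <= visits setT n w + C)%N /\
  (visits setT n w <= visits setT n (return_map w) + C)%N.
Proof.
have [[n zn]|nz] := pselect (exists n, z n.+1 w); last first.
  exists 0%N => n; rewrite !addn0 return_map_id//.
  by move=> k; apply/negP => zk; apply: nz; exists k.
have [t _ ft] := first_return_exists zn.
exists t.+1 => m; have /andP[zt _] := ft.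
have e : visits setT (t.+1 + m) w = (1 + visits setT m (return_map w))%N.
  by rewrite visitsD// visits_first// (return_mapE ft).
have h1 := visits_lipschitz setT m t.+1 w.
have h2 : (visits setT m w <= visits setT (t.+1 + m) w)%N.
  by apply: visits_le; rewrite leq_addl.
rewrite e in h1 h2; split; first by rewrite (leq_trans _ h1)// leq_addl.
by rewrite (leq_trans h2)// addnC leq_add2l.
Qed.

Lemma return_map_invariantE (U : Type) (h : T -> U) :
  (forall w, h (return_map w) = h w) -> forall n w, z n w -> h (iter n s w) = h w.
Proof.
move=> hr n w zn; rewrite iter_return_map//.
by elim: (visits _ _ _) => //= k IH; rewrite hr.
Qed.

(** The powers of x telescope along the visits: the visit at time i + 1 changes
    x ^ r into x ^ (r + 1), where r is the number of the visits after it. *)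
Lemma indicator_recurrence (R : pzRingType) (x : R) A n w :
  1 - x ^+ visits A n w = (1 - x) * \sum_(i < n)
    (z i.+1 w && (iter i.+1 s w \in A))%:R * x ^+ visits A (n - i.+1) (iter i.+1 s w).
Proof.
have aux (b : nat -> bool) m : 1 - x ^+ (\sum_(i < m) b i)%N =
    (1 - x) * \sum_(i < m) (b i)%:R * x ^+ (\sum_(j < m - i.+1) b (i.+1 + j)%N)%N.
  elim: m b => [|m IH] b; first by rewrite !big_ord0 expr0 subrr mulr0.
  rewrite big_ord_recl [in RHS]big_ord_recl/= mulrDr.
  rewrite [X in _ = _ + _ * X](eq_bigr (fun i : 'I_m =>
    (b i.+1)%:R * x ^+ (\sum_(j < m - i.+1) b (i.+1 + j).+1)%N)); last by [].
  rewrite -(IH (fun i => b i.+1)) subn1/=.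
  rewrite [X in _ = (1 - x) * (_ * x ^+ X) + _](eq_bigr (fun i : 'I_m => b i.+1 : nat)); last by [].
  case: (b 0%N); rewrite ?mul0r ?mulr0 ?add0r ?add0n//=.
  rewrite mul1r exprD expr1 mulrBl mul1r.
  under eq_bigr => i _ do rewrite /bump add1n.
  by rewrite [RHS]addrC addrA subrK.
rewrite /visits (aux (fun i => z i.+1 w && (iter i.+1 s w \in A))); congr (_ * _); apply: eq_bigr => i _.
case: (boolP (z i.+1 w)) => zi; last by rewrite !mul0r.
congr (_ * x ^+ _); apply: eq_bigr => j _.
by rewrite -addnS zD// [(i.+1 + _)%N]addnC iterD.
Qed.

End return_times.

(** * Arrivals and recurrence *)

Section layers.
Context d (T : measurableType d) (R : realType).
Implicit Types h : T -> R.

Definition layer h (k i : nat) : set T := [set w | i.+1%:R <= k%:R * h w].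

(** An average of indicators within 1 / k of h.  Estimates known for events
    pass to functions with values in the unit interval by linearity. *)
Definition staircase h k w : R := k%:R^-1 * \sum_(i < k) \1_(layer h k i) w.

Lemma measurable_layer h k i : measurable_fun setT h -> measurable (layer h k i).
Proof.
move=> mh; rewrite (_ : layer h k i = (fun w => k%:R * h w) @^-1` `[i.+1%:R, +oo[).
  rewrite -[X in measurable X]setTI.
  by have := measurable_funM (@measurable_cst _ _ _ _ setT (k%:R : R)) mh; apply.
by apply/seteqP; split => w /=; rewrite in_itv/= andbT.
Qed.

Lemma staircase_approx h k w : 0 <= h w <= 1 ->
  `|h w - staircase h k.+1 w| <= k.+1%:R^-1.
Proof.
move=> /andP[h0 h1]; rewrite /staircase; set y := k.+1%:R * h w.
have k0 : 0 < (k.+1%:R : R) by rewrite ltr0n.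
have y0 : 0 <= y by exact: mulr_ge0 (ltW k0) h0.
have tk : (Num.Def.trunc y <= k.+1)%N.
  by rewrite -(@ler_nat R) (@le_trans _ _ y)// ?truncn_le// ler_piMr// ltW.
have -> : \sum_(i < k.+1) \1_(layer h k.+1 i) w = (Num.Def.trunc y)%:R :> R.
  have aux m t : (\sum_(i < m) (i < t) = minn m t)%N.
    elim: m => [|m IH]; first by rewrite big_ord0 min0n.
    by rewrite big_ord_recr/= IH; case: (ltnP m t) => mt /=; lia.
  rewrite -[in RHS](minn_idPr tk) -aux natr_sum; apply: eq_bigr => i _.
  rewrite indicE truncn_gt_nat; congr ((nat_of_bool _)%:R).
  by apply/idP/idP => [/set_mem|ih]; [|apply/mem_set].
rewrite -[h w](@mulKf _ k.+1%:R) ?gt_eqF// -/y -mulrBr normrM.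
rewrite (@ger0_norm _ k.+1%:R^-1) ?invr_ge0// -[leRHS]mulr1 ler_wpM2l ?invr_ge0//.
have /andP[t1 t2] := truncn_itv y0.
rewrite ger0_norm ?subr_ge0// lerBlDl (le_trans (ltW t2))// -natr1; lra.
Qed.

End layers.

Section prob_real.
Context d (T : measurableType d) (R : realType) (P : probability T R).
Implicit Types A B : set T.

Definition prob B : R := fine (P B).

Lemma probE B : measurable B -> (prob B)%:E = P B.
Proof. by move=> mB; rewrite /prob fineK// fin_num_measure. Qed.

Lemma prob_ge0 B : 0 <= prob B.
Proof. exact: fine_ge0. Qed.

Lemma prob_le A B : measurable A -> measurable B -> A `<=` B -> prob A <= prob B.
Proof.
by move=> mA mB AB; rewrite -lee_fin !probE//; apply: le_measure => //; rewrite inE.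
Qed.

Lemma prob_setC B : measurable B -> prob (~` B) = 1 - prob B.
Proof.
move=> mB; apply: EFin_inj; rewrite EFinB !probE//; last exact: measurableC.
exact: probability_setC.
Qed.

Lemma prob_setU A B : measurable A -> measurable B ->
  prob (A `|` B) <= prob A + prob B.
Proof.
move=> mA mB; rewrite -lee_fin EFinD !probE//; last exact: measurableU.
exact: measureU2.
Qed.

Lemma mean_indicE (B : set T) : measurable B -> \int[P]_w (\1_B w : R) = prob B.
Proof. exact: mean_indic. Qed.

End prob_real.

Lemma archi_le (R : realType) (x y C : R) :
  (forall k : nat, x <= y + C * k.+1%:R^-1) -> x <= y.
Proof.
move=> h; apply/ler_addgt0Pr => e e0.
have cv : y + C * k.+1%:R^-1 @[k --> \oo] --> y + C * 0.
  by apply: cvgD; [exact: cvg_cst|apply: cvgMr; exact: cvg_harmonic].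
rewrite mulr0 addr0 in cv.
rewrite -(cvg_lim _ cv)//; apply: (@le_trans _ _ (limn (fun k => y + C * k.+1%:R^-1))).
  by apply: limr_ge; [apply/cvg_ex; eexists; exact: cv|exact: nearW].
by rewrite lerDl ltW.
Qed.

Section recurrent_process.
Context d (T : measurableType d) (R : realType) (P : probability T R).
Variables (s : T -> T) (z : nat -> T -> bool).
Hypothesis ms : measurable_fun setT s.
Hypothesis sP : forall A, measurable A -> P (s @^-1` A) = P A.
Hypothesis mz : forall i, measurable [set w | z i w].
Hypothesis zD : forall i j w, z i w -> z (i + j) w = z j (iter i s w).
Hypothesis zB : forall i j w, z (i + j) w -> z j (iter i s w) -> z i w.
Implicit Types A B : set T.

Lemma measurable_iter_preimage i A : measurable A -> measurable (iter i s @^-1` A).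
Proof.
by move=> mA; rewrite -[X in measurable X]setTI; have [m _] := iter_preserving ms sP i; exact: m.
Qed.

Lemma prob_iter_preimage i A : measurable A -> prob P (iter i s @^-1` A) = prob P A.
Proof. by move=> mA; rewrite /prob; have [_ ->] := iter_preserving ms sP i. Qed.

Definition arrival A i : set T := [set w | z i w] `&` iter i s @^-1` A.

Lemma measurable_arrival A i : measurable A -> measurable (arrival A i).
Proof. by move=> mA; apply: measurableI => //; exact: measurable_iter_preimage. Qed.

Lemma arrivalE A i w : (\1_(arrival A i) w : R) = (z i w && (iter i s w \in A))%:R.
Proof.
rewrite indicE; congr ((nat_of_bool _)%:R); apply/idP/idP.
  by move=> /set_mem[/= -> ?]; rewrite mem_set.
by move=> /andP[zi /set_mem ?]; apply/mem_set; split.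
Qed.

Lemma arrival_indicM A i w : (z i w)%:R * \1_A (iter i s w) = \1_(arrival A i) w :> R.
Proof. by rewrite arrivalE indicE; case: (z i w); rewrite ?mul1r ?mul0r. Qed.

(** The relative form of the local limit theorem: v is nearly
    the probability of z at time i given the trajectory from time i on, as long
    as the latter lies in A, and one relative error serves for all of A. *)
Definition uniform_arrivals A i (v delta : R) := forall B, measurable B -> B `<=` A ->
  `|prob P (arrival B i) - v * prob P B| <= delta * v * prob P B.

Lemma bounded_measurable_z i : bounded_measurable (fun w => (z i w)%:R : R).
Proof.
rewrite (_ : (fun _ => _) = \1_[set w | z i w]); first exact: bounded_measurable_indic.
by apply/funext => w; rewrite indicE; congr ((nat_of_bool _)%:R); apply/idP/idP => [?|/set_mem//]; apply/mem_set.
Qed.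

Lemma uniform_arrivals_mean A i (v delta : R) (h : T -> R) : 0 <= v -> 0 <= delta ->
  uniform_arrivals A i v delta -> measurable_fun setT h ->
  (forall w, 0 <= h w <= 1) -> (forall w, ~ A w -> h w = 0) ->
  `|\int[P]_w ((z i w)%:R * h (iter i s w)) - v * \int[P]_w h w|
    <= delta * v * \int[P]_w h w.
Proof.
move=> v0 d0 hA mh h01 hA0.
pose C := 1 + v + delta * v.
have bz := bounded_measurable_z i.
have bh : bounded_measurable h.
  by split=> //; exists 1 => x; have /andP[? ?] := h01 x; rewrite ger0_norm.
have [mi _] := iter_preserving ms sP i.
have bhi := bounded_measurable_comp mi bh.
apply: (@archi_le _ _ _ C) => k.
set e := k.+1%:R^-1; have e0 : 0 <= e by rewrite invr_ge0.
pose g := staircase h k.+1.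
have ml j : measurable (layer h k.+1 j) by exact: measurable_layer.
have bl j : bounded_measurable (\1_(layer h k.+1 j) : T -> R) by exact: bounded_measurable_indic.
have bg : bounded_measurable g by apply: bounded_measurableZ; apply: bounded_measurable_sum.
have bgi := bounded_measurable_comp mi bg.
have hg w : `|h w - g w| <= e by exact: staircase_approx.
have close (f1 f2 : T -> R) : bounded_measurable f1 -> bounded_measurable f2 ->
    (forall w, `|f1 w - f2 w| <= e) -> `|\int[P]_w f1 w - \int[P]_w f2 w| <= e.
  move=> b1 b2 h12; rewrite -meanB// (le_trans (mean_norm _ (bounded_measurableB b1 b2)))//.
  rewrite -[leRHS](mean_cst P); apply: mean_le => //; last exact: bounded_measurable_cst.
  exact: bounded_measurable_norm (bounded_measurableB b1 b2).
have h1 := close _ _ bh bg hg.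
have h2 : `|\int[P]_w ((z i w)%:R * h (iter i s w)) -
            \int[P]_w ((z i w)%:R * g (iter i s w))| <= e.
  apply: close; [exact: bounded_measurableM|exact: bounded_measurableM|] => w.
  rewrite -mulrBr normrM (le_trans _ (hg (iter i s w)))// ler_piMl//.
  by case: (z i w); rewrite ?normr1 ?normr0.
have lA j : layer h k.+1 j `<=` A.
  move=> w; apply: contraPP => nAw; rewrite /layer/= hA0// mulr0; apply/negP.
  by rewrite -ltNge ltr0n.
have Eg : \int[P]_w g w = e * \sum_(j < k.+1) prob P (layer h k.+1 j).
  rewrite /g /staircase meanZ ?mean_sum//; last exact: bounded_measurable_sum.
  by congr (_ * _); apply: eq_bigr => j _; rewrite mean_indicE.
have Ezg : \int[P]_w ((z i w)%:R * g (iter i s w)) =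
    e * \sum_(j < k.+1) prob P (arrival (layer h k.+1 j) i).
  have ba j : bounded_measurable (\1_(arrival (layer h k.+1 j) i) : T -> R).
    exact/bounded_measurable_indic/measurable_arrival.
  transitivity (\int[P]_w (e * \sum_(j < k.+1) \1_(arrival (layer h k.+1 j) i) w)).
    apply: eq_Rintegral => w _; rewrite /g /staircase mulrCA big_distrr/=.
    by congr (_ * _); apply: eq_bigr => j _; rewrite arrival_indicM.
  rewrite meanZ ?mean_sum//; last exact: bounded_measurable_sum.
  by congr (_ * _); apply: eq_bigr => j _; rewrite mean_indicE//; exact: measurable_arrival.
have h3 : `|\int[P]_w ((z i w)%:R * g (iter i s w)) - v * \int[P]_w g w|
    <= delta * v * \int[P]_w g w.
  rewrite Ezg Eg mulrCA -mulrBr normrM (ger0_norm e0) [leRHS]mulrCA ler_wpM2l//.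
  rewrite !big_distrr/= -sumrB (le_trans (ler_norm_sum _ _ _))//.
  by apply: ler_sum => j _; exact: hA.
move: h1 h2 h3; rewrite /C !ler_norml.
move: (\int[P]_w h w) (\int[P]_w g w) (\int[P]_w ((z i w)%:R * h (iter i s w)))
  (\int[P]_w ((z i w)%:R * g (iter i s w))) => a b p q.
move=> /andP[a1 a2] /andP[b1 b2] /andP[c1 c2].
have v1 : v * b <= v * (a + e) by apply: ler_wpM2l => //; lra.
have v2 : v * (a - e) <= v * b by apply: ler_wpM2l => //; lra.
have dv : 0 <= delta * v by exact: mulr_ge0.
have v3 : delta * v * b <= delta * v * (a + e) by apply: ler_wpM2l => //; lra.
apply/andP; split; lra.
Qed.

Lemma visits_indic A n w :
  (visits s z A n w)%:R = \sum_(i < n) \1_(arrival A i.+1) w :> R.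
Proof.
by rewrite /visits natr_sum; apply: eq_bigr => i _; rewrite arrivalE.
Qed.

Lemma bounded_measurable_visits A n : measurable A ->
  bounded_measurable (fun w => (visits s z A n w)%:R : R).
Proof.
move=> mA; under eq_fun do rewrite visits_indic.
by apply: bounded_measurable_sum => i; exact/bounded_measurable_indic/measurable_arrival.
Qed.

Lemma mean_visits A n : measurable A ->
  \int[P]_w ((visits s z A n w)%:R : R) = \sum_(i < n) prob P (arrival A i.+1).
Proof.
move=> mA; under eq_Rintegral do rewrite visits_indic.
rewrite mean_sum => [|i]; last exact/bounded_measurable_indic/measurable_arrival.
by apply: eq_bigr => i _; rewrite mean_indicE//; exact: measurable_arrival.
Qed.

Definition never_returns : set T := [set w | forall n, ~~ z n.+1 w].

Lemma measurable_never_returns : measurable never_returns.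
Proof.
rewrite (_ : never_returns = \bigcap_n ~` [set w | z n.+1 w]).
  by apply: bigcap_measurable => // n _; exact: measurableC.
by apply/seteqP; split => w h n //=; [move=> _; apply/negP; exact: h | apply/negP; exact: h].
Qed.

(** A trajectory that never returns after a visit has no later visit. *)
Lemma visits_never_returns A n w : A `<=` never_returns -> (visits s z A n w <= 1)%N.
Proof.
move=> AW; elim: n => [|n IH]; first by rewrite /visits big_ord0.
rewrite visitsS; case: (boolP (z n.+1 w && _)) => [/andP[zn _]|]; last by rewrite addn0.
rewrite /visits big1// => i _.
apply/eqP; rewrite eqb0; apply/negP => /andP[zi /set_mem/AW nr].
have := nr (n - i.+1)%N; rewrite -zD//.
have -> : (i.+1 + (n - i.+1).+1 = n.+1)%N by rewrite addnS subnKC.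
by rewrite zn.
Qed.

Variable u : nat -> R.
Hypothesis u_gt0 : forall i, 0 < u i.+1.
Definition partial_sums n : R := \sum_(i < n) u i.+1.
Hypothesis u_div : partial_sums n @[n --> \oo] --> +oo.
Hypothesis u_visits : forall delta, 0 < delta -> exists A N,
  [/\ measurable A, prob P (~` A) <= delta &
  forall i, (N <= i)%N -> uniform_arrivals A i.+1 (u i.+1) delta].

(** Otherwise the expected number of visits to a subset A of positive
    probability of the non-returning trajectories, which is at most 1, would
    grow like a multiple of the divergent sums of u. *)
Lemma prob_never_returns : prob P never_returns = 0.
Proof.
have mW := measurable_never_returns.
apply/eqP; rewrite eq_le prob_ge0 andbT; apply/ler_addgt0Pr => e e0; rewrite add0r.
(* An error below 1 / 2 keeps half of the expected number of arrivals. *)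
have d0 : 0 < Num.min e (1 / 2) by rewrite lt_min e0; lra.
have [A [N [mA PA hA]]] := u_visits d0.
have de : Num.min e (1 / 2) <= e by rewrite ge_min lexx.
have d2 : Num.min e (1 / 2) <= 1 / 2 by rewrite ge_min lexx orbT.
move: (Num.min _ _) d0 PA hA de d2 => dl d0 PA hA de d2.
have mWA : measurable (never_returns `&` A) by exact: measurableI.
suff WA0 : prob P (never_returns `&` A) = 0.
  apply: le_trans (_ : prob P (never_returns `&` A) + prob P (~` A) <= _).
    apply: le_trans (prob_setU P _ _) => //; last exact: measurableC.
    apply: prob_le => //; first by apply: measurableU => //; exact: measurableC.
    by move=> w Ww; have [Aw|] := pselect (A w); [left|right].
  by rewrite WA0 add0r (le_trans PA).
apply/eqP; rewrite eq_le prob_ge0 andbT leNgt; apply/negP.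
set p := prob P _ => p0.
move/cvgryPge : u_div => /(_ (partial_sums N + 2 / p + 1)) [n0 _ hn].
have := hn (maxn N n0) (leq_maxr _ _); set n := maxn _ _ => /= {hn}; apply/negP.
have Nn : (N <= n)%N by exact: leq_maxl.
rewrite -ltNge.
have h1 : \sum_(i < n) prob P (arrival (never_returns `&` A) i.+1) <= 1.
  rewrite -mean_visits// -[leRHS](mean_cst P); apply: mean_le.
  - exact: bounded_measurable_visits.
  - exact: bounded_measurable_cst.
  by move=> w; rewrite lern1; apply: visits_never_returns => x [].
have h2 : (1 / 2 * p) * (partial_sums n - partial_sums N) <=
    \sum_(i < n) prob P (arrival (never_returns `&` A) i.+1).
  rewrite -(big_mkord xpredT (fun i => prob P (arrival _ i.+1))).
  rewrite /partial_sums -!(big_mkord xpredT (fun i => u i.+1)).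
  have splitN (F : nat -> R) : \sum_(0 <= i < n) F i =
      \sum_(0 <= i < N) F i + \sum_(N <= i < n) F i.
    by rewrite (big_cat_nat (leq0n N) Nn).
  rewrite [leRHS]splitN [X in _ * (X - _)]splitN addrAC subrr add0r.
  apply: ler_wpDl; first by apply: sumr_ge0 => i _; exact: prob_ge0.
  rewrite big_distrr/= big_nat_cond [leRHS]big_nat_cond; apply: ler_sum => i /andP[/andP[Ni _] _].
  have := hA i Ni _ mWA; rewrite -/p => /(_ (@subIsetr _ _ _)); rewrite ler_norml => /andP[h _].
  have : dl * (u i.+1 * p) <= 1 / 2 * (u i.+1 * p).
    by apply: ler_wpM2r => //; rewrite mulr_ge0// ltW.
  lra.
have := le_trans h2 h1; rewrite -ler_pdivlMl; last by rewrite mulr_gt0//; lra.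
rewrite (_ : _^-1 * 1 = 2 / p); first by lra.
by rewrite mulr1 invfM div1r invrK.
Qed.

End recurrent_process.

(** * Invariance of the probability under the return map *)

Lemma sum_exclusive (n : nat) (b : 'I_n -> bool) (c : bool) :
  (forall i, b i -> c) -> (forall i j : 'I_n, (i < j)%N -> b i -> ~~ b j) ->
  (\sum_(i < n) b i <= c)%N.
Proof.
move=> bc excl; have [/existsP[i bi]|] := boolP [exists i, b i]; last first.
  by rewrite negb_exists => /forallP h; rewrite big1// => i _; rewrite (negbTE (h i)).
rewrite (bigD1 i)//= big1 ?addn0 => [|j ji]; first by rewrite bi (bc i bi).
apply/eqP; rewrite eqb0; apply/negP => bj; case: (ltngtP i j) => [ij|ij|/ord_inj ij].
- by have := excl i j ij bi; rewrite bj.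
- by have := excl j i ij bj; rewrite bi.
- by rewrite ij eqxx in ji.
Qed.

Section return_map_measure.
Context d (T : measurableType d) (R : realType) (P : probability T R).
Variables (s : T -> T) (z : nat -> T -> bool).
Hypothesis ms : measurable_fun setT s.
Hypothesis sP : forall A, measurable A -> P (s @^-1` A) = P A.
Hypothesis mz : forall i, measurable [set w | z i w].
Hypothesis zB : forall i j w, z (i + j) w -> z j (iter i s w) -> z i w.
Implicit Types A B C : set T.

Let hit C n : set T := [set w | first_return z n w] `&` iter n.+1 s @^-1` C.

Let measurable_hit C n : measurable C -> measurable (hit C n).
Proof.
move=> mC; apply: measurableI; last exact: (measurable_iter_preimage ms sP).
rewrite (_ : mkset _ = [set w | z n.+1 w] `&` \bigcap_(i in `I_n) ~` [set w | z i.+1 w]).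
  by apply: measurableI => //; apply: bigcap_measurableType => i _; exact: measurableC.
apply/seteqP; split => w /=.
  move=> /andP[zn /forallP h]; split=> // i /= ni; apply/negP; exact: (h (Ordinal ni)).
move=> [zn h]; rewrite /first_return zn/=; apply/forallP => i; apply/negP.
exact: (h i (ltn_ord i)).
Qed.

Lemma return_map_preimage C : return_map s z @^-1` C =
  (never_returns z `&` C) `|` \bigcup_n hit C n.
Proof.
apply/seteqP; split => w /=.
  have [[n zn] Cr|nz] := pselect (exists n, z n.+1 w).
    have [t _ ft] := first_return_exists zn; right; exists t => //; split=> //.
    by move: Cr; rewrite (return_mapE s ft).
  have nw : never_returns z w by move=> n; apply/negP => zn; apply: nz; exists n.
  by rewrite return_map_id// => Cw; left.
by move=> [[nw Cw]|[n _ [/= fn]]]; [rewrite return_map_id|rewrite (return_mapE s fn)].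
Qed.

Lemma measurable_return_map : measurable_fun setT (return_map s z).
Proof.
move=> _ C mC; rewrite setTI return_map_preimage; apply: measurableU.
  by apply: measurableI => //; exact: measurable_never_returns.
by apply: bigcup_measurable => n _; exact: measurable_hit.
Qed.

(** Shifted to a common final time N, the events that a trajectory enters C at
    its first return exclude each other: among the times before N at which the
    walk is at its final level, only the last one has N as its first return. *)
Let sum_hit C N : measurable C -> \sum_(n < N) prob P (hit C n) <= prob P C.
Proof.
move=> mC.
have mh n : measurable (iter (N - n.+1) s @^-1` hit C n).
  by apply: (measurable_iter_preimage ms sP); exact: measurable_hit.
have mN : measurable (iter N s @^-1` C) by exact: (measurable_iter_preimage ms sP).
rewrite -(prob_iter_preimage ms sP N mC) -mean_indicE//.
rewrite (eq_bigr (fun n : 'I_N => \int[P]_w (\1_(iter (N - n.+1) s @^-1` hit C n) w : R))); last first.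
  by move=> n _; rewrite mean_indicE// prob_iter_preimage//; exact: measurable_hit.
rewrite -mean_sum => [|n]; last exact: bounded_measurable_indic.
apply: mean_le.
- by apply: bounded_measurable_sum => n; exact: bounded_measurable_indic.
- exact: bounded_measurable_indic.
move=> w; rewrite indicE; under eq_bigr do rewrite indicE.
rewrite -natr_sum ler_nat; apply: sum_exclusive => [n|n m nm].
  move=> /set_mem[/= _]; rewrite -iterS -iterD subnKC => [?|]; last exact: ltn_ord.
  exact/mem_set.
move=> /set_mem[/= /andP[zn _] _]; apply/negP => /set_mem[/= /andP[zm /forallP fm] _].
have e : (N - n.+1 = (m - n.+1).+1 + (N - m.+1))%N.
  have := ltn_ord m; have := ltn_ord n; lia.
have lt : (m - n.+1 < m)%N by lia.
have := fm (Ordinal lt); apply/negP; rewrite negbK/=.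
apply: (zB (j := n.+1)); last by rewrite -iterD -e.
by rewrite (_ : ((m - n.+1).+1 + n.+1 = m.+1)%N)//; lia.
Qed.

Hypothesis nr0 : prob P (never_returns z) = 0.

Let prob_return_map_le C : measurable C ->
  prob P (return_map s z @^-1` C) <= prob P C.
Proof.
move=> mC; have mnC : measurable (never_returns z `&` C).
  by apply: measurableI => //; exact: measurable_never_returns.
have mU : measurable (\bigcup_n hit C n).
  by apply: bigcup_measurable => n _; exact: measurable_hit.
rewrite return_map_preimage (le_trans (prob_setU P mnC mU))//.
have -> : prob P (never_returns z `&` C) = 0.
  apply/eqP; rewrite eq_le prob_ge0 andbT -nr0; apply: prob_le => //.
  exact: measurable_never_returns.
rewrite add0r -lee_fin !probE//.
apply: (@le_trans _ _ (\sum_(0 <= n <oo) P (hit C n))%E).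
  by apply: measure_sigma_subadditive => // n; exact: measurable_hit.
apply: lime_le; first by apply: is_cvg_nneseries.
apply: nearW => N; rewrite -probE// big_mkord.
rewrite (eq_bigr (fun n : 'I_N => (prob P (hit C n))%:E)); last first.
  by move=> n _; rewrite probE//; exact: measurable_hit.
by rewrite sumEFin lee_fin; exact: sum_hit.
Qed.

(** The inequality between the two measures holds for a set and for its
    complement, hence is an equality. *)
Lemma return_map_preserving C : measurable C -> P (return_map s z @^-1` C) = P C.
Proof.
move=> mC; have mr := measurable_return_map.
have mrp D : measurable D -> measurable (return_map s z @^-1` D).
  by move=> mD; rewrite -[X in measurable X]setTI; exact: mr.
rewrite -!(probE P)//; last exact: mrp.
congr EFin; apply/eqP; rewrite eq_le prob_return_map_le//=.
have := prob_return_map_le (measurableC mC).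
by rewrite preimage_setC !prob_setC//; [lra|exact: mrp].
Qed.

End return_map_measure.

(** * The renewal inequality *)

Lemma expr_geometric_le1 (R : realType) (x : R) n : 0 <= x <= 1 ->
  n%:R * (1 - x) * x ^+ n <= 1.
Proof.
move=> /andP[x0 x1].
apply: (@le_trans _ _ (1 - x ^+ n)); last by rewrite gerBl exprn_ge0.
rewrite -(opprB (x ^+ n)) subrX1 -mulNr opprB mulrAC mulrC ler_wpM2l ?subr_ge0//.
apply: (@le_trans _ _ (\sum_(i < n) x ^+ n)).
  by rewrite sumr_const card_ord mulr_natl.
by apply: ler_sum => i _; apply: ler_wiXn2l => //; exact: ltnW.
Qed.

Lemma bernoulli_ineq (R : realType) (x : R) n : 0 <= x <= 1 ->
  1 - x ^+ n <= n%:R * (1 - x).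
Proof.
move=> /andP[x0 x1].
rewrite -(opprB (x ^+ n)) subrX1 -mulNr opprB mulrC ler_wpM2r ?subr_ge0//.
apply: (@le_trans _ _ (\sum_(i < n) 1)); last by rewrite sumr_const card_ord.
by apply: ler_sum => i _; rewrite exprn_ile1.
Qed.

(** A relatively small increase of the exponent changes x ^ a little, whatever
    x is: x ^ a (1 - x ^ b) is at most b (1 - x) x ^ a, and a (1 - x) x ^ a is at
    most 1. *)
Lemma exprB_ratio_le (R : realType) (x c : R) a b : 0 <= x <= 1 -> 0 <= c ->
  b%:R <= c * a%:R -> x ^+ a - x ^+ (a + b) <= c.
Proof.
move=> x01 c0 bca; have /andP[x0 x1] := x01.
rewrite exprD -{1}[x ^+ a]mulr1 -mulrBr.
apply: (@le_trans _ _ (x ^+ a * (b%:R * (1 - x)))).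
  by rewrite ler_wpM2l ?exprn_ge0//; exact: bernoulli_ineq.
apply: (@le_trans _ _ (x ^+ a * (c * a%:R * (1 - x)))).
  by rewrite ler_wpM2l ?exprn_ge0// ler_wpM2r// subr_ge0.
have := expr_geometric_le1 a x01; move/(ler_wpM2l c0); rewrite mulr1; apply: le_trans.
by rewrite le_eqVlt; apply/orP; left; apply/eqP; ring.
Qed.

Section renewal.
Context d (T : measurableType d) (R : realType) (P : probability T R).
Variables (s : T -> T) (z : nat -> T -> bool).
Hypothesis ms : measurable_fun setT s.
Hypothesis sP : forall A, measurable A -> P (s @^-1` A) = P A.
Hypothesis mz : forall i, measurable [set w | z i w].
Hypothesis zD : forall i j w, z i w -> z (i + j) w = z j (iter i s w).
Hypothesis zB : forall i j w, z (i + j) w -> z j (iter i s w) -> z i w.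
Variable u : nat -> R.
Hypothesis u_gt0 : forall i, 0 < u i.+1.
Hypothesis u_div : partial_sums u n @[n --> \oo] --> +oo.
Hypothesis u_visits : forall delta, 0 < delta -> exists A N,
  [/\ measurable A, prob P (~` A) <= delta &
  forall i, (N <= i)%N -> uniform_arrivals P s z A i.+1 (u i.+1) delta].
Implicit Types A B : set T.

Let ret := return_map s z.

Let mret : measurable_fun setT ret.
Proof. exact: (measurable_return_map ms sP mz). Qed.

Let retP A : measurable A -> P (ret @^-1` A) = P A.
Proof.
move=> mA; apply: (return_map_preserving ms sP mz zB) => //.
exact: (prob_never_returns ms sP mz zD u_gt0 u_div u_visits).
Qed.

Variable h : T -> R.
Hypotheses (mh : measurable_fun setT h) (h01 : forall w, 0 <= h w <= 1).

(** With x = exp (- lambda), the Laplace transform at lambda of the number of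
    visits to A under the density h. *)
Definition laplace_visits A (x : R) m : R := \int[P]_w (h w * x ^+ visits s z A m w).

Section fixed_x.
Variables (x : R) (x01 : 0 <= x <= 1).

Let bh : bounded_measurable h.
Proof. by split=> //; exists 1 => w; have /andP[? ?] := h01 w; rewrite ger0_norm. Qed.

Let pow01 k : 0 <= x ^+ k <= 1.
Proof. by move: x01 => /andP[x0 x1]; rewrite exprn_ge0//= exprn_ile1. Qed.

Lemma bounded_measurable_exp_visits A m : measurable A ->
  bounded_measurable (fun w => x ^+ visits s z A m w).
Proof.
move=> mA; split; last first.
  by exists 1 => w; have /andP[p0 p1] := pow01 (visits s z A m w); rewrite ger0_norm.
have [mv _] := bounded_measurable_visits ms sP mz m mA.
have -> : (fun w => x ^+ visits s z A m w) =
    (fun w => \sum_(k < m.+1) x ^+ k * \1_[set w | visits s z A m w = k :> nat] w).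
  apply/funext => w; have vm : (visits s z A m w < m.+1)%N.
    rewrite ltnS (leq_trans (leq_sum _ (fun i _ => leq_b1 _)))//.
    by rewrite sum1_card card_ord.
  rewrite (bigD1 (Ordinal vm))//= indicE mem_set// mulr1 big1 ?addr0// => k.
  move=> kv; rewrite indicE memNset ?mulr0//= => e; move/eqP: kv; apply.
  by apply/val_inj => /=.
have [] // : bounded_measurable (fun w => \sum_(k < m.+1) x ^+ k * (\1_[set w | visits s z A m w = k :> nat] w : R)).
apply: bounded_measurable_sum => k; apply/bounded_measurableZ/bounded_measurable_indic.
rewrite (_ : mkset _ = (fun w => (visits s z A m w)%:R : R) @^-1` [set k%:R]).
  by rewrite -[X in measurable X]setTI; apply: mv.
by apply/seteqP; split => w /=; [move=> ->|move/eqP; rewrite eqr_nat => /eqP].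
Qed.

Lemma bounded_measurable_laplace A m : measurable A ->
  bounded_measurable (fun w => h w * x ^+ visits s z A m w).
Proof. by move=> mA; apply: bounded_measurableM => //; exact: bounded_measurable_exp_visits. Qed.

Lemma laplace01 A m w : 0 <= h w * x ^+ visits s z A m w <= 1.
Proof.
have /andP[h0 h1] := h01 w; have /andP[p0 p1] := pow01 (visits s z A m w).
by rewrite mulr_ge0//= mulr_ile1.
Qed.

Lemma laplace_visits01 A m : measurable A -> 0 <= laplace_visits A x m <= 1.
Proof.
move=> mA; rewrite Rintegral_ge0/= => [|w _]; last by case/andP: (laplace01 A m w).
rewrite -[leRHS](mean_cst P); apply: mean_le.
- exact: bounded_measurable_laplace.
- exact: bounded_measurable_cst.
by move=> w; case/andP: (laplace01 A m w).
Qed.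

Lemma laplace_visits_nonincreasing A m n : measurable A -> (m <= n)%N ->
  laplace_visits A x n <= laplace_visits A x m.
Proof.
move=> mA mn; apply: mean_le; [exact: bounded_measurable_laplace|exact: bounded_measurable_laplace|].
move=> w; have /andP[h0 _] := h01 w; rewrite ler_wpM2l//.
by move: x01 => /andP[x0 x1]; apply: ler_wiXn2l => //; exact: visits_le.
Qed.

Hypothesis h_ret : forall w, h (ret w) = h w.

(** The mean of [indicator_recurrence].  A visit to A at time i + 1 is decoupled
    from the later visits by [uniform_arrivals], applied to h x ^ (number of
    later visits) on A; h keeps its value at a visit by invariance.  The first N
    terms are bounded trivially, and leaving A costs at most delta each time. *)
Lemma renewal_ineq A N delta m : measurable A -> 0 <= delta ->
  prob P (~` A) <= delta ->
  (forall i, (N <= i)%N -> uniform_arrivals P s z A i.+1 (u i.+1) delta) ->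
  `|\int[P]_w h w - laplace_visits A x m -
    (1 - x) * \sum_(i < m) u i.+1 * laplace_visits A x (m - i.+1)| <=
  (1 - x) * (N%:R + partial_sums u N + 2 * delta * partial_sums u m).
Proof.
move=> mA d0 PA hA; have /andP[x0 x1] := x01.
pose f j w := \1_A w * (h w * x ^+ visits s z A j w).
have bA := bounded_measurable_indic R mA.
have bf j : bounded_measurable (f j).
  by apply: bounded_measurableM => //; exact: bounded_measurable_laplace.
have f01 j w : 0 <= f j w <= 1.
  have /andP[l0 l1] := laplace01 A j w.
  by rewrite /f indicE; case: (w \in A); rewrite ?mul1r ?mul0r ?lexx ?ler01 ?l0.
pose I j i := \int[P]_w ((z i w)%:R * f j (iter i s w)).
have bI j i : bounded_measurable (fun w => (z i w)%:R * f j (iter i s w)).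
  apply: bounded_measurableM; first exact: bounded_measurable_z.
  by apply: bounded_measurable_comp => //; have [] := iter_preserving ms sP i.
have -> : \int[P]_w h w - laplace_visits A x m =
    (1 - x) * \sum_(i < m) I (m - i.+1)%N i.+1.
  rewrite /laplace_visits -meanB//; last exact: bounded_measurable_laplace.
  rewrite -mean_sum => [|i]; last exact: bI.
  rewrite -meanZ; last by apply: bounded_measurable_sum => i; exact: bI.
  apply: eq_Rintegral => w _.
  rewrite -[X in X - _]mulr1 -mulrBr (indicator_recurrence zD) mulrCA; congr (_ * _).
  rewrite big_distrr/=; apply: eq_bigr => i _; rewrite /f indicE.
  case: (boolP (z i.+1 w)) => zi /=; last by rewrite !mul0r mulr0.
  rewrite (return_map_invariantE zD h_ret zi) mul1r.
  by case: (_ \in A); rewrite ?mul1r ?mul0r ?mulr0.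
rewrite -mulrBr -sumrB normrM ger0_norm ?subr_ge0// ler_wpM2l ?subr_ge0//.
have term i : (i < m)%N ->
    `|I (m - i.+1)%N i.+1 - u i.+1 * laplace_visits A x (m - i.+1)| <=
    (i < N)%:R * (1 + u i.+1) + 2 * delta * u i.+1.
  move=> im; set j := (m - i.+1)%N.
  have u0 := u_gt0 i.
  have v01 := laplace_visits01 j mA.
  have I01 : 0 <= I j i.+1 <= 1.
    rewrite Rintegral_ge0 => [|w _]; last first.
      by apply: mulr_ge0; rewrite ?ler0n//; case/andP: (f01 j (iter i.+1 s w)).
    rewrite -[leRHS](mean_cst P); apply: mean_le => //; first exact: bounded_measurable_cst.
    move=> w; have /andP[? ?] := f01 j (iter i.+1 s w).
    by case: (z i.+1 w); rewrite ?mul1r ?mul0r.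
  have du : 0 <= 2 * delta * u i.+1 by rewrite !mulr_ge0// ltW.
  case: ltnP => iN; rewrite ?mul1r ?mul0r ?add0r.
    move: v01 I01 => /andP[v0 v1] /andP[I0 I1].
    have uv0 : 0 <= u i.+1 * laplace_visits A x j by rewrite mulr_ge0// ltW.
    have uv1 : u i.+1 * laplace_visits A x j <= u i.+1 by rewrite ler_piMr// ltW.
    rewrite ler_norml; apply/andP; split; lra.
  have f0 w : ~ A w -> f j w = 0 by move=> nA; rewrite /f indicE memNset// mul0r.
  have := @uniform_arrivals_mean _ _ _ P _ _ ms sP mz A i.+1 (u i.+1) delta (f j)
    (ltW u0) d0 (hA i iN) (proj1 (bf j)) (f01 j) f0.
  rewrite -/(I j i.+1) => hI.
  have J1 : \int[P]_w f j w <= 1.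
    rewrite -[leRHS](mean_cst P); apply: mean_le => //; first exact: bounded_measurable_cst.
    by move=> w; case/andP: (f01 j w).
  have Jv : \int[P]_w f j w <= laplace_visits A x j.
    apply: mean_le => //; first exact: bounded_measurable_laplace.
    move=> w; have /andP[? ?] := laplace01 A j w.
    by rewrite /f indicE; case: (w \in A); rewrite ?mul1r ?mul0r.
  have vJ : laplace_visits A x j <= \int[P]_w f j w + delta.
    rewrite (le_trans _ (_ : \int[P]_w f j w + prob P (~` A) <= _)) ?lerD2l//.
    have mCA := measurableC mA; rewrite -mean_indicE//.
    have bCA := bounded_measurable_indic R mCA.
    rewrite -meanD//; apply: mean_le.
    - exact: bounded_measurable_laplace.
    - exact: bounded_measurableD.
    move=> w; have /andP[? ?] := laplace01 A j w.
    rewrite /f !indicE in_setC; case: (w \in A); rewrite ?mul1r ?mul0r ?addr0 ?add0r//.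
  have uJ1 : delta * u i.+1 * (\int[P]_w f j w) <= delta * u i.+1.
    by rewrite ler_piMr// mulr_ge0// ltW.
  have uJv : u i.+1 * (\int[P]_w f j w) <= u i.+1 * laplace_visits A x j.
    by rewrite ler_wpM2l// ltW.
  have uvJ : u i.+1 * laplace_visits A x j <= u i.+1 * (\int[P]_w f j w) + u i.+1 * delta.
    by rewrite -mulrDr ler_wpM2l// ltW.
  move: hI; rewrite !ler_norml => /andP[a b]; apply/andP; split; lra.
rewrite (le_trans (ler_norm_sum _ _ _))//.
rewrite (le_trans (ler_sum _ (fun (i : 'I_m) _ => term i (ltn_ord i))))//.
rewrite big_split/= -big_distrr/= lerD2r.
have -> : N%:R + partial_sums u N = \sum_(i < N) (1 + u i.+1).
  by rewrite big_split/= sumr_const card_ord.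
rewrite -(big_mkord xpredT (fun i => (i < N)%:R * (1 + u i.+1))).
rewrite -(big_mkord xpredT (fun i => 1 + u i.+1)).
have pos i : 0 <= 1 + u i.+1 by rewrite addr_ge0// ltW.
case: (leqP m N) => mN.
  rewrite (big_cat_nat (leq0n m) mN)/= ler_wpDr//; first exact: sumr_ge0.
  by apply: ler_sum => i _; rewrite ler_piMl//; case: (_ < _)%N.
rewrite (big_cat_nat (leq0n N) (ltnW mN))/= [X in _ + X]big_nat_cond.
rewrite [X in _ + X]big1 ?addr0 => [|i /andP[/andP[Ni _] _]]; last first.
  by rewrite ltnNge Ni mul0r.
by apply: ler_sum => i _; rewrite ler_piMl//; case: (_ < _)%N.
Qed.

(** The visits are an orbit of [return_map].  By the maximal ergodic theorem,
    outside an event of probability eta at most a fraction eta of the visits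
    lies outside A, simultaneously for all times, and then [exprB_ratio_le]
    compares the two powers of x. *)
Lemma laplace_visits_restrict A eta m : measurable A -> 0 < eta -> eta <= 1 / 2 ->
  prob P (~` A) <= eta ^+ 2 ->
  `|laplace_visits setT x m - laplace_visits A x m| <= 3 * eta.
Proof.
move=> mA e0 e12 PA; have mCA := measurableC mA.
(* The first visit is the image of w under the return map, so the orbit to be
   controlled starts at ret w: hence the preimage E below. *)
pose E' := [set w | exists n, n%:R * eta < orbit_sum ret (\1_(~` A) : T -> R) n w].
have := maximal_frequency mret retP eta mCA; rewrite -/(prob P _) -/(prob P _).
rewrite -/E' => PE'.
have mE' : measurable E'.
  have -> : E' = \bigcup_n [set w | n%:R * eta < orbit_sum ret (\1_(~` A) : T -> R) n w].
    by apply/seteqP; split => w /=; [move=> [n ?]; exists n | move=> [n _ ?]; exists n].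
  apply: bigcup_measurable => n _.
  have [mo _] : bounded_measurable (orbit_sum ret (\1_(~` A) : T -> R) n).
    apply: bounded_measurable_sum => i.
    by apply: (bounded_measurable_iter mret retP); exact: bounded_measurable_indic.
  rewrite (_ : mkset _ = orbit_sum ret \1_(~` A) n @^-1` `]n%:R * eta, +oo[).
    by rewrite -[X in measurable X]setTI; exact: mo.
  by apply/seteqP; split => w /=; rewrite in_itv/= andbT.
pose E := ret @^-1` E'.
have mE : measurable E by rewrite -[X in measurable X]setTI; exact: mret.
have PE : prob P E <= eta.
  rewrite /prob /E retP// -(ler_pM2l e0) (le_trans PE')//.
have bE := bounded_measurable_indic R mE.
have bT := @bounded_measurable_laplace setT m measurableT.
have bA := bounded_measurable_laplace m mA.
have key w : 0 <= h w * x ^+ visits s z A m w - h w * x ^+ visits s z setT m w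
    <= 2 * eta + \1_E w.
  have /andP[h0 h1] := h01 w.
  have vE : visits s z setT m w = (visits s z A m w + visits s z (~` A) m w)%N.
    rewrite /visits -big_split/=; apply: eq_bigr => i _; rewrite in_setC in_setT.
    by case: (z i.+1 w) => //=; case: (_ \in A).
  have /andP[x0 x1] := x01.
  apply/andP; split.
    rewrite subr_ge0 ler_wpM2l//; apply: ler_wiXn2l => //.
    by rewrite vE leq_addr.
  rewrite -mulrBr indicE; have [Ew|nE] := pselect (E w).
    rewrite mem_set// mulr1n.
    have /andP[p0 p1] := pow01 (visits s z A m w).
    have /andP[q0 q1] := pow01 (visits s z setT m w).
    apply: (@le_trans _ _ (1 * 1)); last lra.
    have [s0|s0] := leP 0 (x ^+ visits s z A m w - x ^+ visits s z setT m w).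
      by apply: ler_pM => //; lra.
    by rewrite (@le_trans _ _ 0)//; rewrite ?mulr1// mulr_ge0_le0// ltW.
  rewrite memNset//= addr0 vE; set a := visits s z A m w; set b := visits s z _ m w.
  have bk : b%:R <= (a + b)%:R * eta.
    rewrite leNgt; apply/negP => lt; apply: nE; rewrite /E /E' /=; exists (a + b)%N.
    rewrite (lt_le_trans lt)//.
    have bs : b = (\sum_(j < a + b) (iter j.+1 ret w \in ~` A))%N.
      by rewrite (_ : (a + b)%N = visits s z setT m w) //; exact: (visits_return_map zD).
    by rewrite [X in X%:R <= _]bs /orbit_sum natr_sum; apply: ler_sum => j _; rewrite indicE -iterSr.
  have bc : b%:R <= (2 * eta) * a%:R.
    move: bk; rewrite natrD.
    have b0 : 0 <= (b%:R : R) by []. have a0 : 0 <= (a%:R : R) by [].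
    have := ler_wpM2l b0 e12; lra.
  have := exprB_ratio_le x01 (_ : 0 <= 2 * eta) bc => /(_ ltac:(lra)) le2.
  have s0 : 0 <= x ^+ a - x ^+ (a + b) by rewrite subr_ge0; apply: ler_wiXn2l => //; rewrite ?leq_addr// ltnW.
  by apply: le_trans le2; rewrite ler_piMl.
rewrite distrC /laplace_visits -meanB// ger0_norm; last first.
  by apply: Rintegral_ge0 => w _; case/andP: (key w).
apply: (@le_trans _ _ (\int[P]_w (2 * eta + \1_E w))).
  apply: mean_le; [exact: bounded_measurableB| |].
    by apply: bounded_measurableD => //; exact: bounded_measurable_cst.
  by move=> w; case/andP: (key w).
rewrite meanD//; last exact: bounded_measurable_cst.
by rewrite mean_cst mean_indicE//; lra.
Qed.

End fixed_x.

End renewal.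

(** * Consecutive values of a slowly varying function *)

Section translation.
Context {R : realType}.
Local Notation mu := (@lebesgue_measure R).

Lemma lebesgue_measure_translation (d : R) (A : set R) : measurable A ->
  pushforward mu ((fun t => t + d) : _ -> measurableTypeR R) A = mu A.
Proof.
move=> mA; apply/esym/lebesgue_measure_unique => //=.
  by apply: measurable_funD => //; exact: measurable_id.
move=> _ _ [[a b]] _ <-; rewrite /pushforward.
have -> : (fun t => t + d) @^-1` `]a, b]%classic = `]a - d, b - d]%classic.
  by apply/seteqP; split => t /=; rewrite !in_itv/= ltrBlDr lerBrDr.
rewrite !lebesgue_measure_itv/= !lte_fin ltrD2r.
by case: ifPn => // _; rewrite -!EFinB; congr EFin; ring.
Qed.

Lemma ge0_integral_translation (d a b : R) (f : R -> \bar R) :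
  measurable_fun `[a + d, b + d] f -> (forall t, 0 <= f t)%E ->
  (\int[mu]_(t in `[a, b]) f (t + d)%R = \int[mu]_(t in `[(a + d)%R, (b + d)%R]) f t)%E.
Proof.
move=> mf f0.
have mt : measurable_fun setT ((fun t => t + d) : measurableTypeR R -> measurableTypeR R).
  by apply: measurable_funD => //; exact: measurable_id.
have := @ge0_integral_pushforward _ _ _ _ _ _ mt mu `[a + d, b + d] f.
have -> : (fun t => t + d) @^-1` `[a + d, b + d]%classic = `[a, b]%classic.
  by apply/seteqP; split => t /=; rewrite !in_itv/= !lerD2r.
move=> <-//.
by apply: eq_measure_integral => A mA _; exact: lebesgue_measure_translation.
Qed.

End translation.

Section slow_variation.
Context {R : realType}.
Local Notation mu := (@lebesgue_measure R).
Variable L : R -> R.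
Variable x0 : R.
Hypothesis mL : measurable_fun `[x0, +oo[ L.
Hypothesis L_gt0 : {in `[x0, +oo[, forall x, 0 < L x}.
Hypothesis L_slow : forall c : R, 0 < c -> L (c * x) / L x @[x --> +oo] --> (1 : R).

(** Truncated at 1 to be dominated. *)
Let dev (n : nat) (t : R) : R :=
  Num.min 1 `|ln (L (n%:R * expR t)) - ln (L n%:R)|.

Let dev01 n t : 0 <= dev n t <= 1.
Proof. by rewrite /dev le_min ler01 normr_ge0 ge_min lexx. Qed.

Let n0 : nat := (Num.Def.trunc `|x0|).+1.

Let ge_x0 n : (n0 <= n)%N -> x0 <= n%:R.
Proof.
move=> n0n; apply: le_trans (ler_norm x0) _; apply: le_trans (ltW (truncnS_gt _)) _.
by rewrite ler_nat.
Qed.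

Let expR_ge_x0 n t : (n0 <= n)%N -> 0 <= t -> x0 <= n%:R * expR t.
Proof.
move=> n0n t0; apply: le_trans (ge_x0 n0n) _; rewrite ler_peMr//.
by rewrite -expR0 ler_expR.
Qed.

Let measurable_dev n : (n0 <= n)%N -> measurable_fun (`[0, +oo[ : set R) (dev n).
Proof.
move=> n0n; apply: measurable_minr => //.
apply: measurableT_comp => //; apply: measurable_funB => //.
apply: measurableT_comp => //.
apply: (@measurable_comp _ _ _ _ _ _ `[x0, +oo[) => //.
  move=> _ [t + <-] /=; rewrite !in_itv/= !andbT => t0; apply: expR_ge_x0 => //.
  by move: t0; rewrite in_itv/= andbT.
apply: (@measurable_funM _ _ _ _ (cst n%:R) expR) => //.
by apply: measurable_funTS; exact: measurable_expR.
Qed.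

Let cvg_dev t : 0 <= t -> dev n t @[n --> \oo] --> 0.
Proof.
move=> t0; apply/cvgr0Pnorm_lt => e e0.
have c0 : 0 < expR t by exact: expR_gt0.
have h : L (expR t * n%:R) / L n%:R @[n --> \oo] --> (1 : R).
  exact: (cvg_comp _ _ (@cvgr_idn R) (L_slow c0)).
have : ln (L (expR t * n%:R) / L n%:R) @[n --> \oo] --> (0 : R).
  by rewrite -(@ln1 R); exact: (cvg_comp _ _ h (continuous_ln (@ltr01 R))).
move=> /cvgr0Pnorm_lt/(_ e e0) hn; near=> n.
have n0n : (n0 <= n)%N by near: n; exact: nbhs_infty_ge.
have /andP[d0 _] := dev01 n t; rewrite ger0_norm//.
rewrite /dev gt_min; apply/orP; right; rewrite -ln_div ?posrE; last 2 first.
- by apply: L_gt0; rewrite in_itv/= andbT expR_ge_x0.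
- by apply: L_gt0; rewrite in_itv/= andbT ge_x0.
by rewrite [n%:R * _]mulrC; near: n.
Unshelve. all: by end_near. Qed.

Let cvg_int_dev : (\int[mu]_(t in `[0%R, 2%R]) (dev (n0 + n)%N t)%:E)%E @[n --> \oo] --> 0%E.
Proof.
have sub : (`[0, 2] : set R) `<=` `[0, +oo[.
  by move=> t /=; rewrite !in_itv/= => /andP[-> _].
have := @dominated_convergence _ _ _ mu `[0, 2] _ (fun n t => (dev (n0 + n) t)%:E) (cst 0%E) (cst 1%E) _ _ _ _ _.
have -> : (\int[mu]_(x in `[0%R, 2%R]) cst 0%E x = 0)%E by rewrite integral0.
case=> //.
- move=> n; apply/measurable_EFinP; apply: measurable_funS (measurable_dev _) => //.
  by rewrite leq_addr.
- apply: aeW => t /=; rewrite in_itv/= => /andP[t0 _].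
  apply: cvg_EFin; first exact: nearW.
  have := cvg_dev t0; rewrite -(cvg_shiftn n0) => h.
  by under eq_fun do rewrite /= addnC.
- apply: (@measurable_bounded_integrable _ _ _ mu (cst 1)) => //.
    by rewrite /= lebesgue_measure_itv/= lte_fin ltr0n/= ltry.
  by exists 1; split=> // y y1 t _ /=; rewrite normr1 ltW.
- apply: aeW => t n _ /=; have /andP[d0 d1] := dev01 (n0 + n) t.
  by rewrite lee_fin ger0_norm.
Qed.

(** With d = ln ((n + 1) / n), the increment ln L(n + 1) - ln L(n) is, for
    every t, the difference of ln (L(n e^(t + d)) / L(n)) and
    ln (L((n + 1) e^t) / L(n + 1)).  Averaged over t in [0, 1], both tend to zero
    by dominated convergence.  The averaging takes the place of the uniform
    convergence theorem for slowly varying functions. *)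
Lemma slowly_varying_ratio : L n.+1%:R / L n%:R @[n --> \oo] --> (1 : R).
Proof.
pose q n : R := Num.min 1 `|ln (L n.+1%:R) - ln (L n%:R)|.
have q0 : q (n0 + n)%N @[n --> \oo] --> 0.
  pose I n := (\int[mu]_(t in `[0%R, 2%R]) (dev (n0 + n)%N t)%:E)%E.
  have I0 : (I n + I n.+1)%E @[n --> \oo] --> 0%E.
    have I1 : I n.+1 @[n --> \oo] --> 0%E by rewrite (cvg_shiftS I); exact: cvg_int_dev.
    have := cvgeD (fin_num_adde_defl _ _) (cvg_int_dev : I n @[n --> \oo] --> 0%E) I1.
    by rewrite adde0; exact.
  have qI n : ((q (n0 + n)%N)%:E <= I n + I n.+1)%E.
    set m := (n0 + n)%N; have m_gt0 : 0 < (m%:R : R) by rewrite ltr0n.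
    have n0m : (n0 <= m)%N by rewrite leq_addr.
    (* The shift by d maps [0, 1] into [0, 2], as d <= 1. *)
    pose d : R := ln (m.+1%:R / m%:R).
    have dE : expR d = m.+1%:R / m%:R by rewrite lnK// posrE divr_gt0.
    have d0 : 0 <= d by rewrite ln_ge0// ler_pdivlMr// mul1r ler_nat.
    have d1 : d <= 1.
      rewrite -ler_expR dE (@le_trans _ _ 2)//; last by rewrite (le_trans _ (expR_ge1Dx 1)).
      by rewrite ler_pdivrMr// -natrM ler_nat; lia.
    have qdev t : 0 <= t -> q m <= dev m (t + d) + dev m.+1 t.
      move=> t0; have E : m%:R * expR (t + d) = m.+1%:R * expR t.
        by rewrite expRD dE mulrC -mulrA divfK ?gt_eqF// mulrC.
      rewrite /q /dev E; set a := ln _; set b := ln _; set c := ln _.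
      have : `|a - b| <= `|c - b| + `|c - a|.
        have -> : a - b = (c - b) - (c - a) by ring.
        exact: ler_normB.
      move: (normr_ge0 (c - b)) (normr_ge0 (c - a)).
      by rewrite !minEle; case: ifP; case: ifP; case: ifP; lra.
    have mm : measurable_fun (`[0, +oo[ : set R) (dev m) by exact: measurable_dev.
    have mm1 : measurable_fun (`[0, +oo[ : set R) (dev m.+1) by apply: measurable_dev; exact: leqW.
    have -> : ((q m)%:E = \int[mu]_(t in `[0%R, 1%R]) (q m)%:E)%E.
      rewrite integral_cst//= lebesgue_measure_itv/= lte_fin ltr01/=.
      by rewrite -EFinB subr0 mule1.
    have mshift : measurable_fun (`[0, 1] : set R) (fun t => dev m (t + d)).
      apply: (measurable_comp _ _ mm) => //.
        move=> _ [t + <-] /=; rewrite !in_itv/= => /andP[t0 _].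
        by rewrite ?in_itv/= andbT addr_ge0.
      by apply: measurable_funTS; apply: measurable_funD => //; exact: measurable_id.
    have mm1' : measurable_fun (`[0, 1] : set R) (dev m.+1).
      by apply: measurable_funS mm1 => // t /=; rewrite !in_itv/= => /andP[-> _].
    have dev0 k t : (0 <= (dev k t)%:E)%E by rewrite lee_fin; case/andP: (dev01 k t).
    apply: (@le_trans _ _ (\int[mu]_(t in `[0%R, 1%R]) ((dev m (t + d))%:E + (dev m.+1 t)%:E))%E).
      apply: ge0_le_integral => //.
      - by move=> t _; rewrite lee_fin /q le_min ler01 normr_ge0.
      - by apply/measurable_EFinP; exact: measurable_funD.
      - by move=> t /=; rewrite in_itv/= => /andP[t0 _]; rewrite -EFinD lee_fin qdev.
    rewrite ge0_integralD//; try by apply/measurable_EFinP.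
    apply: leeD.
      rewrite (@ge0_integral_translation _ d 0 1 (fun t => (dev m t)%:E))//; last first.
        apply/measurable_EFinP; apply: measurable_funS mm => // t /=.
        by rewrite !in_itv/= add0r andbT => /andP[dt _]; exact: le_trans dt.
      apply: ge0_subset_integral => //.
        apply/measurable_EFinP; apply: measurable_funS mm => // t /=.
        by rewrite !in_itv/= andbT => /andP[].
      move=> t /=; rewrite !in_itv/= add0r => /andP[dt td].
      by rewrite (le_trans d0)//= (le_trans td)//; lra.
    rewrite /I addnS; apply: ge0_subset_integral => //.
      apply/measurable_EFinP; apply: measurable_funS mm1 => // t /=.
      by rewrite !in_itv/= andbT => /andP[].
    by move=> t /=; rewrite !in_itv/= => /andP[-> t1]/=; rewrite (le_trans t1)//; lra.
  have [_] := (fine_cvgP _ _).1 I0 => fI0.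
  have fin := ((fine_cvgP _ _).1 I0).1.
  apply: (@squeeze_cvgr _ _ _ _ (fun=> 0) (fun n => fine (I n + I n.+1)%E)) => //; last exact: cvg_cst.
  near=> n; rewrite /q le_min ler01 normr_ge0/= -lee_fin fineK; first exact: qI.
  by near: n; exact: fin.
have lnq : ln (L n.+1%:R / L n%:R) @[n --> \oo] --> (0 : R).
  apply/cvgr0Pnorm_lt => e e0.
  have e1 : 0 < Num.min e 1 by rewrite lt_min e0 ltr01.
  move: q0 => /cvgr0Pnorm_lt/(_ _ e1)[N _ hN].
  exists (n0 + N)%N => // n /= Nn.
  have := hN (n - n0)%N; rewrite /= subnKC; last by rewrite (leq_trans (leq_addr N _)).
  rewrite leq_subRL ?Nn; last by rewrite (leq_trans (leq_addr N _)).
  move=> /(_ isT); rewrite ger0_norm ?lt_min; last by rewrite /q le_min ler01 normr_ge0.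
  rewrite /q !gt_min ltxx/= => /andP[h1 h2].
  have nn0 : (n0 <= n)%N by rewrite (leq_trans (leq_addr N _)).
  rewrite ln_div ?posrE.
  - by case/orP: h1 => // /(lt_trans h2).
  - by apply: L_gt0; rewrite in_itv/= andbT ge_x0// leqW.
  - by apply: L_gt0; rewrite in_itv/= andbT ge_x0.
have := cvg_comp _ _ lnq (@continuous_expR R 0); rewrite expR0.
apply: cvg_trans; apply: near_eq_cvg; near=> n => /=.
have nn0 : (n0 <= n)%N by near: n; exact: nbhs_infty_ge.
rewrite lnK// posrE divr_gt0//.
- by apply: L_gt0; rewrite in_itv/= andbT ge_x0// leqW.
- by apply: L_gt0; rewrite in_itv/= andbT ge_x0.
Unshelve. all: by end_near. Qed.

End slow_variation.

(** * Polynomial approximation on the unit interval *)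

Section bernstein.
Context {R : realType}.
Implicit Types (v : nat -> R) (x : R).

(** De Casteljau's recursion for the Bernstein polynomial of the values v, the
    mean of v at a binomial variable of parameters n and x.  Positivity and the
    variance follow by induction along it. *)
Fixpoint bernstein v n : {poly R} :=
  if n is m.+1 then 'X * bernstein (fun k => v k.+1) m + (1 - 'X) * bernstein v m
  else (v 0%N)%:P.

Lemma bernsteinS v n x : (bernstein v n.+1).[x] =
  x * (bernstein (fun k => v k.+1) n).[x] + (1 - x) * (bernstein v n).[x].
Proof. by rewrite /= hornerD !hornerM hornerX hornerD hornerN hornerX hornerC. Qed.

Lemma bernstein_le v v' n x : 0 <= x <= 1 -> (forall k, (k <= n)%N -> v k <= v' k) ->
  (bernstein v n).[x] <= (bernstein v' n).[x].
Proof.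
move=> /andP[x0 x1]; elim: n v v' => [|n IH] v v' vv'.
  by rewrite !hornerC; exact: vv'.
rewrite !bernsteinS lerD// ler_wpM2l ?subr_ge0// IH// => k kn; apply: vv' => //.
exact: leqW.
Qed.

Lemma bernstein_affine v c e n x :
  (bernstein (fun k => c + e * v k) n).[x] = c + e * (bernstein v n).[x].
Proof.
by elim: n v => [|n IH] v; [rewrite !hornerC|rewrite !bernsteinS !IH; ring].
Qed.

(** The second moment about c of a binomial variable. *)
Lemma bernstein_variance c n x : (bernstein (fun k => (k%:R - c) ^+ 2) n).[x] =
  n%:R * x * (1 - x) + (n%:R * x - c) ^+ 2.
Proof.
elim: n c => [|n IH] c; first by rewrite hornerC; ring.
rewrite bernsteinS IH.
have -> : (fun k : nat => (k.+1%:R - c) ^+ 2) = (fun k => (k%:R - (c - 1)) ^+ 2).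
  by apply/funext => k; rewrite -natr1; ring.
by rewrite IH -natr1; ring.
Qed.

(** Points at distance at least d satisfy 1 <= (x - y)^2 / d^2, which absorbs
    the bound of g; closer points are handled by uniform continuity. *)
Lemma uniform_continuity_quadratic (g : R -> R) (e : R) : continuous g -> 0 < e ->
  exists2 K : R, 0 <= K &
    forall x y, 0 <= x <= 1 -> 0 <= y <= 1 -> `|g x - g y| <= e + K * (x - y) ^+ 2.
Proof.
move=> cg e0; have e20 : 0 < e / 2 by rewrite divr_gt0.
have cpt : compact (`[0, 1] : set R) by exact: segment_compact.
have [M [_ /(_ (M + 1))]] : bounded_set (g @` `[0, 1]).
  apply: compact_bounded; apply: continuous_compact => //.
  exact: continuous_subspaceT.
move=> /(_ ltac:(by rewrite ltrDl)) gM.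
have {}gM x : 0 <= x <= 1 -> `|g x| <= M + 1 by move=> x01; apply: gM; exists x; rewrite //= in_itv.
have M0 : 0 <= M + 1 by apply: le_trans (gM 0 _); rewrite ?lexx ?ler01.
have [d d0 unif] : exists2 d : R, 0 < d & forall x, 0 <= x <= 1 ->
    forall y, `|x - y| < d -> `|g x - g y| <= e.
  have cov := (compact_near_coveringP _).1 cpt R ((0:R)^'+)
    (fun d x => forall y, `|x - y| < d -> `|g x - g y| <= e) _.
  have nh : \forall d \near (0:R)^'+, 0 < d /\
      (`[0, 1] `<=` (fun x => forall y, `|x - y| < d -> `|g x - g y| <= e)).
    near=> d; split; first by near: d; exact: nbhs_right_gt.
    near: d; apply: cov => x _.
    have /cvgrPdist_lt/(_ _ e20) := cg x; move=> /nbhs_ballP[r /= r0 hr].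
    exists (ball x (r / 2), [set d | d < r / 2]).
      split => /=; first by apply: nbhsx_ballx; rewrite divr_gt0.
      by apply: nbhs_right_lt; rewrite divr_gt0.
    move=> [x' d] /= [xx' dr] y x'y.
    have h1 : `|g x - g x'| < e / 2.
      by apply: hr; apply: le_ball xx'; lra.
    have h2 : `|g x - g y| < e / 2.
      apply: hr; rewrite /ball/= -[x - y](subrKA x').
      rewrite (le_lt_trans (ler_normD _ _))// (splitr r) ltrD// (lt_trans x'y)//.
    have -> : g x' - g y = (g x - g y) - (g x - g x') by ring.
    by rewrite (le_trans (ler_normB _ _))// (splitr e) lerD// ltW.
  have [d [d0 hd]] := filter_ex nh.
  by exists d => // x x01; apply: hd; rewrite /= in_itv.
exists (2 * (M + 1) / d ^+ 2); first by rewrite divr_ge0 ?sqr_ge0// mulr_ge0.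
move=> x y x01 y01; have [xy|dxy] := ltP `|x - y| d.
  by rewrite (le_trans (unif x x01 y xy))// lerDl mulr_ge0 ?sqr_ge0// divr_ge0 ?sqr_ge0// mulr_ge0.
apply: (@le_trans _ _ (2 * (M + 1))).
  by rewrite (le_trans (ler_normB _ _))// mulr_natl mulr2n lerD ?gM.
rewrite -(real_normK (num_real (x - y))) ler_wpDl ?(ltW e0)//.
have m0 : 0 <= 2 * (M + 1) by rewrite mulr_ge0.
move: (2 * (M + 1)) m0 => m m0; rewrite -[leRHS]mulrA ler_peMr// mulrC ler_pdivlMr ?exprn_gt0// mul1r.
by rewrite ler_sqr// nnegrE ltW.
Unshelve. all: by end_near. Qed.

(** The Bernstein mean of K (x - k / N)^2 is K x (1 - x) / N. *)
Lemma weierstrass (g : R -> R) (e : R) : continuous g -> 0 < e ->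
  exists p : {poly R}, forall x, 0 <= x <= 1 -> `|g x - p.[x]| <= e.
Proof.
move=> cg e0; have e20 : 0 < e / 2 by rewrite divr_gt0.
have [K K0 gK] := uniform_continuity_quadratic cg e20.
pose N := (Num.Def.trunc (2 * K / e)).+1.
have N0 : 0 < (N%:R : R) by rewrite ltr0n.
have KN : K / N%:R <= e / 2.
  rewrite ler_pdivrMr// mulrC -ler_pdivrMr//.
  by apply: le_trans (ltW (truncnS_gt _)); rewrite invf_div; lra.
exists (bernstein (fun k => g (k%:R / N%:R)) N) => x x01.
have gk k : (k <= N)%N -> `|g x - g (k%:R / N%:R)| <= e / 2 + K / N%:R ^+ 2 * (k%:R - N%:R * x) ^+ 2.
  move=> kN; have k01 : 0 <= (k%:R / N%:R : R) <= 1.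
    by rewrite divr_ge0//= ler_pdivrMr// mul1r ler_nat.
  apply: le_trans (gK _ _ x01 k01) _; rewrite lerD2l le_eqVlt; apply/orP; left; apply/eqP.
  by field; rewrite gt_eqF.
pose q k : R := e / 2 + K / N%:R ^+ 2 * (k%:R - N%:R * x) ^+ 2.
have qb : (bernstein q N).[x] <= e.
  rewrite bernstein_affine bernstein_variance subrr expr0n addr0.
  have -> : K / N%:R ^+ 2 * (N%:R * x * (1 - x)) = K / N%:R * (x * (1 - x)) by field; rewrite gt_eqF.
  have KN0 : 0 <= K / N%:R by rewrite divr_ge0// ltW.
  have : x * (1 - x) <= 1.
    by case/andP: x01 => ? ?; rewrite mulr_ile1 ?subr_ge0//; lra.
  move/(ler_wpM2l KN0); lra.
have e1 : (bernstein (fun k => g x + q k) N).[x] = g x + (bernstein q N).[x].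
  by rewrite -[X in _ + X]mul1r -bernstein_affine; congr (_.[_]); congr bernstein; apply/funext => k; rewrite mul1r.
have e2 : (bernstein (fun k => g x + -1 * q k) N).[x] = g x + -1 * (bernstein q N).[x].
  exact: bernstein_affine.
have h1 : (bernstein (fun k => g (k%:R / N%:R)) N).[x] <= g x + (bernstein q N).[x].
  by rewrite -e1; apply: bernstein_le => // k /gk; rewrite ler_norml /q; lra.
have h2 : g x + -1 * (bernstein q N).[x] <= (bernstein (fun k => g (k%:R / N%:R)) N).[x].
  by rewrite -e2; apply: bernstein_le => // k /gk; rewrite ler_norml /q; lra.
by rewrite ler_norml; apply/andP; split; lra.
Qed.

End bernstein.

(** * Continuity of the Laplace transform *)

Section laplace_continuity.
Context {R : realType}.
Implicit Types (f g : R -> R) (I J : (R -> R) -> R).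

Definition half_line_bounded f :=
  continuous f /\ exists M, forall x, 0 <= x -> `|f x| <= M.

(** What is used of the integral against a finite measure on the half-line.
    Working with functionals covers the laws of variables on different spaces
    and weighted integrals alike. *)
Definition positive_functional I :=
  [/\ forall f g, half_line_bounded f -> half_line_bounded g ->
        I (fun x => f x + g x) = I f + I g,
      forall c f, half_line_bounded f -> I (fun x => c * f x) = c * I f &
      forall f g, half_line_bounded f -> half_line_bounded g ->
        (forall x, 0 <= x -> f x <= g x) -> I f <= I g].

Lemma half_line_bounded_cst (c : R) : half_line_bounded (fun=> c).
Proof. by split; [move=> x; exact: cvg_cst|exists `|c|]. Qed.

Lemma half_line_boundedD f g : half_line_bounded f -> half_line_bounded g ->
  half_line_bounded (fun x => f x + g x).
Proof.
move=> [cf [M fM]] [cg [N gN]]; split; first by move=> x; apply: cvgD; [exact: cf|exact: cg].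
by exists (M + N) => x x0; rewrite (le_trans (ler_normD _ _))// lerD ?fM ?gN.
Qed.

Lemma half_line_boundedM f g : half_line_bounded f -> half_line_bounded g ->
  half_line_bounded (fun x => f x * g x).
Proof.
move=> [cf [M fM]] [cg [N gN]]; split; first by move=> x; apply: cvgM; [exact: cf|exact: cg].
by exists (M * N) => x x0; rewrite normrM ler_pM ?fM ?gN.
Qed.

Definition exp_decay (k : nat) (x : R) : R := expR (- x) ^+ k.

Lemma half_line_bounded_exp_decay k : half_line_bounded (exp_decay k).
Proof.
rewrite /exp_decay; split.
  move=> x; apply: (@continuous_comp _ _ _ (fun x => expR (- x)) (fun y => y ^+ k)).
    by apply: continuous_comp; [exact: opp_continuous|exact: continuous_expR].
  exact: exprn_continuous.
exists 1 => x x0; rewrite ger0_norm ?exprn_ge0 ?expR_ge0// exprn_ile1 ?expR_ge0//.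
by rewrite -expR0 ler_expR oppr_le0.
Qed.

(** The values of a functional on these cut-offs measure the mass that it puts
    near infinity. *)
Definition ramp (K : nat) (x : R) : R := Num.max 0 (Num.min 1 (x - K%:R)).

Lemma ramp01 K x : 0 <= ramp K x <= 1.
Proof. by rewrite /ramp le_max lexx/= ge_max ler01 ge_min lexx. Qed.

Lemma continuous_ramp K : continuous (ramp K).
Proof.
move=> x.
have -> : ramp K = (fun=> 0) \max ((fun=> 1) \min (fun x => x - K%:R)) by [].
apply: continuous_max; first exact: cvg_cst.
apply: continuous_min; first exact: cvg_cst.
by apply: cvgB; [exact: cvg_id|exact: cvg_cst].
Qed.

Lemma half_line_bounded_ramp K : half_line_bounded (ramp K).
Proof.
split; first exact: continuous_ramp.
by exists 1 => x _; have /andP[h0 h1] := ramp01 K x; rewrite ger0_norm.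
Qed.

Lemma ramp_eq1 K x : K%:R + 1 <= x -> ramp K x = 1.
Proof. by move=> Kx; rewrite /ramp min_l ?max_r//; lra. Qed.

Lemma half_line_bounded_polynomial (p : {poly R}) :
  half_line_bounded (fun x => p.[expR (- x)]).
Proof.
elim/poly_ind: p => [|p c IH].
  by under eq_fun do rewrite horner0; exact: half_line_bounded_cst.
under eq_fun do rewrite hornerMXaddC; apply: half_line_boundedD; last exact: half_line_bounded_cst.
apply: half_line_boundedM => //; exact: (half_line_bounded_exp_decay 1).
Qed.

Lemma functional_polynomial I (p : {poly R}) : positive_functional I ->
  I (fun x => p.[expR (- x)]) = \sum_(k < size p) p`_k * I (exp_decay k).
Proof.
move=> [ID IZ _].
under [in LHS]eq_fun do rewrite horner_coef.
elim: (size p) => [|n IH].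
  under eq_fun do rewrite big_ord0.
  have -> : (fun=> 0 : R) = (fun x : R => 0 * (exp_decay 0 x)) by apply/funext => x; rewrite mul0r.
  by rewrite IZ ?mul0r ?big_ord0//; exact: half_line_bounded_exp_decay.
under eq_fun do rewrite big_ord_recr/=.
rewrite big_ord_recr/= -IH -IZ; last exact: half_line_bounded_exp_decay.
apply: (ID (fun x => _) (fun x => _)).
  elim: n {IH} => [|n IH].
    by under eq_fun do rewrite big_ord0; exact: half_line_bounded_cst.
  under eq_fun do rewrite big_ord_recr/=; apply: half_line_boundedD => //.
  apply: half_line_boundedM; first exact: half_line_bounded_cst.
  exact: half_line_bounded_exp_decay.
apply: half_line_boundedM; first exact: half_line_bounded_cst.
exact: half_line_bounded_exp_decay.
Qed.

(** A function vanishing beyond K is a continuous function of y = exp (- x), in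
    [0, 1]; cutting y at exp (- K) removes the singularity of the logarithm. *)
Lemma exp_polynomial_approx f (K : nat) (e : R) : continuous f ->
  (forall x, K%:R <= x -> f x = 0) -> 0 < e ->
  exists p : {poly R}, forall x, 0 <= x -> `|f x - p.[expR (- x)]| <= e.
Proof.
move=> cf fK e0.
(* For 0 <= x this gives f x = g (exp (- x)), since f vanishes beyond K. *)
pose g t := f (- ln (Num.max t (expR (- K%:R)))).
have cg : continuous g.
  move=> t; apply: (@continuous_comp _ _ _ (fun t => - ln (Num.max t (expR (- K%:R)))) f);
    last exact: cf.
  apply: (@continuous_comp _ _ _ (fun t => ln (Num.max t (expR (- K%:R)))) -%R);
    last exact: opp_continuous.
  apply: (@continuous_comp _ _ _ (fun t => Num.max t (expR (- K%:R))) (@ln R)).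
    have -> : (fun t => Num.max t (expR (- K%:R))) = (fun t => t) \max (fun=> expR (- K%:R)) by [].
    by apply: continuous_max; [exact: cvg_id|exact: cvg_cst].
  by apply: continuous_ln; rewrite lt_max expR_gt0 orbT.
have [p hp] := weierstrass cg e0.
exists p => x x0.
have -> : f x = g (expR (- x)).
  rewrite /g; have [xK|Kx] := leP x K%:R.
    by rewrite max_l ?expRK ?opprK// ler_expR lerN2.
  rewrite max_r; last by rewrite ler_expR lerN2 ltW.
  by rewrite expRK opprK !fK ?lexx// ltW.
by apply: hp; rewrite expR_ge0/= -expR0 ler_expR oppr_le0.
Qed.

Lemma functional_norm_le I f (M : R) : positive_functional I -> half_line_bounded f ->
  forall g, half_line_bounded g -> (forall x, 0 <= x -> `|f x| <= M * g x) ->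
  `|I f| <= M * I g.
Proof.
move=> [ID IZ Ile] bf g bg fg.
have bMg c : half_line_bounded (fun x => c * g x).
  by apply: half_line_boundedM => //; exact: half_line_bounded_cst.
rewrite ler_norml -mulNr -!IZ//; apply/andP; split; apply: Ile => // x x0.
  by have := fg x x0; rewrite ler_norml mulNr => /andP[].
by have := fg x x0; rewrite ler_norml => /andP[].
Qed.

Lemma functionalB I f g : positive_functional I -> half_line_bounded f ->
  half_line_bounded g -> I (fun x => f x - g x) = I f - I g.
Proof.
move=> [ID IZ _] bf bg; rewrite -[- I g]mulN1r -IZ// -ID//.
  by congr I; apply/funext => x; rewrite mulN1r.
by apply: half_line_boundedM => //; exact: half_line_bounded_cst.
Qed.

(** Polynomials in exp (- x) are uniformly dense among the functions that vanish
    near infinity, and the total masses converge.  The complement of a cut-off is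
    such a function, so little mass of J near infinity forces little mass of
    [I n] there for large n. *)
Theorem laplace_continuity (I : nat -> (R -> R) -> R) J :
  (forall n, positive_functional (I n)) -> positive_functional J ->
  J (ramp K) @[K --> \oo] --> 0 ->
  (forall k, I n (exp_decay k) @[n --> \oo] --> J (exp_decay k)) ->
  forall f, half_line_bounded f -> I n f @[n --> \oo] --> J f.
Proof.
move=> posI posJ tight cvgexp.
have b1 := half_line_bounded_cst 1.
have e1 : exp_decay 0 = fun=> 1 by apply/funext => x; rewrite /exp_decay expr0.
have cvg1 : I n (fun=> 1) @[n --> \oo] --> J (fun=> 1) by rewrite -e1; exact: cvgexp.
have J1_ge0 : 0 <= J (fun=> 1).
  have [_ JZ Jle] := posJ; rewrite -[leLHS](mul0r (J (fun=> 1))) -JZ//.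
  have b0 : half_line_bounded (fun=> 0 * 1) by exact: half_line_bounded_cst.
  by apply: (Jle _ _ b0 b1) => x _; rewrite mul0r.
have cvgpoly (p : {poly R}) : I n (fun x => p.[expR (- x)]) @[n --> \oo] -->
    J (fun x => p.[expR (- x)]).
  rewrite functional_polynomial//; under eq_fun do rewrite functional_polynomial//.
  apply: (@cvg_finite_sum _ _ _ (fun (k : 'I_(size p)) n => p`_k * I n (exp_decay k))) => k.
  by apply: cvgMr; exact: cvgexp.
have compact_case f (K : nat) : half_line_bounded f -> (forall x, K%:R <= x -> f x = 0) ->
    I n f @[n --> \oo] --> J f.
  move=> bf fK; apply/cvgrPdist_le => e e0.
  pose e' := e / (2 * (J (fun=> 1) + 1) + 1).
  have D0 : 0 < 2 * (J (fun=> 1) + 1) + 1 by lra.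
  have e'0 : 0 < e' by rewrite divr_gt0.
  have [p hp] := exp_polynomial_approx (proj1 bf) fK e'0.
  have bp := half_line_bounded_polynomial p.
  have bfp : half_line_bounded (fun x => f x - p.[expR (- x)]).
    apply: half_line_boundedD => //.
    by under eq_fun do rewrite -hornerN; exact: half_line_bounded_polynomial.
  have close I' : positive_functional I' ->
      `|I' f - I' (fun x => p.[expR (- x)])| <= e' * I' (fun=> 1).
    by move=> posI'; rewrite -functionalB//; apply: functional_norm_le => // x x0; rewrite mulr1 hp.
  move/cvgrPdist_le : (cvgpoly p) => /(_ _ e'0) cp.
  move/cvgrPdist_le : cvg1 => /(_ 1 ltac:(by [])) c1.
  near=> n.
  have h1 : `|J (fun x => p.[expR (- x)]) - I n (fun x => p.[expR (- x)])| <= e' by near: n.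
  have h2 : `|J (fun=> 1) - I n (fun=> 1)| <= 1 by near: n.
  have h3 := close _ posJ; have h4 := close _ (posI n).
  have h5 : e' * I n (fun=> 1) <= e' * (J (fun=> 1) + 1).
    by rewrite ler_wpM2l ?(ltW e'0)//; move: h2; rewrite ler_norml; lra.
  have E : e = e' * (2 * (J (fun=> 1) + 1) + 1) by rewrite mulfVK// gt_eqF.
  rewrite E; move: h1 h3 h4; rewrite !ler_norml; lra.
move=> f bf; have [cf [M fM]] := bf.
have M0 : 0 <= M by apply: le_trans (fM 0 _).
have bramp := half_line_bounded_ramp.
have bcut K : half_line_bounded (fun x => 1 - ramp K x).
  split; first by move=> x; apply: cvgB; [exact: cvg_cst|exact: continuous_ramp].
  by exists 1 => x _; have /andP[? ?] := ramp01 K x; rewrite ger0_norm; lra.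
have cut0 K x : K.+1%:R <= x -> 1 - ramp K x = 0.
  by move=> Kx; rewrite ramp_eq1 ?subrr// natr1.
apply/cvgrPdist_le => e e0.
(* The error is at most e' from the truncated function, and M e' and 3 M e' from
   the tails of J and of I n. *)
pose e' := e / (4 * (M + 1)).
have D0 : 0 < 4 * (M + 1) by lra.
have e'0 : 0 < e' by rewrite divr_gt0.
move/cvgrPdist_le : tight => /(_ _ e'0) [K _ /(_ K (leqnn K))]; rewrite /= sub0r normrN => JK.
have cfK := compact_case (fun x => f x * (1 - ramp K x)) K.+1
  (half_line_boundedM bf (bcut K)) ltac:(by move=> x Kx /=; rewrite cut0// mulr0).
have c1K := compact_case (fun x => 1 - ramp K x) K.+1 (bcut K) (@cut0 K).
have split I' : positive_functional I' ->
    `|I' f - I' (fun x => f x * (1 - ramp K x))| <= M * (I' (fun=> 1) - I' (fun x => 1 - ramp K x)).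
  move=> posI'; rewrite -!functionalB//; last exact: half_line_boundedM.
  apply: functional_norm_le => //.
  - apply: half_line_boundedD => //; under eq_fun do rewrite -mulrN.
    apply: half_line_boundedM => //; under eq_fun do rewrite opprB -[- 1]/(-1).
    by apply: half_line_boundedD => //; exact: half_line_bounded_cst.
  - by under eq_fun do rewrite opprB addrC subrK; exact: bramp.
  move=> x x0; have /andP[r0 r1] := ramp01 K x.
  have -> : f x - f x * (1 - ramp K x) = f x * ramp K x by ring.
  rewrite normrM (ger0_norm r0) opprB addrC subrK ler_wpM2r//; exact: fM.
have JKE : J (fun=> 1) - J (fun x => 1 - ramp K x) = J (ramp K).
  by rewrite functionalB//; ring.
move/cvgrPdist_le : cfK => /(_ _ e'0) cfK.
move/cvgrPdist_le : c1K => /(_ _ e'0) c1K.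
move/cvgrPdist_le : cvg1 => /(_ _ e'0) c1.
near=> n.
have h1 : `|J (fun x => f x * (1 - ramp K x)) - I n (fun x => f x * (1 - ramp K x))| <= e' by near: n.
have h2 : `|J (fun x => 1 - ramp K x) - I n (fun x => 1 - ramp K x)| <= e' by near: n.
have h3 : `|J (fun=> 1) - I n (fun=> 1)| <= e' by near: n.
have h4 := split _ posJ; have h5 := split _ (posI n); rewrite JKE in h4.
have h6 : M * J (ramp K) <= M * e'.
  by rewrite ler_wpM2l// (le_trans (ler_norm _)).
have h7 : M * (I n (fun=> 1) - I n (fun x => 1 - ramp K x)) <= M * (3 * e').
  rewrite ler_wpM2l//; move: h2 h3 JK; rewrite !ler_norml; lra.
have E : e = e' * (4 * (M + 1)) by rewrite mulfVK// gt_eqF.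
have Me : 0 <= M * e' by rewrite mulr_ge0// ltW.
rewrite E; move: h1 h4 h5; rewrite !ler_norml; lra.
Unshelve. all: by end_near. Qed.

End laplace_continuity.

(** * Regular variation of the partial sums *)

Section regular_variation.
Context {R : realType}.
Variables (u : nat -> R) (alpha : R).
Hypothesis u_gt0 : forall i, 0 < u i.+1.
Hypothesis alpha_gt0 : 0 < alpha.
Hypothesis alpha_lt1 : alpha < 1.
Hypothesis u_succ : u n.+1 / u n @[n --> \oo] --> (1 : R).
Hypothesis u_dilation : forall k, (0 < k)%N ->
  u (k * n)%N / u n @[n --> \oo] --> k%:R `^ (alpha - 1).

Local Notation a := (partial_sums u).

Lemma partial_sumsS n : a n.+1 = a n + u n.+1.
Proof. by rewrite /partial_sums big_ord_recr. Qed.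

Lemma partial_sums_le m n : (m <= n)%N -> a m <= a n.
Proof.
apply: (@homo_leq _ a <=%O) => // [|k]; first exact: le_trans.
by rewrite partial_sumsS lerDl ltW.
Qed.

Lemma partial_sums_gt0 n : (0 < n)%N -> 0 < a n.
Proof.
by case: n => // n _; rewrite partial_sumsS ltr_wpDl// sumr_ge0// => i _; exact: ltW.
Qed.

Let u_pos n : (0 < n)%N -> 0 < u n.
Proof. by case: n. Qed.

Let block k j : R := \sum_(r < k) u (k * j + r).+1.

Let partial_sums_block k n : a (k * n) = \sum_(j < n) block k j.
Proof.
elim: n => [|n IH]; first by rewrite muln0 /partial_sums !big_ord0.
by rewrite big_ord_recr/= -IH mulnS addnC /partial_sums big_split_ord.
Qed.

Let u_shift r : u (n + r)%N / u n @[n --> \oo] --> (1 : R).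
Proof.
elim: r => [|r IH].
  apply: cvg_near_cst; near=> n; rewrite addn0 divff// gt_eqF// u_pos//.
  by near: n; exact: nbhs_infty_gt.
have h := u_succ; rewrite -(cvg_shiftn r) in h.
have := cvg_seqM h IH; rewrite mul1r; apply: cvg_eventually_eq.
near=> n => /=; rewrite addnS mulrA divfK// gt_eqF// u_pos// addn_gt0; apply/orP; left.
by near: n; exact: nbhs_infty_gt.
Unshelve. all: by end_near. Qed.

(** The sum of u over a block of k consecutive indices ending at k (j + 1) is
    close to k u(k (j + 1)), hence to k^alpha u(j + 1). *)
Let block_ratio k : (0 < k)%N -> block k j / u j.+1 @[j --> \oo] --> k%:R `^ alpha.
Proof.
move=> k0; have k0R : 0 < (k%:R : R) by rewrite ltr0n.
have -> : k%:R `^ alpha = \sum_(r < k) k%:R `^ (alpha - 1).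
  by rewrite sumr_const card_ord -[RHS]mulr_natl mulr_powRB1// ltW.
under eq_fun do rewrite /block big_distrl/=.
apply: (@cvg_finite_sum _ _ _ (fun (r : 'I_k) j => u (k * j + r).+1 / u j.+1)) => r.
have rk := ltn_ord r.
(* The index k j + r + 1 lies within distance k of k (j + 1), at which u is compared with u (j + 1). *)
have kj : (fun j => (k * j.+1)%N) n @[n --> \oo] --> \oo.
  by apply/cvgnyPge => A; near=> n; rewrite (@leq_trans n)//; [near: n; exact: nbhs_infty_ge|rewrite (leq_trans (leqnSn n))// leq_pmull].
have kj1 : (fun j => (k * j + r).+1) n @[n --> \oo] --> \oo.
  by apply/cvgnyPge => A; near=> n; rewrite (@leq_trans n)//; [near: n; exact: nbhs_infty_ge|rewrite leqW// (leq_trans _ (leq_addr _ _))// leq_pmull].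
have h1 : u (k * j.+1)%N / u (k * j + r).+1 @[j --> \oo] --> (1 : R).
  have := cvg_comp _ _ kj1 (u_shift (k - r.+1)); apply: cvg_trans; apply: near_eq_cvg.
  apply: nearW => n /=; congr (u _ / _); rewrite mulnS; lia.
have h2 : u (k * j.+1)%N / u j.+1 @[j --> \oo] --> k%:R `^ (alpha - 1).
  have h := u_dilation k0; rewrite -(cvg_shiftS (fun n => u (k * n)%N / u n)) in h; exact: h.
have := cvg_seqM (cvg_seqV (oner_neq0 _) h1) h2; rewrite invr1 mul1r.
apply: cvg_eventually_eq; apply: nearW => n /=.
by rewrite invf_div mulrA divfK// gt_eqF// u_pos// muln_gt0 k0.
Unshelve. all: by end_near. Qed.

(** As 2^alpha > 1, the block sums of length 2 eventually exceed u, so that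
    a(2 n) - a(n) is eventually nondecreasing and positive.  If a were bounded,
    this difference would tend to zero. *)
Lemma partial_sums_diverge : a n @[n --> \oo] --> +oo.
Proof.
have a2 : (1 : R) < 2 `^ alpha.
  have := gt0_ltr_powR alpha_gt0 (_ : 1 \in Num.nneg) (_ : 2 \in Num.nneg) (_ : (1 : R) < 2).
  by rewrite powR1; apply; rewrite ?nnegrE//; lra.
have e0 : 0 < 2 `^ alpha - 1 by rewrite subr_gt0.
have [J _ hJ] : \forall j \near \oo, u j.+1 <= block 2 j.
  have := block_ratio (isT : (0 < 2)%N) => /cvgrPdist_le/(_ _ e0) h.
  near=> j.
  have : `|2 `^ alpha - block 2 j / u j.+1| <= 2 `^ alpha - 1 by near: j.
  by rewrite ler_norml => /andP[_]; rewrite lerD2l lerN2 ler_pdivlMr// mul1r.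
(* From n to n + 1 the difference gains a block of two terms and loses u n.+1.
   *)
have grow n : (J < n)%N -> a (2 * J.+1) - a J.+1 <= a (2 * n) - a n.
  elim: n => // n IH; rewrite ltnS leq_eqVlt => /orP[/eqP -> //|Jn].
  apply: (le_trans (IH Jn)); rewrite !partial_sums_block big_ord_recr/= partial_sumsS.
  by have := hJ n (ltnW Jn) => /=; lra.
have c0 : 0 < a (2 * J.+1) - a J.+1.
  rewrite subr_gt0 mul2n -addnn addSn [ltRHS]partial_sumsS ltr_pwDr//.
  by apply: partial_sums_le; rewrite leq_addl.
apply/cvgryPge => A.
have [[n hn]|bounded] := pselect (exists n, A <= a n).
  by exists n => // m /= nm; exact: le_trans hn (partial_sums_le nm).
exfalso.
have cva : cvgn a.
  apply: nondecreasing_is_cvgn; first by move=> m n; exact: partial_sums_le.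
  exists A => _ [n _ <-]; rewrite leNgt; apply/negP => h; apply: bounded.
  by exists n; exact: ltW.
have := cva => /cvg_ex[/= l al].
have a2l : a (2 * n) @[n --> \oo] --> l.
  apply: (cvg_comp (fun n => (2 * n)%N) a) al.
  by apply/cvgnyPge => B; near=> n; rewrite (@leq_trans n)//; [near: n; exact: nbhs_infty_ge|rewrite leq_pmull].
have := cvg_seqB a2l al; rewrite subrr => /cvgrPdist_lt/(_ _ c0)[N _ hN].
have := hN (maxn N J.+1) (leq_maxl _ _) => /=; apply/negP; rewrite -leNgt.
rewrite sub0r normrN; apply: le_trans (ler_norm _).
by apply: grow; rewrite leq_max ltnSn orbT.
Unshelve. all: by end_near. Qed.

Lemma partial_sums_dilation k : (0 < k)%N ->
  a (k * n)%N / a n @[n --> \oo] --> k%:R `^ alpha.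
Proof.
move=> k0; under eq_fun do rewrite partial_sums_block.
apply: (@ratio_of_sums _ (block k) (fun j => u j.+1)) => //; first exact: block_ratio.
exact: partial_sums_diverge.
Qed.

Lemma partial_sums_rational p q : (0 < p)%N -> (0 < q)%N ->
  a (p * n)%N / a (q * n)%N @[n --> \oo] --> (p%:R / q%:R) `^ alpha.
Proof.
move=> p0 q0.
have q0' : q%:R `^ alpha != 0 :> R by rewrite gt_eqF// powR_gt0// ltr0n.
have := cvg_seqM (partial_sums_dilation p0) (cvg_seqV q0' (partial_sums_dilation q0)).
have -> : p%:R `^ alpha * (q%:R `^ alpha)^-1 = (p%:R / q%:R) `^ alpha :> R.
  rewrite powRM ?invr_ge0//; congr (_ * _).
  by rewrite -[q%:R^-1]powR_inv1// -powRrM mulN1r powRN.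
apply: cvg_eventually_eq; near=> n => /=.
have n0 : (0 < n)%N by near: n; exact: nbhs_infty_gt.
by rewrite invf_div mulrA divfK// gt_eqF// partial_sums_gt0.
Unshelve. all: by end_near. Qed.

(** By monotonicity, from the rational dilations with p / (q + 1) <= t and
    t <= (p + 2) / q, where p is the integer part of t q and q is large. *)
Lemma partial_sums_regular (t : R) : 0 < t ->
  a (Num.Def.trunc (t * n%:R)) / a n @[n --> \oo] --> t `^ alpha.
Proof.
move=> t0; apply/cvgrPdist_lt => e e0; have e20 : 0 < e / 2 by rewrite divr_gt0.
pose p q := Num.Def.trunc (t * q%:R).
have tq_ge0 q : 0 <= t * q%:R by rewrite mulr_ge0// ltW.
have pq : ((p q)%:R / q.+1%:R : R) @[q --> \oo] --> t.
  apply/cvgrPdist_lt => r r0; near=> q.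
  have q0 : 0 < (q.+1%:R : R) by rewrite ltr0n.
  have qr : (1 + t) / r <= q%:R by near: q; exact: nbhs_infty_ger.
  have /andP[p1 p2] := truncn_itv (tq_ge0 q); rewrite -/(p q) -natr1 in p1 p2.
  have -> : t - (p q)%:R / q.+1%:R = (t * q.+1%:R - (p q)%:R) / q.+1%:R.
    by rewrite mulrBl mulfK// gt_eqF.
  rewrite normrM (@ger0_norm _ q.+1%:R^-1) ?invr_ge0// ltr_pdivrMr//.
  rewrite ler_pdivrMr// in qr; rewrite -natr1 ltr_norml; apply/andP; split; lra.
have pq2 : ((p q).+2%:R / q%:R : R) @[q --> \oo] --> t.
  apply/cvgrPdist_lt => r r0; near=> q.
  have q0 : 0 < (q%:R : R) by rewrite ltr0n; near: q; exact: nbhs_infty_gt.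
  have qr : 3 / r <= q%:R by near: q; exact: nbhs_infty_ger.
  have /andP[p1 p2] := truncn_itv (tq_ge0 q); rewrite -/(p q) -natr1 in p1 p2.
  have -> : t - (p q).+2%:R / q%:R = (t * q%:R - (p q).+2%:R) / q%:R.
    by rewrite mulrBl mulfK// gt_eqF.
  rewrite normrM (@ger0_norm _ q%:R^-1) ?invr_ge0// ltr_pdivrMr//.
  rewrite ler_pdivrMr// in qr; rewrite -2!natr1 ltr_norml; apply/andP; split; lra.
have cpow : {for t, continuous (@powR R ^~ alpha)}.
  apply/differentiable_continuous/derivable1_diffP; apply: derivable_powR.
  by rewrite in_itv/= t0.
have := cvg_comp _ _ pq cpow => /cvgrPdist_lt/(_ _ e20) h1.
have := cvg_comp _ _ pq2 cpow => /cvgrPdist_lt/(_ _ e20) h2.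
have [q [/= hq1 hq2 p0 q0]] : exists q, [/\ `|t `^ alpha - ((p q)%:R / q.+1%:R) `^ alpha| < e / 2,
   `|t `^ alpha - ((p q).+2%:R / q%:R) `^ alpha| < e / 2, (0 < p q)%N & (0 < q)%N].
  have : \forall q \near \oo, [/\ `|t `^ alpha - ((p q)%:R / q.+1%:R) `^ alpha| < e / 2,
   `|t `^ alpha - ((p q).+2%:R / q%:R) `^ alpha| < e / 2, (0 < p q)%N & (0 < q)%N].
    near=> q; split.
    - by near: q; exact: h1.
    - by near: q; exact: h2.
    - rewrite /p truncn_gt0 mulrC -ler_pdivrMr//.
      by near: q; exact: nbhs_infty_ger.
    - by near: q; exact: nbhs_infty_gt.
  by move=> /filter_ex.
have lo := partial_sums_rational p0 (ltn0Sn q).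
have hi := partial_sums_rational (ltn0Sn (p q).+1) q0.
have /cvgrPdist_lt/(_ _ e20) {}lo := cvg_comp _ _ (cvg_divnr q q0) lo.
have /cvgrPdist_lt/(_ _ e20) {}hi := cvg_comp _ _ (cvg_divnr q q0) hi.
(* As q m <= n < q (m + 1), for large m the integer part of t n lies between p m
   and (p + 2) m, and n between q m and (q + 1) m. *)
near=> n; pose m := (n %/ q)%N.
have n0 : (0 < n)%N by near: n; exact: nbhs_infty_gt.
have mbig : (q + (p q).+2 <= m)%N.
  by rewrite leq_divRL//; near: n; exact: nbhs_infty_ge.
have hlo : `|((p q)%:R / q.+1%:R) `^ alpha - a (p q * (n %/ q)) / a (q.+1 * (n %/ q))| < e / 2.
  by near: n; exact: lo.
have hhi : `|((p q).+2%:R / q%:R) `^ alpha - a ((p q).+2 * (n %/ q)) / a (q * (n %/ q))| < e / 2.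
  by near: n; exact: hi.
rewrite -/m in hlo hhi.
have qmn : (q * m <= n)%N by rewrite mulnC leq_trunc_div.
have nqm : (n < q * m.+1)%N by rewrite mulnC ltn_ceil.
have qR : 0 < (q%:R : R) by rewrite ltr0n.
have pE := truncn_itv (tq_ge0 q); have nE := truncn_itv (tq_ge0 n).
have m0 : (0 < m)%N by rewrite (leq_trans _ mbig)// addnS.
have am0 : 0 < a (q * m) by apply: partial_sums_gt0; rewrite muln_gt0 q0.
have aqm0 : 0 < a (q.+1 * m) by apply: partial_sums_gt0; rewrite muln_gt0.
have an0 := partial_sums_gt0 n0.
have a_ge0 k : 0 <= a k by apply: sumr_ge0 => i _; exact: ltW.
have lo1 : a (p q * m) / a (q.+1 * m) <= a (Num.Def.trunc (t * n%:R)) / a n.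
  apply: ler_pM; rewrite ?invr_ge0//.
    apply: partial_sums_le; rewrite truncn_ge_nat//.
    apply: (@le_trans _ _ (t * (q * m)%:R)); last by rewrite ler_wpM2l ?(ltW t0)// ler_nat.
    by rewrite !natrM mulrA ler_wpM2r//; case/andP: pE.
  rewrite lef_pV2 ?posrE//; apply: partial_sums_le.
  apply: (leq_trans (ltnW nqm)); rewrite mulnS mulSn leq_add2r.
  by rewrite (leq_trans _ mbig)// leq_addr.
have hi1 : a (Num.Def.trunc (t * n%:R)) / a n <= a ((p q).+2 * m) / a (q * m).
  apply: ler_pM; rewrite ?invr_ge0//.
    apply: partial_sums_le.
    have : (Num.Def.trunc (t * n%:R) < (p q).+1 * m.+1)%N.
      rewrite truncn_lt_nat// (@lt_le_trans _ _ (t * (q * m.+1)%:R))//.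
        by rewrite ltr_pM2l// ltr_nat.
      by rewrite !natrM mulrA ler_wpM2r// ltW//; case/andP: pE.
    move/ltnW/leq_trans; apply; rewrite mulnS [leqRHS]mulSn leq_add2r.
    by rewrite (leq_trans _ mbig)// addnS leqW// leq_addl.
  by rewrite lef_pV2 ?posrE// partial_sums_le.
move: hlo hhi hq1 hq2; rewrite !ltr_norml; lra.
Unshelve. all: by end_near. Qed.

(** A uniform bound that dominates a(t n) / a(n): doubling a large n multiplies
    a(n) by at most 4, and the number of doublings needed to reach m is
    logarithmic. *)
Lemma partial_sums_quadratic : exists2 n0, (0 < n0)%N &
  forall n m, (n0 <= n)%N -> a m <= 4 * (1 + m%:R / n%:R) ^+ 2 * a n.
Proof.
have e0 : 0 < 4 - 2 `^ alpha.
  rewrite subr_gt0 (@le_lt_trans _ _ (2 `^ 1))//; last by rewrite powRr1//; lra.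
  by apply: ler_powR; [lra|exact: ltW].
have := partial_sums_dilation (isT : (0 < 2)%N) => /cvgrPdist_le/(_ _ e0) [N _ hN].
exists N.+1 => // n m Nn; have n0 : (0 < n)%N by apply: leq_trans Nn.
have nR : 0 < (n%:R : R) by rewrite ltr0n.
have double k : (N <= k)%N -> (0 < k)%N -> a (2 * k) <= 4 * a k.
  move=> Nk k0; have := hN k Nk; rewrite /= ler_norml => /andP[+ _].
  rewrite lerBrDr => h; have : a (2 * k) / a k <= 4 by lra.
  by rewrite ler_pdivrMr// partial_sums_gt0.
have pow j : a (2 ^ j * n) <= 4 ^+ j * a n.
  elim: j => [|j IH]; first by rewrite expn0 mul1n expr0 mul1r.
  have k0 : (n <= 2 ^ j * n)%N by rewrite leq_pmull// expn_gt0.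
  rewrite expnS -mulnA (le_trans (double _ _ _))//; first by rewrite (leq_trans _ k0)// ltnW.
    by rewrite (leq_trans n0).
  by rewrite exprS -mulrA ler_wpM2l.
have an := partial_sums_gt0 n0.
have ex : exists j, (m <= 2 ^ j * n)%N.
  by exists m; rewrite (leq_trans (ltnW (ltn_expl m (isT : (1 < 2)%N))))// leq_pmulr.
(* With the least such j, 2 ^ (j - 1) n < m; this turns 4 ^ j into the square of
   m / n. *)
have [j mj jmin] := ex_minnP ex.
apply: (le_trans (partial_sums_le mj)); apply: (le_trans (pow j)).
rewrite ler_wpM2r ?(ltW an)//.
have mn0 : 0 <= (m%:R / n%:R : R) by rewrite divr_ge0// ltW.
case: j mj jmin => [|j] mj jmin.
  by rewrite expr0 -[leLHS]mulr1 ler_pM//; [lra|rewrite exprn_ege1// lerDl].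
have lt : (2 ^ j * n < m)%N by rewrite ltnNge; apply/negP => /jmin; rewrite ltnn.
have h : 2 ^+ j <= 1 + m%:R / n%:R :> R.
  apply: ler_wpDl => //; rewrite ler_pdivlMr// -natrX -natrM ler_nat ltnW//.
rewrite exprS ler_wpM2l// (_ : (4 : R) = 2 ^+ 2); last by ring.
rewrite exprAC ler_sqr// nnegrE ?exprn_ge0//; lra.
Qed.

End regular_variation.

(** * Exponential means of step functions *)

Section exponential_weight.
Context {R : realType}.
Local Notation mu := (@lebesgue_measure R).
Local Notation D := [set` `[(0 : R), +oo[].

(** The density of the exponential law of rate c. *)
Definition expw (c t : R) : R := c * expR (- (c * t)).

Lemma expw_ge0 c t : 0 < c -> 0 <= expw c t.
Proof. by move=> c0; rewrite mulr_ge0 ?expR_ge0// ltW. Qed.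

Lemma continuous_expw c : continuous (expw c).
Proof.
move=> t; apply: cvgM; first exact: cvg_cst.
apply: (@continuous_comp _ _ _ (fun t => - (c * t)) expR); last exact: continuous_expR.
by apply: cvgN; apply: cvgM; [exact: cvg_cst|exact: cvg_id].
Qed.

Lemma measurable_expw c (A : set R) : measurable_fun A (expw c).
Proof. by apply: measurable_funTS; apply: continuous_measurable_fun; exact: continuous_expw. Qed.

Lemma is_derive_expw c (t : R) : is_derive t (1:R) (fun t => - expR (- (c * t))) (expw c t).
Proof.
have h : is_derive t (1:R) (fun t => - (c * t)) (- c).
  rewrite (_ : (fun t => - (c * t)) = (- c) \*: id); last first.
    by apply/funext => y; rewrite /= /GRing.scale/= mulNr.
  by have := is_deriveZ (- c) (is_derive_id t (1:R)); rewrite /GRing.scale/= mulr1.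
have h2 := @is_derive1_comp _ expR (fun t => - (c * t)) t _ _ (is_derive_expR _) h.
have h3 := is_deriveN h2.
by rewrite /expw; move: h3; rewrite mulrN opprK mulrC.
Qed.

Lemma integral_expw_itv c (p q : R) : 0 < c -> p < q ->
  (\int[mu]_(t in `[p, q[) (expw c t)%:E = (expR (- (c * p)) - expR (- (c * q)))%:E)%E.
Proof.
move=> c0 pq; rewrite integral_itv_bndo_bndc; last first.
  by apply/measurable_EFinP; exact: measurable_expw.
rewrite (@continuous_FTC2 _ _ (fun t => - expR (- (c * t))))//.
- by rewrite -EFinB opprK addrC.
- by apply: continuous_subspaceT; exact: continuous_expw.
- have cF : continuous (fun t : R => - expR (- (c * t))).
    move=> t; apply: differentiable_continuous; apply/derivable1_diffP.
    by have [] := is_derive_expw c t.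
  split.
  + by move=> t _; have [] := is_derive_expw c t.
  + by apply: cvg_at_right_filter; exact: cF.
  + by apply: cvg_at_left_filter; exact: cF.
by move=> t _; rewrite derive1E; have [_ ->] := is_derive_expw c t.
Qed.

Definition cell (n m : nat) : set R := `[m%:R / n%:R, m.+1%:R / n%:R[.

Lemma trunc_cell n m t : (0 < n)%N -> cell n m t -> Num.Def.trunc (t * n%:R) = m.
Proof.
move=> n0; rewrite /cell/= in_itv/= ler_pdivrMr ?ltr0n// ltr_pdivlMr ?ltr0n//.
exact: truncn_def.
Qed.

Lemma cell_trunc n t : (0 < n)%N -> 0 <= t -> cell n (Num.Def.trunc (t * n%:R)) t.
Proof.
move=> n0 t0; rewrite /cell/= in_itv/= ler_pdivrMr ?ltr0n// ltr_pdivlMr ?ltr0n//.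
by apply: truncn_itv; rewrite mulr_ge0.
Qed.

Lemma bigcup_cell n : (0 < n)%N -> \bigcup_m cell n m = D.
Proof.
move=> n0; apply/seteqP; split => t /=.
  move=> [m _]; rewrite /cell/= !in_itv/= andbT => /andP[+ _]; apply: le_trans.
  by rewrite divr_ge0.
by rewrite in_itv/= andbT => t0; exists (Num.Def.trunc (t * n%:R)) => //; exact: cell_trunc.
Qed.

Lemma trivIset_cell n : (0 < n)%N -> trivIset setT (cell n).
Proof.
by move=> n0 i j _ _ [t [ti tj]]; rewrite -(trunc_cell n0 ti) -(trunc_cell n0 tj).
Qed.

(** Sequences are turned into functions of the time t = m / n, so that limits on
    the scale n become limits of functions. *)
Definition step (n : nat) (x : nat -> R) (t : R) : R := x (Num.Def.trunc (t * n%:R)).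

Lemma measurable_step n x : (0 < n)%N -> measurable_fun D (step n x).
Proof.
move=> n0; rewrite -(bigcup_cell n0); apply/measurable_fun_bigcup.
  by move=> m; exact: measurable_itv.
move=> m; apply: (@eq_measurable_fun _ _ _ _ _ (cst (x m))) => //.
by move=> t /set_mem tm; rewrite /step (trunc_cell n0 tm).
Qed.

Lemma integral_step c n x : 0 < c -> (0 < n)%N -> (forall m, 0 <= x m) ->
  (\int[mu]_(t in D) (step n x t * expw c t)%:E =
   \sum_(0 <= m <oo) (x m * (expR (- (c / n%:R)) ^+ m * (1 - expR (- (c / n%:R)))))%:E)%E.
Proof.
move=> c0 n0 x0; rewrite -(bigcup_cell n0) ge0_integral_bigcup//=.
- apply: eq_eseriesr => m _.
  transitivity (\int[mu]_(t in cell n m) ((x m)%:E * (expw c t)%:E))%E.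
    by apply: eq_integral => t /set_mem tm; rewrite /step (trunc_cell n0 tm) EFinM.
  rewrite ge0_integralZl//; last 3 first.
  - by apply/measurable_EFinP; exact: measurable_expw.
  - by move=> t _; rewrite lee_fin expw_ge0.
  - by rewrite lee_fin.
  rewrite integral_expw_itv//; last by rewrite ltr_pM2r ?invr_gt0 ?ltr0n// ltr_nat.
  rewrite -EFinM; congr (_ * _)%:E.
  rewrite mulrBr mulr1 -exprSr -!expRM_natl; congr (expR _ - expR _).
    by rewrite mulrN mulrCA.
  by rewrite mulrN mulrCA.
  by apply: measurable_itv.
- by move=> m; exact: measurable_itv.
- apply/measurable_EFinP; rewrite (bigcup_cell n0); apply: measurable_funM.
    exact: measurable_step.
  exact: measurable_expw.
- by move=> t _; rewrite lee_fin mulr_ge0 ?expw_ge0//; exact: x0.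
- exact: trivIset_cell.
Qed.

End exponential_weight.

Section weighted_mean.
Context {R : realType}.
Local Notation mu := (@lebesgue_measure R).
Local Notation D := [set` `[(0 : R), +oo[].
Implicit Types (c : R) (g h : R -> R).

(** Quadratic growth is what [partial_sums_quadratic] provides. *)
Definition tame g := measurable_fun D g /\
  exists M, forall t, 0 <= t -> `|g t| <= M * (1 + t) ^+ 2.

Definition wmean c g : R := \int[mu]_(t in D) (g t * expw c t).

Lemma expw_integrable c : 0 < c -> mu.-integrable D (EFin \o expw c).
Proof.
move=> c0; have := integrable_exponential_pdf c0.
rewrite (_ : EFin \o exponential_pdf c = (EFin \o expw c) \_ D); first by rewrite -integrable_mkcond.
apply/funext => t; rewrite /= /exponential_pdf !patchE.
by case: ifP => // _; rewrite /expw mulNr.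
Qed.

Lemma quadratic_expw_le c : 0 < c -> exists2 K, 0 <= K &
  forall t, 0 <= t -> (1 + t) ^+ 2 * expw c t <= K * expw (c / 2) t.
Proof.
(* Chosen so that m (1 + t) <= 1 + c t / 4 <= exp (c t / 4). *)
move=> c0; pose m := Num.min 1 (c / 4).
have m0 : 0 < m by rewrite lt_min ltr01 divr_gt0.
exists (2 / m ^+ 2); first by rewrite divr_ge0// exprn_ge0// ltW.
move=> t t0; rewrite /expw.
have h : (1 + t) * expR (- (c / 4 * t)) <= m^-1.
  rewrite expRN ler_pdivrMr ?expR_gt0// mulrC -ler_pdivrMr ?invr_gt0// invrK.
  apply: le_trans (expR_ge1Dx _); rewrite mulrDl mul1r.
  have m1 : m <= 1 by rewrite ge_min lexx.
  have m4 : m <= c / 4 by rewrite ge_min lexx orbT.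
  by rewrite lerD// mulrC ler_wpM2r.
have h2 : ((1 + t) * expR (- (c / 4 * t))) ^+ 2 <= m^-1 ^+ 2.
  by rewrite ler_sqr// nnegrE ?invr_ge0 ?(ltW m0)// mulr_ge0 ?expR_ge0//; lra.
have -> : expR (- (c * t)) = expR (- (c / 4 * t)) ^+ 2 * expR (- (c / 2 * t)).
  by rewrite -expRM_natl -expRD; congr expR; field.
have e0 := expR_ge0 (- (c / 2 * t)).
have -> : (1 + t) ^+ 2 * (c * (expR (- (c / 4 * t)) ^+ 2 * expR (- (c / 2 * t)))) =
   ((1 + t) * expR (- (c / 4 * t))) ^+ 2 * (c * expR (- (c / 2 * t))) by ring.
have -> : 2 / m ^+ 2 * (c / 2 * expR (- (c / 2 * t))) = m^-1 ^+ 2 * (c * expR (- (c / 2 * t))).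
  by rewrite exprVn; field; rewrite gt_eqF.
by rewrite ler_wpM2r// mulr_ge0// ltW.
Qed.

Lemma quadratic_integrable c : 0 < c ->
  mu.-integrable D (EFin \o (fun t => (1 + t) ^+ 2 * expw c t)).
Proof.
move=> c0; have [K K0 hK] := quadratic_expw_le c0.
have c20 : 0 < c / 2 by rewrite divr_gt0.
apply: (@le_integrable _ _ _ mu D _ _ (fun t => (K%:E * (expw (c / 2) t)%:E)%E)) => //.
- apply/measurable_EFinP; apply: measurable_funM; last exact: measurable_expw.
  apply: measurable_funX; apply: measurable_funD => //; exact: measurable_id.
- move=> t /=; rewrite in_itv/= andbT => t0; rewrite lee_fin.
  rewrite (ger0_norm (mulr_ge0 (sqr_ge0 _) (expw_ge0 t c0))) (ger0_norm (mulr_ge0 K0 (expw_ge0 t c20))).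
  exact: hK.
- by apply: (@integrableZl _ _ _ _ _ _ K _ (expw_integrable c20)).
Qed.

Lemma tame_integrable c g : 0 < c -> tame g ->
  mu.-integrable D (EFin \o (fun t => g t * expw c t)).
Proof.
move=> c0 [mg [M gM]].
apply: (@le_integrable _ _ _ mu D _ _ (fun t => (`|M|%:E * ((1 + t) ^+ 2 * expw c t)%:E)%E)) => //.
- by apply/measurable_EFinP; apply: measurable_funM => //; exact: measurable_expw.
- move=> t /=; rewrite in_itv/= andbT => t0; rewrite lee_fin.
  rewrite normrM [leRHS]normrM normr_id (ger0_norm (expw_ge0 t c0)) (ger0_norm (mulr_ge0 (sqr_ge0 _) (expw_ge0 t c0))).
  rewrite [leRHS]mulrA ler_wpM2r ?expw_ge0// (le_trans (gM t t0))//.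
  by rewrite ler_wpM2r ?sqr_ge0// ler_norm.
- by apply: (@integrableZl _ _ _ _ _ _ _ _ (quadratic_integrable c0)).
Qed.

Lemma tame_bounded g M : measurable_fun D g -> (forall t, 0 <= t -> `|g t| <= M) -> tame g.
Proof.
move=> mg gM; split=> //; exists M => t t0; apply: le_trans (gM t t0) _.
have M0 : 0 <= M by exact: le_trans (gM t t0).
by rewrite ler_peMr// exprn_ege1// lerDl.
Qed.

Lemma tameD g h : tame g -> tame h -> tame (fun t => g t + h t).
Proof.
move=> [mg [M gM]] [mh [N hN]]; split; first exact: measurable_funD.
exists (M + N) => t t0; rewrite mulrDl (le_trans (ler_normD _ _))// lerD ?gM ?hN//.
Qed.

Lemma tameZ k g : tame g -> tame (fun t => k * g t).
Proof.
move=> [mg [M gM]]; split; first exact: measurable_funM.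
by exists (`|k| * M) => t t0; rewrite normrM -mulrA ler_wpM2l// gM.
Qed.

Lemma wmeanD c g h : 0 < c -> tame g -> tame h ->
  wmean c (fun t => g t + h t) = wmean c g + wmean c h.
Proof.
move=> c0 tg th; rewrite /wmean -RintegralD//; try exact: tame_integrable.
by apply: eq_Rintegral => t _; rewrite mulrDl.
Qed.

Lemma wmeanZ c k g : 0 < c -> tame g -> wmean c (fun t => k * g t) = k * wmean c g.
Proof.
move=> c0 tg; rewrite /wmean -RintegralZl//; last exact: tame_integrable.
by apply: eq_Rintegral => t _; rewrite mulrA.
Qed.

Lemma wmean_le c g h : 0 < c -> tame g -> tame h ->
  (forall t, 0 <= t -> g t <= h t) -> wmean c g <= wmean c h.
Proof.
move=> c0 tg th gh; apply: le_Rintegral => //; try exact: tame_integrable.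
by move=> t /=; rewrite in_itv/= andbT => t0; rewrite ler_wpM2r ?expw_ge0// gh.
Qed.

Lemma wmean_cvg c (M : R) (g_ : nat -> R -> R) g : 0 < c ->
  (forall n, measurable_fun D (g_ n)) -> measurable_fun D g ->
  (\forall n \near \oo, forall t, 0 <= t -> `|g_ n t| <= M * (1 + t) ^+ 2) ->
  (forall t, 0 < t -> g_ n t @[n --> \oo] --> g t) ->
  wmean c (g_ n) @[n --> \oo] --> wmean c g.
Proof.
move=> c0 mg_ mg [N _ gM] cg.
rewrite -(cvg_shiftn N (fun n => wmean c (g_ n))).
have M0 : 0 <= M.
  have := gM N (leqnn N) 0 (lexx 0); rewrite addr0 expr1n mulr1; exact: le_trans.
have := @dominated_convergence _ _ _ mu D _ (fun n t => (g_ (n + N)%N t * expw c t)%:E)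
  (fun t => (g t * expw c t)%:E) (fun t => (M%:E * ((1 + t) ^+ 2 * expw c t)%:E)%E).
case=> //.
- by move=> n; apply/measurable_EFinP; apply: (@measurable_funM _ _ _ D (g_ (n + N)%N) (expw c)) => //; exact: measurable_expw.
- by apply/measurable_EFinP; apply: (@measurable_funM _ _ _ D g (expw c)) => //; exact: measurable_expw.
- exists [set 0]; split => //; first exact: lebesgue_measure_set1.
  move=> t /= h; apply: contrapT => /eqP t_neq0; apply: h; rewrite in_itv/= andbT => t0.
  apply: cvg_EFin; first exact: nearW.
  have tpos : 0 < t by rewrite lt_neqAle eq_sym t_neq0.
  have := cg t tpos; rewrite -(cvg_shiftn N) => h.
  exact: (cvg_seqM h (cvg_cst _)).
- by apply: (@integrableZl _ _ _ _ _ _ _ _ (quadratic_integrable c0)).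
- apply: aeW => t n /=; rewrite in_itv/= andbT => t0; rewrite lee_fin normrM (ger0_norm (expw_ge0 _ c0)).
  by rewrite [leRHS]mulrA ler_wpM2r ?expw_ge0// gM//= leq_addl.
move=> ig _ cv; apply: (@fine_cvg _ _ _ _ (fun n => (\int[mu]_(t in D) (g_ (n + N)%N t * expw c t)%:E)%E)).
by rewrite /wmean /Rintegral fineK//; exact: integrable_fin_num.
Qed.

(** The mass that the exponential law of rate c gives to the m-th cell of length
    1 / n, a geometric weight. *)
Definition geom_weight c n m : R := expR (- (c / n%:R)) ^+ m * (1 - expR (- (c / n%:R))).

Lemma series_step c n (x : nat -> R) : 0 < c -> (0 < n)%N -> (forall m, 0 <= x m) ->
  tame (step n x) ->
  \sum_(m < M) x m * geom_weight c n m @[M --> \oo] --> wmean c (step n x).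
Proof.
move=> c0 n0 x0 tx; have it := tame_integrable c0 tx.
have fin : (\int[mu]_(t in D) (step n x t * expw c t)%:E)%E \is a fin_num by exact: integrable_fin_num.
have e0 : 0 <= 1 - expR (- (c / n%:R)) :> R.
  by rewrite subr_ge0 -expR0 ler_expR oppr_le0 divr_ge0// ltW.
have gw m : 0 <= geom_weight c n m by rewrite mulr_ge0// exprn_ge0// expR_ge0.
have h : cvgn (fun M => \sum_(0 <= m < M) (x m * geom_weight c n m)%:E)%E.
  by apply: is_cvg_nneseries => m _ _; rewrite lee_fin mulr_ge0.
have cv : ((\sum_(0 <= m < M) (x m * geom_weight c n m)%:E)%E @[M --> \oo] -->
    \int[mu]_(t in D) (step n x t * expw c t)%:E)%E.
  by rewrite (integral_step c0 n0 x0); exact: h.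
rewrite -[X in _ --> X](fineK fin) in cv.
apply: (@cvg_eventually_eq _ (fun M => fine (\sum_(0 <= m < M) (x m * geom_weight c n m)%:E)%E));
  last exact: (fine_cvg cv).
apply: nearW => M.
by rewrite sumEFin big_mkord.
Qed.

End weighted_mean.

(** * Convolutions, Gamma integrals and an Abelian theorem *)

Section convolution.
Context {R : realType}.
Variables x y : nat -> R.
Hypotheses (x0 : forall i, 0 <= x i) (y0 : forall i, 0 <= y i).

Let X n := \sum_(i < n) x i.
Let Y n := \sum_(i < n) y i.
Let C n := \sum_(m < n) \sum_(i < m) x i * y (m - i.+1)%N.

Let convE n : C n = \sum_(i < n) x i * Y (n - i.+1)%N.
Proof.
elim: n => [|n IH]; first by rewrite /C !big_ord0.
rewrite /C big_ord_recr/= -/(C n) IH [in RHS]big_ord_recr/= subnn.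
rewrite [Y 0]/Y big_ord0 mulr0 addr0 -big_split/=; apply: eq_bigr => i _.
rewrite -mulrDr; congr (_ * _); rewrite subSS -[(n - i)%N]prednK ?subn_gt0//.
by rewrite subnS /Y big_ord_recr.
Qed.

Let Y_le m n : (m <= n)%N -> Y m <= Y n.
Proof.
apply: (@homo_leq _ Y <=%O) => // [|k]; first exact: le_trans.
by rewrite /Y big_ord_recr lerDl.
Qed.

Let C_le m n : (m <= n)%N -> C m <= C n.
Proof.
apply: (@homo_leq _ C <=%O) => // [|k]; first exact: le_trans.
by rewrite /C big_ord_recr lerDl sumr_ge0// => i _; exact: mulr_ge0.
Qed.

Let Y_ge0 n : 0 <= Y n.
Proof. exact: sumr_ge0. Qed.

Lemma convolution_le n : C n <= X n * Y n.
Proof.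
rewrite convE /X big_distrl/=; apply: ler_sum => i _; rewrite ler_wpM2l//.
by apply: Y_le; exact: leq_subr.
Qed.

(** Every pair of indices below n has its sum below n + n. *)
Lemma convolution_ge n : X n * Y n <= C (n + n).
Proof.
rewrite convE /X big_distrl/= big_split_ord/=.
apply: ler_wpDr; first by apply: sumr_ge0 => i _; exact: mulr_ge0.
apply: ler_sum => i _; rewrite ler_wpM2l//; apply: Y_le.
by rewrite leq_subRL ?leq_add2r// (leq_trans (ltn_ord i))// leq_addr.
Qed.

Lemma cvg_convolution (a b : R) : X n @[n --> \oo] --> a -> Y n @[n --> \oo] --> b ->
  C n @[n --> \oo] --> a * b.
Proof.
move=> Xa Yb; have XY := cvg_seqM Xa Yb.
apply: (@squeeze_cvgr _ _ _ _ (fun n => X (n %/ 2) * Y (n %/ 2)) (fun n => X n * Y n)) => //.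
  apply: nearW => n; rewrite convolution_le andbT.
  apply: (le_trans (convolution_ge _)); apply: C_le.
  by rewrite addnn -muln2 leq_trunc_div.
exact: (cvg_comp _ _ (cvg_divnr 2 isT) XY).
Qed.

(** For nonnegative sequences, a convergent Cauchy product has convergent
    factors, as soon as the other factor is nonzero. *)
Lemma convolution_factor_cvg (c : R) : Y 1 = 1 -> C n @[n --> \oo] --> c ->
  exists a : R, X n @[n --> \oo] --> a.
Proof.
move=> Y1 Cc; suff : cvgn X by move=> /cvg_ex.
apply: nondecreasing_is_cvgn.
  apply: homo_leq => // [|k]; first exact: le_trans.
  by rewrite /X big_ord_recr lerDl.
have [M [_ hM]] := cvg_seq_bounded (cvgP _ Cc).
exists (M + 1) => _ [n _ <-]; case: n => [|n].
  rewrite /X big_ord0; apply: le_trans (hM (M + 1) _ 0%N I); first exact: normr_ge0.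
  by rewrite ltrDl.
apply: (@le_trans _ _ (X n.+1 * Y n.+1)).
  by rewrite ler_peMr ?sumr_ge0// -Y1 Y_le.
apply: (le_trans (convolution_ge _)); apply: le_trans (ler_norm _) _.
by apply: hM => //; rewrite ltrDl.
Qed.

End convolution.

Section gamma_scaling.
Context {R : realType}.
Local Notation mu := (@lebesgue_measure R).
Local Notation D := [set` `[(0 : R), +oo[].
Implicit Types (c g : R).

Lemma measurable_powR_fun g (A : set R) : measurable_fun A (fun t : R => t `^ g).
Proof. by apply: measurable_funTS; exact: measurable_powR. Qed.

Lemma powR_expR_le g : 0 <= g -> exists2 K : R, 0 <= K &
  forall t, 0 <= t -> t `^ g * expR (- t) <= K * expR (- (t / 2)).
Proof.
move=> g0; pose N := (Num.Def.trunc g).+1.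
have gN : g <= N%:R by exact/ltW/truncnS_gt.
have N0 : 0 < (N%:R : R) by rewrite ltr0n.
exists ((2 * N%:R) ^+ N); first by rewrite exprn_ge0// mulr_ge0.
move=> t t0.
have e1 : expR (- t) = expR (- (t / 2)) * expR (- (t / 2)).
  by rewrite -expRD; congr expR; field.
rewrite e1 mulrA ler_wpM2r ?expR_ge0// expRN ler_pdivrMr ?expR_gt0//.
have step1 : (1 + t / (2 * N%:R)) ^+ N <= expR (t / 2).
  have -> : t / 2 = N%:R * (t / (2 * N%:R)) by field; rewrite gt_eqF.
  rewrite expRM_natl ler_pXn2r ?nnegrE ?expR_ge0 ?expR_ge1Dx//.
  by rewrite addr_ge0// divr_ge0// mulr_ge0.
apply: (@le_trans _ _ ((2 * N%:R) ^+ N * (1 + t / (2 * N%:R)) ^+ N)); last first.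
  by rewrite ler_wpM2l// exprn_ge0// mulr_ge0.
rewrite -exprMn mulrDr mulr1 mulrCA divff ?mulr1; last by rewrite gt_eqF// mulr_gt0.
have N1 : 1 <= (N%:R : R) by rewrite ler1n.
apply: (@le_trans _ _ ((1 + t) `^ g)).
  by apply: ge0_ler_powR; rewrite ?nnegrE//; lra.
apply: (@le_trans _ _ ((1 + t) `^ N%:R)); first by apply: ler_powR => //; lra.
rewrite powR_mulrn; last by lra.
rewrite ler_pXn2r ?nnegrE//; lra.
Qed.

Lemma powR_integrable c g : 0 < c -> 0 <= g ->
  mu.-integrable D (EFin \o (fun t => t `^ g * expw c t)).
Proof.
move=> c0 g0; have [K K0 hK] := powR_expR_le g0.
have c20 : 0 < c / 2 by rewrite divr_gt0.
have cg : 0 < c `^ g by rewrite powR_gt0.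
pose M := 2 * K / c `^ g; have M0 : 0 <= M by rewrite divr_ge0 ?(ltW cg)// mulr_ge0.
apply: (@le_integrable _ _ _ mu D _ _ (fun t => (M%:E * (expw (c / 2) t)%:E)%E)) => //.
- apply/measurable_EFinP; apply: (@measurable_funM _ _ _ D (fun t => t `^ g) (expw c)).
    exact: measurable_powR_fun.
  exact: measurable_expw.
- move=> t /=; rewrite in_itv/= andbT => t0; rewrite lee_fin.
  rewrite (ger0_norm (mulr_ge0 (powR_ge0 _ _) (expw_ge0 t c0))).
  rewrite (ger0_norm (mulr_ge0 M0 (expw_ge0 t c20))).
  have := hK _ (mulr_ge0 (ltW c0) t0); rewrite powRM// ?(ltW c0)// => h.
  rewrite /expw /M -(ler_pM2l cg).
  have -> : c `^ g * (t `^ g * (c * expR (- (c * t)))) =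
            c * (c `^ g * t `^ g * expR (- (c * t))) by ring.
  have -> : c `^ g * (2 * K / c `^ g * (c / 2 * expR (- (c / 2 * t)))) =
            c * (K * expR (- (c * t / 2))).
    by rewrite [c * t / 2]mulrAC; field; rewrite gt_eqF.
  by rewrite ler_wpM2l// ltW.
- by apply: (@integrableZl _ _ _ _ _ _ M _ (expw_integrable c20)).
Qed.

Lemma gamma_funE g : gamma_fun (1 + g) = wmean 1 (fun t : R => t `^ g).
Proof.
rewrite /gamma_fun /wmean /Rintegral; congr fine.
rewrite integral_itv_obnd_cbnd; last first.
  apply/measurable_EFinP; apply: measurable_funM; first exact: measurable_powR_fun.
  apply: measurable_funTS; apply: measurableT_comp => //; exact: measurable_funN.
apply: eq_integral => t _; rewrite /expw !mul1r.
by rewrite addrAC subrr add0r.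
Qed.

Lemma gamma_fun_gt0 g : 0 <= g -> 0 < gamma_fun (1 + g) :> R.
Proof.
move=> g0; rewrite gamma_funE.
have ig := powR_integrable (@ltr01 R) g0.
rewrite -lte_fin /wmean /Rintegral fineK; last exact: integrable_fin_num.
apply: (@lt_le_trans _ _ (\int[mu]_(t in `[1%R, 2%R[) (expw 1 t)%:E)%E).
  rewrite integral_expw_itv//; last by lra.
  by rewrite lte_fin subr_gt0 ltr_expR; lra.
apply: (@le_trans _ _ (\int[mu]_(t in `[1%R, 2%R[) (t `^ g * expw 1 t)%:E)%E).
  apply: ge0_le_integral => //.
  - by move=> t _; rewrite lee_fin expw_ge0.
  - by apply/measurable_EFinP; exact: measurable_expw.
  - apply/measurable_EFinP; apply: (@measurable_funM _ _ _ _ (fun t => t `^ g) (expw 1)).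
      exact: measurable_powR_fun.
    exact: measurable_expw.
  move=> t /=; rewrite in_itv/= => /andP[t1 _].
  rewrite lee_fin ler_peMl ?expw_ge0// -(powRr0 t); exact: ler_powR.
apply: ge0_subset_integral => //.
- by apply/measurable_EFinP; have /integrableP[/measurable_EFinP] := ig.
- by move=> t _; rewrite lee_fin mulr_ge0 ?powR_ge0 ?expw_ge0.
- by move=> t /=; rewrite !in_itv/= andbT => /andP[t1 _]; lra.
Qed.

(** The change of variables t |-> c t. *)
Lemma wmean_powR c g : 0 < c -> 0 <= g ->
  wmean c (fun t : R => t `^ g) = gamma_fun (1 + g) * c `^ (- g).
Proof.
move=> c0 g0.
have ig := powR_integrable (@ltr01 R) g0.
have mG : measurable_fun D (EFin \o (fun t => t `^ g * expw 1 t)).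
  by have /integrableP[] := ig.
have cG : {within D, continuous (fun t : R => t `^ g * expw 1 t)}.
  apply/continuous_within_itvcyP; split.
    move=> t; rewrite in_itv/= andbT => t0; apply: cvgM; last exact: continuous_expw.
    have cpow : {for t, continuous (@powR R ^~ g)}.
      apply/differentiable_continuous; apply/derivable1_diffP; apply: derivable_powR.
      by rewrite in_itv/= t0.
    exact: cpow.
  apply: cvgM; last by apply: cvg_at_right_filter; exact: continuous_expw.
  move: g0; rewrite le_eqVlt => /predU1P[<-|g0].
    by under eq_fun do rewrite powRr0; rewrite powRr0; exact: cvg_cst.
  by rewrite powR0 ?gt_eqF//; exact: powR_cvg0.
have dF : (( *%R c : R -> R)^`() = cst c)%classic.
  apply/funext => t; rewrite derive1E.
  by have := @derive_val _ _ _ _ _ _ _ (is_deriveZ c (is_derive_id t (1:R))); rewrite /GRing.scale/= mulr1.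
have := @increasing_ge0_integration_by_substitutiony R ( *%R c) (fun t : R => t `^ g * expw 1 t) 0.
rewrite dF mulr0 => H.
have cg : 0 < c `^ g by rewrite powR_gt0.
suff -> : gamma_fun (1 + g) = c `^ g * wmean c (fun t : R => t `^ g).
  by rewrite powRN mulrAC divff ?mul1r// gt_eqF.
rewrite gamma_funE /wmean -RintegralZl//; last exact: powR_integrable.
rewrite /Rintegral; congr fine; rewrite H //.
- apply: eq_integral => t; rewrite inE/= in_itv/= andbT => t0.
  rewrite -[LHS]/(((c * t) `^ g * expw 1 (c * t) * c)%:E).
  rewrite powRM// ?(ltW c0)// /expw !mul1r; congr EFin.
  by rewrite -mulrA [expR _ * c]mulrC !mulrA.
- by move=> a b _ _; rewrite ltr_pM2l.
- by move=> t _; exact: cvg_cst.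
- exact: is_cvg_cst.
- exact: is_cvg_cst.
- split.
    by move=> t _; have [] := is_deriveZ c (is_derive_id t (1:R)).
  apply: cvg_at_right_filter; apply: cvgM; [exact: cvg_cst|exact: cvg_id].
- by apply: gt0_cvgMry => //; exact: cvg_id.
- by move=> t _; rewrite mulr_ge0 ?powR_ge0 ?expw_ge0.
Qed.

End gamma_scaling.

Section abel.
Context {R : realType}.
Variables (u : nat -> R) (alpha : R).
Hypothesis u_gt0 : forall i, 0 < u i.+1.
Hypothesis alpha_gt0 : 0 < alpha.
Hypothesis alpha_lt1 : alpha < 1.
Hypothesis u_succ : u n.+1 / u n @[n --> \oo] --> (1 : R).
Hypothesis u_dilation : forall k, (0 < k)%N ->
  u (k * n)%N / u n @[n --> \oo] --> k%:R `^ (alpha - 1).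

Local Notation a := (partial_sums u).

Lemma step_partial_sums_le : exists2 n0, (0 < n0)%N & forall n, (n0 <= n)%N ->
  forall t, 0 <= t -> 0 <= step n a t <= 4 * a n * (1 + t) ^+ 2.
Proof.
have [n0 n00 h] := partial_sums_quadratic u_gt0 alpha_gt0 alpha_lt1 u_succ u_dilation.
exists n0 => // n nn0 t t0; have n_gt0 : (0 < n)%N by exact: leq_trans nn0.
have nR : 0 < (n%:R : R) by rewrite ltr0n.
have an := partial_sums_gt0 u_gt0 n_gt0.
rewrite /step sumr_ge0 => [|i _]; last exact: ltW.
apply: (le_trans (h n _ nn0)); rewrite mulrAC ler_wpM2l ?mulr_ge0 ?(ltW an)//.
rewrite ler_pXn2r ?nnegrE//; last by lra.
  rewrite lerD2l ler_pdivrMr//; have tn0 : 0 <= t * n%:R by rewrite mulr_ge0.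
  by case/andP: (truncn_itv tn0).
Qed.

Lemma tame_step_partial_sums : exists2 n0, (0 < n0)%N &
  forall n, (n0 <= n)%N -> tame (step n a).
Proof.
have [n0 n00 h] := step_partial_sums_le; exists n0 => // n nn0; split.
  by apply: measurable_step; exact: leq_trans nn0.
by exists (4 * a n) => t t0; have /andP[h0 h1] := h n nn0 t t0; rewrite ger0_norm.
Qed.

(** Regular variation gives a(t n) / a(n) -> t^alpha for each t, and the
    quadratic bound dominates. *)
Lemma abel_partial_sums c : 0 < c ->
  wmean c (step n a) / a n @[n --> \oo] --> gamma_fun (1 + alpha) * c `^ (- alpha).
Proof.
move=> c0; rewrite -wmean_powR//; last exact: ltW.
rewrite -(cvg_shiftS (fun n => wmean c (step n a) / a n)).
have [n0 n00 h] := step_partial_sums_le.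
have [n1 n10 tm] := tame_step_partial_sums.
apply: (@cvg_eventually_eq _ (fun n => wmean c (fun t => (a n.+1)^-1 * step n.+1 a t))).
  near=> n; rewrite wmeanZ//; first by rewrite mulrC.
  by apply: tm; near: n; exists n1 => // k /= nk; exact: leqW.
apply: (@wmean_cvg _ _ 4) => //.
- move=> n; apply: (@measurable_funM _ _ _ _ (cst (a n.+1)^-1) (step n.+1 a)) => //.
  exact: measurable_step.
- exact: measurable_powR_fun.
- near=> n => t t0; have an := partial_sums_gt0 u_gt0 (ltn0Sn n).
  have nn0 : (n0 <= n.+1)%N by near: n; exists n0 => // k /= nk; exact: leqW.
  have /andP[h0 h1] := h n.+1 nn0 t t0.
  rewrite ger0_norm ?mulr_ge0 ?invr_ge0 ?(ltW an)// ler_pdivrMl//.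
  by rewrite mulrA [a _ * 4]mulrC.
move=> t t0; have := partial_sums_regular u_gt0 alpha_gt0 alpha_lt1 u_succ u_dilation t0.
rewrite -(cvg_shiftS (fun n => a (Num.Def.trunc (t * n%:R)) / a n)).
apply: cvg_eventually_eq; apply: nearW => n.
by rewrite mulrC.
Unshelve. all: by end_near. Qed.

End abel.

(** * The renewal inequality under the exponential mean *)

Section renewal_transform.
Context {R : realType}.
Variables (u : nat -> R) (c : R) (n : nat).
Hypotheses (u_gt0 : forall i, 0 < u i.+1) (c0 : 0 < c) (n0 : (0 < n)%N).

Local Notation a := (partial_sums u).
Hypothesis tame_a : tame (step n a).

Let s := expR (- (c / n%:R)) : R.

Let s_gt0 : 0 < s. Proof. exact: expR_gt0. Qed.

Let s_lt1 : s < 1.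
Proof. by rewrite /s -[ltRHS]expR0 ltr_expR oppr_lt0 divr_gt0// ltr0n. Qed.

Let U := wmean c (step n a).

Let xs i := u i.+1 * s ^+ i.+1.

Let xs_ge0 i : 0 <= xs i.
Proof. by rewrite mulr_ge0 ?(ltW (u_gt0 i))// exprn_ge0// ltW. Qed.

Let conv_weight (v : nat -> R) m :
  (\sum_(i < m) u i.+1 * v (m - i.+1)%N) * geom_weight c n m =
  (1 - s) * \sum_(i < m) xs i * (v (m - i.+1)%N * s ^+ (m - i.+1)).
Proof.
rewrite /geom_weight -/s mulrA [LHS]mulrC; congr (_ * _).
rewrite big_distrl/=; apply: eq_bigr => i _.
have -> : s ^+ m = s ^+ i.+1 * s ^+ (m - i.+1) by rewrite -exprD subnKC.
by rewrite /xs; ring.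
Qed.

Let geom_cvg : \sum_(m < M) s ^+ m @[M --> \oo] --> (1 - s)^-1.
Proof.
have := @cvg_geometric_series R 1 s; rewrite ger0_norm ?(ltW s_gt0)// div1r => /(_ s_lt1).
apply: cvg_eventually_eq; apply: nearW => M.
by rewrite /series/= big_mkord; apply: eq_bigr => i _; rewrite /geometric/= mul1r.
Qed.

Let s1 : 1 - s != 0. Proof. by rewrite subr_eq0 gt_eqF. Qed.

Let weight_cvg : \sum_(m < M) geom_weight c n m @[M --> \oo] --> (1 : R).
Proof.
have := cvg_seqM geom_cvg (@cvg_seq_cst R (1 - s)); rewrite mulVf//.
by apply: cvg_eventually_eq; apply: nearW => M; rewrite big_distrl.
Qed.

Let xs_cvg : \sum_(i < M) xs i @[M --> \oo] --> U.
Proof.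
have s_ge0 i : 0 <= s ^+ i by rewrite exprn_ge0// ltW.
have a_ge0 m : 0 <= a m by apply: sumr_ge0 => i _; exact: ltW.
have ua := series_step c0 n0 a_ge0 tame_a.
have convU : \sum_(m < M) \sum_(i < m) xs i * s ^+ (m - i.+1) @[M --> \oo] --> (1 - s)^-1 * U.
  have := cvg_seqM (@cvg_seq_cst R (1 - s)^-1) ua; apply: cvg_eventually_eq; apply: nearW => M.
  rewrite big_distrr/=; apply: eq_bigr => m _.
  have aE : a m = \sum_(i < m) u i.+1 * (fun=> 1) (m - i.+1)%N.
    by apply: eq_bigr => i _; rewrite mulr1.
  rewrite aE (conv_weight (fun=> 1)) mulrA mulVf// mul1r.
  by apply: eq_bigr => i _; rewrite mul1r.
have [|X Xcvg] := convolution_factor_cvg xs_ge0 s_ge0 _ convU; first by rewrite big_ord1 expr0.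
have := cvg_convolution xs_ge0 s_ge0 Xcvg geom_cvg => h.
have E : U / (1 - s) = X / (1 - s).
  by rewrite mulrC; exact: (cvg_unique (@Rhausdorff R) convU h).
by rewrite (mulIf (invr_neq0 s1) E).
Qed.

(** Sum the hypothesis against [geom_weight].  The weight of m is s^m (1 - s), so
    the convolution of u and v becomes a Cauchy product of the power series of u
    and v at s, and the series of u at s is the mean U of its partial sums. *)
Lemma renewal_transform (v : nat -> R) (h theta C e : R) :
  (forall m, 0 <= v m <= 1) -> 0 <= theta ->
  (forall m, `|h - v m - theta * \sum_(i < m) u i.+1 * v (m - i.+1)%N| <=
     theta * (C + e * a m)) ->
  `|h - wmean c (step n v) * (1 + theta * U)| <= theta * (C + e * U).
Proof.
move=> v01 th0 hv; set V := wmean c (step n v).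
have v0 m : 0 <= v m by case/andP: (v01 m).
have s_ge0 i : 0 <= s ^+ i by rewrite exprn_ge0// ltW.
have g0 m : 0 <= geom_weight c n m by rewrite mulr_ge0// subr_ge0 ltW.
have a_ge0 m : 0 <= a m by apply: sumr_ge0 => i _; exact: ltW.
have tv : tame (step n v).
  apply: (@tame_bounded _ _ 1); first exact: measurable_step.
  by move=> t _; rewrite ger0_norm ?v0//; case/andP: (v01 (Num.Def.trunc (t * n%:R))).
have vV := series_step c0 n0 v0 tv.
have aU := series_step c0 n0 a_ge0 tame_a.
have ys0 j : 0 <= v j * s ^+ j by exact: mulr_ge0.
have ysV : \sum_(j < M) v j * s ^+ j @[M --> \oo] --> V * (1 - s)^-1.
  have := cvg_seqM vV (@cvg_seq_cst R (1 - s)^-1); apply: cvg_eventually_eq; apply: nearW => M.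
  rewrite big_distrl/=; apply: eq_bigr => m _.
  by rewrite /geom_weight -/s mulrA mulfK.
have conv := cvg_convolution xs_ge0 ys0 xs_cvg ysV.
have convUV : \sum_(m < M) (\sum_(i < m) u i.+1 * v (m - i.+1)%N) * geom_weight c n m
    @[M --> \oo] --> U * V.
  have := cvg_seqM (@cvg_seq_cst R (1 - s)) conv.
  have -> : (1 - s) * (U * (V / (1 - s))) = U * V by field; rewrite subr_eq0 gt_eqF.
  apply: cvg_eventually_eq; apply: nearW => M.
  by rewrite big_distrr/=; apply: eq_bigr => m _; rewrite conv_weight.
have lhs : \sum_(m < M) (h - v m - theta * \sum_(i < m) u i.+1 * v (m - i.+1)%N) *
    geom_weight c n m @[M --> \oo] --> h - V * (1 + theta * U).
  have -> : h - V * (1 + theta * U) = h * 1 - V - theta * (U * V) by ring.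
  have := cvg_seqB (cvg_seqB (cvg_seqM (@cvg_seq_cst R h) weight_cvg) vV) (cvg_seqM (@cvg_seq_cst R theta) convUV).
  apply: cvg_eventually_eq; apply: nearW => M.
  rewrite !big_distrr/= -!sumrB; apply: eq_bigr => m _; ring.
have rhs : \sum_(m < M) (theta * (C + e * a m)) * geom_weight c n m @[M --> \oo] -->
    theta * (C + e * U).
  have := cvg_seqM (@cvg_seq_cst R theta) (cvg_seqD (cvg_seqM (@cvg_seq_cst R C) weight_cvg) (cvg_seqM (@cvg_seq_cst R e) aU)).
  rewrite mulr1; apply: cvg_eventually_eq; apply: nearW => M /=.
  rewrite !big_distrr/= -big_split/= big_distrr/=; apply: eq_bigr => m _; ring.
apply: (cvg_seq_le _ (cvg_seq_norm lhs) rhs) => M.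
apply: (le_trans (ler_norm_sum _ _ _)); apply: ler_sum => m _.
by rewrite normrM (ger0_norm (g0 m)) ler_wpM2r.
Qed.

End renewal_transform.

(** * Exponential means of the transform of the visits *)

Lemma one_minus_expRN (R : realType) (y : R) : 0 <= y ->
  y / (1 + y) <= 1 - expR (- y) <= y.
Proof.
move=> y0; have y1 : 0 < 1 + y by lra.
have h1 := expR_ge1Dx (- y); have h2 := expR_ge1Dx y.
apply/andP; split; last by lra.
have : expR (- y) <= (1 + y)^-1 by rewrite expRN lef_pV2 ?posrE ?expR_gt0.
have -> : y / (1 + y) = 1 - (1 + y)^-1 by field; rewrite gt_eqF.
lra.
Qed.

(** The bounds y / (1 + y) <= 1 - exp (- y) <= y at y = lambda / a. *)
Lemma cvg_one_minus_exp (R : realType) (lambda : R) (a : nat -> R) : 0 < lambda ->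
  a n @[n --> \oo] --> +oo ->
  (1 - expR (- (lambda / a n))) * a n @[n --> \oo] --> lambda.
Proof.
move=> l0 aoo; apply/cvgrPdist_le => e e0.
move/cvgryPge : aoo => aoo; near=> n.
have an : lambda ^+ 2 / e + 1 <= a n by near: n; exact: aoo.
have le0 : 0 <= lambda ^+ 2 / e by rewrite divr_ge0 ?sqr_ge0// ltW.
have a0 : 0 < a n by lra.
have y0 : 0 <= lambda / a n by rewrite divr_ge0// ltW.
have /andP[h1 h2] := one_minus_expRN y0.
have k1 : (1 - expR (- (lambda / a n))) * a n <= lambda.
  by have := ler_wpM2r (ltW a0) h2; rewrite divfK// gt_eqF.
have k2 : lambda - e <= (1 - expR (- (lambda / a n))) * a n.
  apply: le_trans (ler_wpM2r (ltW a0) h1).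
  have al : 0 < a n + lambda by lra.
  have -> : lambda / a n / (1 + lambda / a n) * a n = lambda - lambda ^+ 2 / (a n + lambda).
    field; rewrite !gt_eqF//=; lra.
  rewrite lerD2l lerN2 ler_pdivrMr//.
  have : lambda ^+ 2 / e <= a n + lambda by lra.
  by rewrite ler_pdivrMr// mulrC.
rewrite ler_norml; apply/andP; split; lra.
Unshelve. all: by end_near. Qed.

Section visits_transform.
Context d (T : measurableType d) (R : realType) (P : probability T R).
Variables (s : T -> T) (z : nat -> T -> bool).
Hypothesis ms : measurable_fun setT s.
Hypothesis sP : forall A, measurable A -> P (s @^-1` A) = P A.
Hypothesis mz : forall i, measurable [set w | z i w].
Hypothesis zD : forall i j w, z i w -> z (i + j) w = z j (iter i s w).
Hypothesis zB : forall i j w, z (i + j) w -> z j (iter i s w) -> z i w.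
Variables (u : nat -> R) (alpha : R).
Hypothesis u_gt0 : forall i, 0 < u i.+1.
Hypothesis alpha_gt0 : 0 < alpha.
Hypothesis alpha_lt1 : alpha < 1.
Hypothesis u_succ : u n.+1 / u n @[n --> \oo] --> (1 : R).
Hypothesis u_dilation : forall k, (0 < k)%N ->
  u (k * n)%N / u n @[n --> \oo] --> k%:R `^ (alpha - 1).
Hypothesis u_visits : forall delta, 0 < delta -> exists A N,
  [/\ measurable A, prob P (~` A) <= delta &
  forall i, (N <= i)%N -> uniform_arrivals P s z A i.+1 (u i.+1) delta].
Variable h : T -> R.
Hypotheses (mh : measurable_fun setT h) (h01 : forall w, 0 <= h w <= 1).
Hypothesis h_ret : forall w, h (return_map s z w) = h w.

Local Notation a := (partial_sums u).

(** The renewal inequality for the visits to A determines the mean of their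
    transform up to terms that vanish with 1 - x or with the probability of the
    complement of A; the visits outside A change it little. *)
Lemma cvg_visits_transform c lambda : 0 < c -> 0 < lambda ->
  wmean c (step n (laplace_visits P s z h setT (expR (- (lambda / a n))))) @[n --> \oo] -->
  (\int[P]_w h w) / (1 + lambda * (gamma_fun (1 + alpha) * c `^ (- alpha))).
Proof.
move=> c0 l0; set hb := \int[P]_w h w.
have u_div := partial_sums_diverge u_gt0 alpha_gt0 alpha_lt1 u_succ u_dilation.
set kappa := lambda * _.
have kappa0 : 0 < kappa by rewrite !mulr_gt0 ?powR_gt0// gamma_fun_gt0 ?ltW.
have [n0 n00 tm] := tame_step_partial_sums u_gt0 alpha_gt0 alpha_lt1 u_succ u_dilation.
pose x n := expR (- (lambda / a n)).
pose theta n := 1 - x n.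
pose U n := wmean c (step n a).
have a_ge0 m : 0 <= a m by apply: sumr_ge0 => i _; exact: ltW.
have x01 n : 0 <= x n <= 1.
  by rewrite expR_ge0/= -[leRHS]expR0 ler_expR oppr_le0 divr_ge0// ltW.
have theta0 n : 0 <= theta n by rewrite subr_ge0; case/andP: (x01 n).
have U0 n : 0 <= U n.
  apply: Rintegral_ge0 => t _; rewrite mulr_ge0 ?expw_ge0//; exact: a_ge0.
have thetaU : theta n * U n @[n --> \oo] --> kappa.
  have := cvg_seqM (cvg_one_minus_exp l0 u_div)
    (abel_partial_sums u_gt0 alpha_gt0 alpha_lt1 u_succ u_dilation c0).
  apply: cvg_eventually_eq; near=> n.
  have n_gt0 : (0 < n)%N by near: n; exact: nbhs_infty_gt.
  by rewrite mulrA mulrAC mulfK 1?mulrC// gt_eqF// partial_sums_gt0.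
have theta_to0 : theta n @[n --> \oo] --> 0.
  apply: (@squeeze_cvgr _ _ _ _ (fun=> 0) (fun n => lambda / a n)).
  - near=> n; rewrite theta0/=.
    have y0 : 0 <= lambda / a n by rewrite divr_ge0// ltW.
    by case/andP: (one_minus_expRN y0).
  - exact: cvg_cst.
  - rewrite -(mulr0 lambda); apply: cvg_seqM; first exact: cvg_seq_cst.
    apply: ((gtr0_cvgV0 _).2 u_div); near=> n; apply: partial_sums_gt0 => //.
    by near: n; exact: nbhs_infty_gt.
have target : hb / (1 + theta n * U n) @[n --> \oo] --> hb / (1 + kappa).
  apply: cvg_seqM; first exact: cvg_seq_cst.
  apply: cvg_seqV; first by rewrite gt_eqF//; lra.
  by apply: cvg_seqD; first exact: cvg_seq_cst.
apply/cvgrPdist_le => e e0.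
(* The set A has a complement of probability eta ^ 2, since the maximal
   inequality for the frequency eta divides by eta. *)
pose eta := Num.min (1 / 2) (e / 8).
have eta0 : 0 < eta by rewrite lt_min divr_gt0//= divr_gt0.
have eta12 : eta <= 1 / 2 by rewrite ge_min lexx.
have eta8 : eta <= e / 8 by rewrite ge_min lexx orbT.
have eta2 : 0 < eta ^+ 2 by rewrite exprn_gt0.
have sum_le : e / 8 + (e / 8 + e / 8 + e / 8 + 3 * eta) <= e by lra.
have [A [N [mA PA hA]]] := u_visits eta2.
(* The contribution of the first N terms of the renewal inequality, killed by
   the factor theta n. *)
pose C := N%:R + a N.
have C0 : 0 <= C by rewrite addr_ge0.
pose V n := wmean c (step n (laplace_visits P s z h setT (x n))).
pose W n := wmean c (step n (laplace_visits P s z h A (x n))).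
have VW n : (0 < n)%N -> `|V n - W n| <= 3 * eta.
  move=> n_gt0.
  have tA B : measurable B -> tame (step n (laplace_visits P s z h B (x n))).
    move=> mB; apply: (@tame_bounded _ _ 1); first exact: measurable_step.
    move=> t _; have /andP[? ?] := laplace_visits01 ms sP mz mh h01 (x01 n) (Num.Def.trunc (t * n%:R)) mB.
    by rewrite ger0_norm.
  have one : wmean c (fun=> 1 : R) = 1.
    rewrite /wmean /Rintegral -[RHS]/(fine 1%E); congr fine.
    have := @integral_exponential_pdf R c c0; rewrite integral_mkcond => <-.
    apply: eq_integral => t _; rewrite /exponential_pdf !patchE.
    by case: ifP => // _; rewrite /expw mul1r mulNr.
  have tcst (k : R) : tame (fun=> k) by apply: (@tame_bounded _ _ `|k|).
  have tT := tA _ measurableT; have tAA := tA _ mA.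
  have close : forall t, `|step n (laplace_visits P s z h setT (x n)) t -
      step n (laplace_visits P s z h A (x n)) t| <= 3 * eta.
    move=> t; apply: (laplace_visits_restrict ms sP mz zD zB u_gt0 u_div u_visits) => //.
  have up : V n <= W n + 3 * eta.
    have -> : W n + 3 * eta = wmean c (fun t => step n (laplace_visits P s z h A (x n)) t + (3 * eta) * 1).
      by rewrite wmeanD// ?wmeanZ ?one ?mulr1.
    apply: wmean_le => //; first exact: tameD.
    by move=> t _; have := close t; rewrite mulr1 ler_norml; lra.
  have lo : W n <= V n + 3 * eta.
    have -> : V n + 3 * eta = wmean c (fun t => step n (laplace_visits P s z h setT (x n)) t + (3 * eta) * 1).
      by rewrite wmeanD// ?wmeanZ ?one ?mulr1.
    apply: wmean_le => //; first exact: tameD.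
    by move=> t _; have := close t; rewrite mulr1 ler_norml; lra.
  by rewrite ler_norml; apply/andP; split; lra.
have WE n : (n0 <= n)%N -> `|hb - W n * (1 + theta n * U n)| <= theta n * (C + 2 * eta ^+ 2 * U n).
  move=> nn0; have n_gt0 : (0 < n)%N by exact: leq_trans nn0.
  apply: (renewal_transform u_gt0 c0 n_gt0 (tm n nn0)) => //.
    by move=> m; exact: (laplace_visits01 ms sP mz mh h01).
  move=> m; exact: (renewal_ineq ms sP mz zD u_gt0 mh h01 (x01 n) h_ret m mA (ltW eta2) PA hA).
have C1 : 0 < e / 8 / (C + 1) by rewrite !divr_gt0//; lra.
move/cvgrPdist_le : theta_to0 => /(_ _ C1) th_near.
have e80 : 0 < e / 8 by rewrite divr_gt0.
move/cvgrPdist_le : target => /(_ _ e80) target.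
near=> n.
have nn0 : (n0 <= n)%N by near: n; exact: nbhs_infty_ge.
have n_gt0 : (0 < n)%N by exact: leq_trans nn0.
have h1 := VW n n_gt0; have h2 := WE n nn0.
have h3 : `|hb / (1 + kappa) - hb / (1 + theta n * U n)| <= e / 8 by near: n.
have h4 : `|0 - theta n| <= e / 8 / (C + 1) by near: n.
rewrite sub0r normrN (ger0_norm (theta0 n)) in h4.
have D1 : 1 <= 1 + theta n * U n by rewrite lerDl mulr_ge0.
have h5 : `|hb / (1 + theta n * U n) - W n| <= e / 8 + e / 8 + e / 8.
  have D0 : 0 < 1 + theta n * U n by lra.
  have -> : hb / (1 + theta n * U n) - W n = (hb - W n * (1 + theta n * U n)) / (1 + theta n * U n).
    by field; rewrite gt_eqF.
  rewrite normrM (@ger0_norm _ (_^-1)) ?invr_ge0 ?(ltW D0)// ler_pdivrMr//.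
  apply: (le_trans h2).
  have thC : theta n * C <= e / 8.
    have C10 : 0 < C + 1 by lra.
    apply: (@le_trans _ _ (theta n * (C + 1))); first by rewrite ler_wpM2l//; lra.
    by move: h4; rewrite ler_pdivlMr.
  have eta2e : eta ^+ 2 <= e / 8.
    rewrite expr2 (le_trans _ eta8)// ler_piMr ?(ltW eta0)//; lra.
  have tU : 0 <= theta n * U n by rewrite mulr_ge0.
  have := ler_wpM2r tU eta2e; have := mulr_ge0 (ltW e0) tU; lra.
rewrite -/(V n) -[_ / _ - _](subrKA (hb / (1 + theta n * U n))).
rewrite -[hb / (1 + theta n * U n) - V n](subrKA (W n)).
apply: (le_trans (ler_normD _ _)); apply: (le_trans (lerD h3 (ler_normD _ _))).
rewrite distrC in h1; by apply: (le_trans (lerD (lexx _) (lerD h5 h1))).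
Unshelve. all: by end_near. Qed.

End visits_transform.

(** * The Mittag-Leffler law *)

Section mittag_leffler_transform.
Context d (T : measurableType d) (R : realType) (Q : probability T R).
Variables (Y : {RV Q >-> R}) (alpha : R).
Hypothesis alpha_gt0 : 0 < alpha.
Hypothesis Y_ML : mittag_leffler Y alpha.
Local Notation mu := (@lebesgue_measure R).
Local Notation D := [set` `[(0 : R), +oo[].

Definition ml_coef (p : nat) : R := gamma_fun (1 + alpha) ^+ p / gamma_fun (1 + p%:R * alpha).

Definition mgf (x : R) : R := \int[Q]_w expR (x * Y w).

(** The complex moment series on the real axis. *)
Lemma mgf_series x : \sum_(p < n) ml_coef p * x ^+ p @[n --> \oo] --> mgf x.
Proof.
have [_ /(_ x%:C%C) [_ h]] := Y_ML.
have mgfE : complex.Re (cexpectation Q (fun w => cexp (x%:C * (Y w)%:C)%C)) = mgf x.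
  rewrite /cexpectation/= unlock /mgf /Rintegral; congr fine.
  apply: eq_integral => w _ /=; congr EFin.
  by rewrite !(mulr0, mul0r, subr0, addr0) cos0 mulr1.
apply/cvgrPdist_lt => e e0.
have eC : (0 : R[i]) < e%:C%C by rewrite ltcR.
have {}h := (@cvgrPdist_lt (R[i]) (R[i]^o) _ _ _ _ _).1 h _ eC; near=> n.
have : `|cexpectation Q (fun w => cexp (x%:C * (Y w)%:C)%C) -
  \sum_(0 <= p < n) (gamma_fun (1 + alpha) ^+ p / gamma_fun (1 + p%:R * alpha))%:C%C * x%:C%C ^+ p| < e%:C%C.
  near: n; exact: h.
have -> : \sum_(0 <= p < n) (gamma_fun (1 + alpha) ^+ p / gamma_fun (1 + p%:R * alpha))%:C%C * x%:C%C ^+ p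
   = (\sum_(p < n) ml_coef p * x ^+ p)%:C%C.
  rewrite big_mkord rmorph_sum/=; apply: eq_bigr => p _.
  by rewrite [RHS]rmorphM rmorphXn.
move=> h1; rewrite -ltcR; apply: le_lt_trans h1.
rewrite -mgfE; set E := cexpectation _ _; set S := \sum_(_ < _) _.
rewrite (_ : complex.Re E - S = complex.Re (E - S%:C%C)); last by case: E.
exact: normc_ge_Re.
Unshelve. all: by end_near. Qed.

Lemma ml_coef_ge0 p : 0 <= ml_coef p.
Proof.
rewrite /ml_coef divr_ge0// ?exprn_ge0// ltW// gamma_fun_gt0//; first exact: ltW.
by rewrite mulr_ge0// ltW.
Qed.

Lemma mgf_partial_le x n : 0 <= x -> \sum_(p < n) ml_coef p * x ^+ p <= mgf x.
Proof.
move=> x0; rewrite -(cvg_lim _ (@mgf_series x))//.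
apply: (nondecreasing_cvgn_le (u_ := fun n => \sum_(p < n) ml_coef p * x ^+ p)).
  apply: homo_leq => // [|k]; first exact: le_trans.
  by rewrite big_ord_recr lerDl mulr_ge0 ?ml_coef_ge0 ?exprn_ge0.
by apply/cvg_ex; eexists; exact: mgf_series.
Qed.

Lemma mgf_ge0 x : 0 <= mgf x.
Proof. by apply: Rintegral_ge0 => w _; exact: expR_ge0. Qed.

Let poly (b : nat -> R) n (t : R) := \sum_(p < n) b p * (t `^ alpha) ^+ p.

Let measurable_poly b n (A : set R) : measurable_fun A (poly b n).
Proof.
apply: measurable_funTS; apply: measurable_sum => p.
apply: (@measurable_funM _ _ _ _ (cst (b p)) (fun t => (t `^ alpha) ^+ p)) => //.
by apply: measurable_funX; exact: measurable_powR_fun.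
Qed.

Let powR_expr p (t : R) : (t `^ alpha) ^+ p = t `^ (p%:R * alpha).
Proof. by rewrite mulrC powRrM powR_mulrn ?powR_ge0. Qed.

Let wmean_poly c b n : 0 < c ->
  mu.-integrable D (EFin \o (fun t => poly b n t * expw c t)) /\
  wmean c (poly b n) =
    \sum_(p < n) b p * (gamma_fun (1 + p%:R * alpha) * c `^ (- (p%:R * alpha))).
Proof.
move=> c0; elim: n => [|n [IHi IHw]].
  have polyE : (fun t => poly b 0 t * expw c t) = cst 0.
    by apply/funext => t; rewrite /poly big_ord0 mul0r.
  rewrite /wmean polyE Rintegral_cst// mul0r big_ord0; split => //.
  exact: integrable0.
have na0 : 0 <= n%:R * alpha by rewrite mulr_ge0// ltW.
have im : mu.-integrable D (EFin \o (fun t => b n * (t `^ (n%:R * alpha) * expw c t))).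
  by apply: (@integrableZl _ _ _ _ _ _ (b n) _ (powR_integrable c0 na0)).
have polyE t : poly b n.+1 t * expw c t = poly b n t * expw c t + b n * (t `^ (n%:R * alpha) * expw c t).
  by rewrite /poly big_ord_recr/= mulrDl powR_expr mulrA.
split.
  rewrite (_ : _ \o _ = (fun t => ((poly b n t * expw c t)%:E + (b n * (t `^ (n%:R * alpha) * expw c t))%:E)%E)).
    exact: integrableD.
  by apply/funext => t /=; rewrite polyE EFinD.
rewrite big_ord_recr/= -IHw -wmean_powR// /wmean -RintegralZl//; last exact: powR_integrable.
by rewrite -RintegralD//; apply: eq_Rintegral => t _; rewrite polyE.
Qed.

Variables (lambda c : R).
Hypotheses (lambda_gt0 : 0 < lambda) (c_gt0 : 0 < c).

Let kappa := lambda * (gamma_fun (1 + alpha) * c `^ (- alpha)).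
Hypothesis kappa_lt1 : kappa < 1.

Let kappa_ge0 : 0 <= kappa.
Proof. by rewrite !mulr_ge0 ?powR_ge0 ?(ltW lambda_gt0)// ltW// gamma_fun_gt0// ltW. Qed.

Let series_poly x t n : \sum_(p < n) ml_coef p * (x * t `^ alpha) ^+ p =
  poly (fun p => ml_coef p * x ^+ p) n t.
Proof. by apply: eq_bigr => p _; rewrite exprMn mulrA. Qed.

Let wmean_series x n : wmean c (poly (fun p => ml_coef p * x ^+ p) n) =
  \sum_(p < n) (x * (gamma_fun (1 + alpha) * c `^ (- alpha))) ^+ p.
Proof.
have [_ ->] := wmean_poly (fun p => ml_coef p * x ^+ p) n c_gt0.
apply: eq_bigr => p _; rewrite /ml_coef.
have pa0 : 0 <= p%:R * alpha by rewrite mulr_ge0// ltW.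
have g0 : gamma_fun (1 + p%:R * alpha) != 0 :> R by rewrite gt_eqF// gamma_fun_gt0.
have -> : c `^ (- (p%:R * alpha)) = (c `^ (- alpha)) ^+ p.
  by rewrite -powR_mulrn ?powR_ge0// -powRrM mulNr mulrC.
by rewrite !exprMn; field.
Qed.

Lemma measurable_mgf x (A : set R) : measurable_fun A (fun t => mgf (x * t `^ alpha)).
Proof.
apply: (measurable_fun_cvg (h := fun n => poly (fun p => ml_coef p * x ^+ p) n)).
  by move=> n; exact: measurable_poly.
move=> t _; have := @mgf_series (x * t `^ alpha).
by apply: cvg_eventually_eq; apply: nearW => n; rewrite series_poly.
Qed.

(** At lambda > 0 the series has nonnegative terms, so monotone convergence
    reduces integrability to the convergence of the geometric series of kappa. *)
Let dominant_integrable :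
  mu.-integrable D (EFin \o (fun t => mgf (lambda * t `^ alpha) * expw c t)).
Proof.
have mf : measurable_fun D (fun t => mgf (lambda * t `^ alpha) * expw c t).
  apply: (@measurable_funM _ _ _ _ (fun t => mgf (lambda * t `^ alpha)) (expw c)).
    exact: measurable_mgf.
  exact: measurable_expw.
apply/integrableP; split; first exact/measurable_EFinP.
apply: (@le_lt_trans _ _ (\int[mu]_(t in D) (mgf (lambda * t `^ alpha) * expw c t)%:E)%E).
  rewrite le_eqVlt; apply/orP; left; apply/eqP; apply: eq_integral => t _ /=.
  by rewrite ger0_norm// mulr_ge0 ?mgf_ge0 ?expw_ge0.
pose g n t := (poly (fun p => ml_coef p * lambda ^+ p) n t * expw c t)%:E.
have cf_ge0 p t : 0 <= ml_coef p * lambda ^+ p * (t `^ alpha) ^+ p.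
  by rewrite mulr_ge0 ?exprn_ge0 ?powR_ge0// mulr_ge0 ?ml_coef_ge0// exprn_ge0// ltW.
have mon := @cvg_monotone_convergence _ _ _ mu D _ g.
have {}mon : (\int[mu]_(t in D) g n t)%E @[n --> \oo] -->
    (\int[mu]_(t in D) limn (g ^~ t))%E.
  apply: mon => //.
  - move=> n; apply/measurable_EFinP.
    apply: (@measurable_funM _ _ _ _ (poly (fun p => ml_coef p * lambda ^+ p) n) (expw c)).
      exact: measurable_poly.
    exact: measurable_expw.
  - by move=> n t _; rewrite lee_fin mulr_ge0 ?expw_ge0// sumr_ge0.
  - move=> t _; apply: homo_leq => // [|k]; first exact: le_trans.
    by rewrite lee_fin ler_wpM2r ?expw_ge0// /poly big_ord_recr lerDl.
have limE : (\int[mu]_(t in D) limn (g ^~ t))%E =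
    (\int[mu]_(t in D) (mgf (lambda * t `^ alpha) * expw c t)%:E)%E.
  apply: eq_integral => t _; apply/cvg_lim => //.
  apply: cvg_EFin; first exact: nearW.
  have := cvg_seqM (@mgf_series (lambda * t `^ alpha)) (@cvg_seq_cst R (expw c t)).
  by apply: cvg_eventually_eq; apply: nearW => n; rewrite series_poly.
rewrite -limE -(cvg_lim _ mon)//.
apply: (@le_lt_trans _ _ ((1 - kappa)^-1)%:E); last exact: ltry.
apply: lime_le; first by apply/cvg_ex; eexists; exact: mon.
apply: nearW => n.
have [ip _] := wmean_poly (fun p => ml_coef p * lambda ^+ p) n c_gt0.
rewrite -[leLHS]fineK; last exact: integrable_fin_num.
rewrite lee_fin -[leLHS]/(wmean c (poly (fun p => ml_coef p * lambda ^+ p) n)) wmean_series -/kappa.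
have k1 : 0 < 1 - kappa by rewrite subr_gt0.
rewrite -(ler_pM2l k1) divff ?gt_eqF//.
have -> : (1 - kappa) * \sum_(p < n) kappa ^+ p = 1 - kappa ^+ n.
  by rewrite -opprB mulNr -subrX1 opprB.
by rewrite gerBl exprn_ge0.
Qed.

(** The p-th term of the moment series has exponential mean (- kappa)^p, because
    the Gamma factor in the denominator is the one of [wmean_powR].  The
    resulting geometric series is integrated term by term. *)
Lemma mittag_leffler_laplace : wmean c (fun t => mgf (- lambda * t `^ alpha)) = (1 + kappa)^-1.
Proof.
pose b p := ml_coef p * (- lambda) ^+ p.
have := @dominated_convergence _ _ _ mu D _ (fun n t => (poly b n t * expw c t)%:E)
  (fun t => (mgf (- lambda * t `^ alpha) * expw c t)%:E)
  (EFin \o (fun t => mgf (lambda * t `^ alpha) * expw c t)).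
case=> //.
- move=> n; apply/measurable_EFinP.
  apply: (@measurable_funM _ _ _ _ (poly b n) (expw c)); first exact: measurable_poly.
  exact: measurable_expw.
- apply/measurable_EFinP.
  apply: (@measurable_funM _ _ _ _ (fun t => mgf (- lambda * t `^ alpha)) (expw c)).
    exact: measurable_mgf.
  exact: measurable_expw.
- apply: aeW => t _; apply: cvg_EFin; first exact: nearW.
  have := cvg_seqM (@mgf_series (- lambda * t `^ alpha)) (@cvg_seq_cst R (expw c t)).
  by apply: cvg_eventually_eq; apply: nearW => n; rewrite series_poly.
- apply: aeW => t n _ /=; rewrite lee_fin normrM (ger0_norm (expw_ge0 t c_gt0)).
  rewrite ler_wpM2r ?expw_ge0//; apply: le_trans (mgf_partial_le n _); last first.
    by rewrite mulr_ge0 ?powR_ge0// ltW.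
  rewrite /poly (le_trans (ler_norm_sum _ _ _))//; apply: ler_sum => p _.
  rewrite /b normrM [`|ml_coef p * _|]normrM !normrX normrN (ger0_norm (ml_coef_ge0 p)) (ger0_norm (ltW lambda_gt0)).
  by rewrite (ger0_norm (powR_ge0 _ _)) exprMn mulrA.
move=> ig _ cv.
have cv1 : wmean c (poly b n) @[n --> \oo] --> wmean c (fun t => mgf (- lambda * t `^ alpha)).
  apply: (@fine_cvg _ _ _ _ (fun n => (\int[mu]_(t in D) (poly b n t * expw c t)%:E)%E)).
  by rewrite /wmean /Rintegral fineK//; exact: integrable_fin_num.
have cv2 : wmean c (poly b n) @[n --> \oo] --> (1 + kappa)^-1.
  have kn : `|- kappa| < 1 by rewrite normrN ger0_norm.
  have := @cvg_geometric_series R 1 (- kappa) kn; rewrite opprK div1r.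
  apply: cvg_eventually_eq; apply: nearW => n.
  rewrite wmean_series mulNr -/kappa /series/= big_mkord.
  by apply: eq_bigr => p _; rewrite /geometric/= mul1r.
exact: (cvg_unique (@Rhausdorff R) cv1 cv2).
Qed.

End mittag_leffler_transform.

(** * A Tauberian theorem *)

Section tauberian.
Context {R : realType}.
Local Notation mu := (@lebesgue_measure R).
Local Notation D := [set` `[(0 : R), +oo[].
Implicit Types (c : R) (f w : R -> R).

Lemma tame_half_line_bounded f w (M : R) : half_line_bounded f -> measurable_fun D w ->
  (forall t, 0 <= t -> `|w t| <= M) -> tame (fun t => f t * w t).
Proof.
move=> [cf [N fN]] mw wM; apply: (@tame_bounded _ _ (N * M)).
  apply: (@measurable_funM _ _ _ _ f w) => //.
  by apply: measurable_funTS; exact: continuous_measurable_fun.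
by move=> t t0; rewrite normrM ler_pM ?fN ?wM.
Qed.

Lemma weighted_functional c w (M : R) : 0 < c -> measurable_fun D w ->
  (forall t, 0 <= t -> 0 <= w t <= M) ->
  positive_functional (fun f => wmean c (fun t => f t * w t)).
Proof.
move=> c0 mw wM.
have wM' t : 0 <= t -> `|w t| <= M by move=> /wM /andP[? ?]; rewrite ger0_norm.
have tm f bf := tame_half_line_bounded bf mw wM' : tame (fun t => f t * w t).
split=> [f g bf bg|k f bf|f g bf bg fg].
- rewrite -wmeanD//; try exact: tm.
  by congr wmean; apply/funext => t; rewrite mulrDl.
- rewrite -wmeanZ//; last exact: tm.
  by congr wmean; apply/funext => t; rewrite mulrA.
- apply: wmean_le => //; try exact: tm.
  by move=> t t0; rewrite ler_wpM2r ?fg//; case/andP: (wM t t0).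
Qed.

(** Multiplication by exp (- k t) changes the rate from c to c + k; convergence
    of the means at all rates is thus convergence of Laplace transforms. *)
Lemma wmean_exp_decay c w k : 0 < c -> tame w ->
  wmean c (fun t => exp_decay k t * w t) = c / (c + k%:R) * wmean (c + k%:R) w.
Proof.
move=> c0 tw; have ck : 0 < c + k%:R by rewrite ltr_wpDr.
have E t : exp_decay k t * w t * expw c t = c / (c + k%:R) * (w t * expw (c + k%:R) t).
  rewrite /exp_decay /expw -expRM_natl [(c + _) * t]mulrDl opprD expRD mulrN.
  by field; rewrite gt_eqF.
rewrite /wmean; under eq_Rintegral do rewrite E.
by rewrite RintegralZl//; exact: tame_integrable.
Qed.

Lemma wmean_gt0 c f (k p q : R) : 0 < c -> tame f -> (forall t, 0 <= t -> 0 <= f t) ->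
  0 < k -> 0 <= p -> p < q -> (forall t, p <= t < q -> k <= f t) -> 0 < wmean c f.
Proof.
move=> c0 tf f0 k0 p0 pq fk; have itf := tame_integrable c0 tf.
rewrite -lte_fin /wmean /Rintegral fineK; last exact: integrable_fin_num.
apply: (@lt_le_trans _ _ (\int[mu]_(t in `[p, q[) (k * expw c t)%:E)%E).
  under eq_integral do rewrite EFinM.
  rewrite ge0_integralZl//; last 3 first.
  - by apply/measurable_EFinP; exact: measurable_expw.
  - by move=> t _; rewrite lee_fin expw_ge0.
  - by rewrite lee_fin ltW.
  rewrite integral_expw_itv// -EFinM lte_fin mulr_gt0// subr_gt0 ltr_expR.
  by rewrite ltrN2 ltr_pM2l.
apply: (@le_trans _ _ (\int[mu]_(t in `[p, q[) (f t * expw c t)%:E)%E).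
  apply: ge0_le_integral => //.
  - by move=> t _; rewrite lee_fin mulr_ge0 ?expw_ge0// ltW.
  - apply/measurable_EFinP; apply: (@measurable_funM _ _ _ _ (cst k) (expw c)) => //.
    exact: measurable_expw.
  - apply: measurable_funS (measurable_int _ itf) => // t /=.
    by rewrite !in_itv/= andbT => /andP[pt _]; exact: le_trans pt.
  by move=> t /=; rewrite in_itv/= => tpq; rewrite lee_fin ler_wpM2r ?expw_ge0// fk.
apply: ge0_subset_integral => //.
- exact: (measurable_int _ itf).
- by move=> t /=; rewrite in_itv/= andbT => t0; rewrite lee_fin mulr_ge0 ?expw_ge0 ?f0.
- by move=> t /=; rewrite !in_itv/= andbT => /andP[pt _]; exact: le_trans pt.
Qed.

(** A continuous bump around m, of width r on each side, used to localise means
    near a point. *)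
Definition tent (m r t : R) : R := Num.max 0 (r - `|t - m|).

Lemma half_line_bounded_tent m r : half_line_bounded (tent m r).
Proof.
split.
  have -> : tent m r = (fun=> 0) \max (fun t => r - `|t - m|) by [].
  move=> t; apply: continuous_max; first exact: cvg_cst.
  apply: cvgB; first exact: cvg_cst.
  by apply: cvg_norm; apply: cvgB; [exact: cvg_id|exact: cvg_cst].
exists `|r| => t _; rewrite ger0_norm /tent ?le_max ?lexx// ge_max normr_ge0/=.
by rewrite (le_trans _ (ler_norm _))// lerBlDr lerDl.
Qed.

Lemma tent_support m r t : tent m r t != 0 -> m - r < t < m + r.
Proof.
rewrite /tent; case: (ltP 0 (r - `|t - m|)) => [h _|h]; last first. by move/eqP.
by move: h; rewrite subr_gt0 ltr_norml => /andP[? ?]; apply/andP; split; lra.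
Qed.

Lemma tent_ge0 m r t : 0 <= tent m r t.
Proof. by rewrite /tent le_max lexx. Qed.

Lemma wmean_tent_gt0 c m r : 0 < c -> 0 < r -> r <= m -> 0 < wmean c (tent m r).
Proof.
move=> c0 r0 rm; have [ct [M hM]] := half_line_bounded_tent m r.
apply: (@wmean_gt0 _ _ (r / 2) (m - r / 2) (m + r / 2)) => //; try lra.
- apply: (@tame_bounded _ _ M) => //.
  by apply: measurable_funTS; exact: continuous_measurable_fun.
- by move=> t _; exact: tent_ge0.
move=> t /andP[t1 t2]; rewrite /tent le_max; apply/orP; right.
have : `|t - m| <= r / 2 by rewrite ler_norml; apply/andP; split; lra.
lra.
Qed.

Variables (v : nat -> nat -> R) (F : R -> R) (c0 : R).
Hypothesis c0_gt0 : 0 < c0.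
Hypothesis v01 : forall n m, 0 <= v n m <= 1.
Hypothesis v_nonincreasing : forall n m k, (m <= k)%N -> v n k <= v n m.
Hypothesis mF : measurable_fun D F.
Hypothesis F01 : forall t, 0 <= t -> 0 <= F t <= 1.
Hypothesis F_nonincreasing : forall t t', 0 <= t -> t <= t' -> F t' <= F t.
Hypothesis F_continuous1 : forall e, 0 < e -> exists r, [/\ 0 < r, r <= 1 / 2,
  F (1 - 2 * r) <= F 1 + e & F 1 - e <= F (1 + 2 * r)].
Hypothesis cvg_laplace : forall c, c0 <= c ->
  wmean c (step n (v n)) @[n --> \oo] --> wmean c F.

Let w n := step n.+1 (v n.+1).

Let mw n : measurable_fun D (w n).
Proof. exact: measurable_step. Qed.

Let w01 n t : 0 <= t -> 0 <= w n t <= 1.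
Proof. by move=> _; exact: v01. Qed.

Let tame01 (g : R -> R) : measurable_fun D g -> (forall t, 0 <= t -> 0 <= g t <= 1) -> tame g.
Proof.
move=> mg g01; apply: (@tame_bounded _ _ 1) => // t /g01 /andP[? ?].
by rewrite ger0_norm.
Qed.

(** The step functions of v, seen as densities with respect to the exponential
    law, converge weakly to F. *)
Lemma cvg_functional f : half_line_bounded f ->
  wmean c0 (fun t => f t * w n t) @[n --> \oo] --> wmean c0 (fun t => f t * F t).
Proof.
apply: (@laplace_continuity _ (fun n f => wmean c0 (fun t => f t * w n t))
  (fun f => wmean c0 (fun t => f t * F t))).
- by move=> n; apply: weighted_functional => //; exact: w01.
- exact: (weighted_functional c0_gt0 mF F01).
- rewrite (_ : 0 = wmean c0 (fun=> 0)); last first.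
    by rewrite /wmean; under eq_Rintegral do rewrite mul0r; rewrite Rintegral_cst// mul0r.
  have mr K : measurable_fun D (fun t => ramp K t * F t).
    apply: (@measurable_funM _ _ _ _ (ramp K) F) => //.
    by apply: measurable_funTS; apply: continuous_measurable_fun; exact: continuous_ramp.
  apply: (@wmean_cvg _ _ 1) => //.
    apply: nearW => K t t0; have /andP[r0 r1] := ramp01 K t; have /andP[f0 f1] := F01 t0.
    rewrite mul1r ger0_norm ?mulr_ge0// (le_trans (mulr_ile1 _ _ _ _))//.
    by rewrite exprn_ege1// lerDl.
  move=> t t0; apply: cvg_near_cst; near=> K.
  have tK : t <= K%:R by near: K; exact: nbhs_infty_ger.
  rewrite /ramp max_l ?mul0r// ge_min; apply/orP; right; lra.
- move=> k; have ck : c0 <= c0 + k%:R by rewrite lerDl.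
  have tF : tame F by exact: tame01.
  have tw n : tame (w n) by apply: tame01 => //; exact: w01.
  rewrite wmean_exp_decay//.
  under eq_fun => n do rewrite (wmean_exp_decay k c0_gt0 (tw n)).
  apply: cvg_seqM; first exact: cvg_seq_cst.
  by have := cvg_laplace ck; rewrite -(cvg_shiftS (fun n => wmean _ (step n (v n)))).
Unshelve. all: by end_near. Qed.

(** Monotonicity compares v n n with the values of v n localised by a tent just
    before and just after the time n; these converge by weak convergence, and F
    is continuous at 1. *)
Lemma tauberian : v n n @[n --> \oo] --> F 1.
Proof.
rewrite -(cvg_shiftS (fun n => v n n)).
apply/cvgrPdist_le => e e0; have e20 : 0 < e / 2 by rewrite divr_gt0.
have [r [r0 r12 Fl Fr]] := F_continuous1 e20.
have key m : r <= m -> \forall n \near \oo,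
    `|wmean c0 (fun t => tent m r t * F t) - wmean c0 (fun t => tent m r t * w n t)|
    <= e / 2 * wmean c0 (tent m r).
  move=> rm; have M0 := wmean_tent_gt0 c0_gt0 r0 rm.
  by move/cvgrPdist_le : (cvg_functional (half_line_bounded_tent m r)); apply; rewrite mulr_gt0.
have tt m : tame (tent m r).
  have [ct [M hM]] := half_line_bounded_tent m r; apply: (@tame_bounded _ _ M) => //.
  by apply: measurable_funTS; exact: continuous_measurable_fun.
have ttg (g : R -> R) m : measurable_fun D g -> (forall t, 0 <= t -> 0 <= g t <= 1) ->
    tame (fun t => tent m r t * g t).
  move=> mg g01; apply: (@tame_half_line_bounded _ _ 1) => //; first exact: half_line_bounded_tent.
  by move=> t /g01 /andP[? ?]; rewrite ger0_norm.
have compare m (g : R -> R) (k : R) : measurable_fun D g -> (forall t, 0 <= t -> 0 <= g t <= 1) ->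
    (forall t, 0 <= t -> m - r < t < m + r -> k <= g t) ->
    k * wmean c0 (tent m r) <= wmean c0 (fun t => tent m r t * g t).
  move=> mg g01 kg; rewrite -wmeanZ//; apply: wmean_le => //; [exact: tameZ|exact: ttg|].
  move=> t t0; rewrite mulrC; have [->|/tent_support tm] := eqVneq (tent m r t) 0.
    by rewrite !mul0r.
  by rewrite ler_wpM2l ?tent_ge0// kg.
have compare' m (g : R -> R) (k : R) : measurable_fun D g -> (forall t, 0 <= t -> 0 <= g t <= 1) ->
    (forall t, 0 <= t -> m - r < t < m + r -> g t <= k) ->
    wmean c0 (fun t => tent m r t * g t) <= k * wmean c0 (tent m r).
  move=> mg g01 kg; rewrite -wmeanZ//; apply: wmean_le => //; [exact: ttg|exact: tameZ|].
  move=> t t0; rewrite [leRHS]mulrC; have [->|/tent_support tm] := eqVneq (tent m r t) 0.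
    by rewrite !mul0r.
  by rewrite ler_wpM2l ?tent_ge0// kg.
have r1 : r <= 1 - r by lra.
have r2 : r <= 1 + r by lra.
(* The tents around 1 - r and 1 + r live on [1 - 2 r, 1] and [1, 1 + 2 r]. *)
have key1 := key _ r1; have key2 := key _ r2.
have M1 := wmean_tent_gt0 c0_gt0 r0 r1; have M2 := wmean_tent_gt0 c0_gt0 r0 r2.
near=> n.
have h1 : `|wmean c0 (fun t => tent (1 - r) r t * F t) -
   wmean c0 (fun t => tent (1 - r) r t * w n t)| <= e / 2 * wmean c0 (tent (1 - r) r) by near: n.
have h2 : `|wmean c0 (fun t => tent (1 + r) r t * F t) -
   wmean c0 (fun t => tent (1 + r) r t * w n t)| <= e / 2 * wmean c0 (tent (1 + r) r) by near: n.
have a1 : v n.+1 n.+1 * wmean c0 (tent (1 - r) r) <= wmean c0 (fun t => tent (1 - r) r t * w n t).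
  apply: compare => //; first exact: w01.
  move=> t t0 /andP[_ t1]; apply: v_nonincreasing.
  rewrite -(@ler_nat R) (@le_trans _ _ (t * n.+1%:R))//; first by rewrite truncn_le mulr_ge0.
  by rewrite ler_piMl//; lra.
have a2 : wmean c0 (fun t => tent (1 - r) r t * F t) <= F (1 - 2 * r) * wmean c0 (tent (1 - r) r).
  apply: compare' => // t t0 /andP[t1 _]; apply: F_nonincreasing; lra.
have b1 : wmean c0 (fun t => tent (1 + r) r t * w n t) <= v n.+1 n.+1 * wmean c0 (tent (1 + r) r).
  apply: compare' => //; first exact: w01.
  move=> t t0 /andP[t1 _]; apply: v_nonincreasing.
  by rewrite truncn_ge_nat ?mulr_ge0// ler_peMl//; lra.
have b2 : F (1 + 2 * r) * wmean c0 (tent (1 + r) r) <= wmean c0 (fun t => tent (1 + r) r t * F t).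
  apply: compare => // t t0 /andP[_ t1]; apply: F_nonincreasing; lra.
have up : v n.+1 n.+1 <= F (1 - 2 * r) + e / 2.
  by rewrite -(ler_pM2r M1); move: h1; rewrite ler_norml; lra.
have lo : F (1 + 2 * r) - e / 2 <= v n.+1 n.+1.
  by rewrite -(ler_pM2r M2); move: h2; rewrite ler_norml; lra.
rewrite ler_norml; apply/andP; split => /=; move: Fl Fr lo up; lra.
Unshelve. all: by end_near. Qed.

End tauberian.

(** * Identification of the limit *)

Section mittag_leffler_mgf.
Context d (T : measurableType d) (R : realType) (Q : probability T R).
Variables (Y : {RV Q >-> R}) (alpha : R).
Hypothesis alpha_gt0 : 0 < alpha.
Hypothesis Y_ML : mittag_leffler Y alpha.

(** Almost surely equal to Y, and nonnegative everywhere, so that functions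
    bounded on the half-line can be composed with it. *)
Definition positive_part_of (w : T) : R := Num.max 0 (Y w).
Local Notation Y' := positive_part_of.

Lemma measurable_positive_part_of : measurable_fun setT Y'.
Proof. by apply: measurable_maxr => //; exact: measurable_cst. Qed.

Lemma positive_part_of_ge0 w : 0 <= Y' w.
Proof. by rewrite le_max lexx. Qed.

Lemma mean_positive_part (g : R -> R) : continuous g ->
  (\int[Q]_w (g (Y w))%:E)%E = (\int[Q]_w (g (Y' w))%:E)%E.
Proof.
move=> cg; have mg := continuous_measurable_fun cg.
apply: ae_eq_integral => //.
- by apply/measurable_EFinP; exact: measurableT_comp.
- by apply/measurable_EFinP; apply: measurableT_comp => //; exact: measurable_positive_part_of.
- have [Y0 _] := Y_ML; apply: filterS Y0 => w Y0 _.
  by rewrite /positive_part_of max_r.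
Qed.

Let continuous_exp x : continuous (fun y : R => expR (- (x * y))).
Proof.
move=> y; apply: (@continuous_comp _ _ _ (fun y => - (x * y)) expR); last exact: continuous_expR.
by apply: cvgN; apply: cvgM; [exact: cvg_cst|exact: cvg_id].
Qed.

Let expY x w : 0 <= x -> 0 <= expR (- (x * Y' w)) <= 1.
Proof.
by move=> x0; rewrite expR_ge0/= -[leRHS]expR0 ler_expR oppr_le0 mulr_ge0 ?positive_part_of_ge0.
Qed.

Let bm_expY x : 0 <= x -> bounded_measurable (fun w => expR (- (x * Y' w))).
Proof.
move=> x0; split; last by exists 1 => w; have /andP[? ?] := expY w x0; rewrite ger0_norm.
apply: (@measurableT_comp _ _ _ _ _ _ (fun y : R => expR (- (x * y)))).
  by apply: continuous_measurable_fun; exact: continuous_exp.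
exact: measurable_positive_part_of.
Qed.

Lemma mgfN x : mgf Y (- x) = \int[Q]_w expR (- (x * Y' w)).
Proof.
rewrite /mgf /Rintegral; congr fine.
rewrite -(mean_positive_part (@continuous_exp x)).
by apply: eq_integral => w _; rewrite mulNr.
Qed.

Lemma mgfN01 x : 0 <= x -> 0 <= mgf Y (- x) <= 1.
Proof.
move=> x0; rewrite mgf_ge0/= mgfN -[leRHS](mean_cst Q); apply: mean_le.
- exact: bm_expY.
- exact: bounded_measurable_cst.
- by move=> w; case/andP: (expY w x0).
Qed.

Lemma mgfN_nonincreasing x y : 0 <= x -> x <= y -> mgf Y (- y) <= mgf Y (- x).
Proof.
move=> x0 xy; rewrite !mgfN; apply: mean_le; [apply: bm_expY; lra|exact: bm_expY|].
by move=> w; rewrite ler_expR lerN2 ler_wpM2r ?positive_part_of_ge0.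
Qed.

Lemma cvg_mgfN (x : nat -> R) (y : R) : (forall n, 0 <= x n) -> 0 <= y ->
  x n @[n --> \oo] --> y -> mgf Y (- x n) @[n --> \oo] --> mgf Y (- y).
Proof.
move=> x0 y0 xy; rewrite mgfN; under eq_fun do rewrite mgfN.
apply: (mean_cvg (M := 1)).
- by move=> n; have [] := bm_expY (x0 n).
- by have [] := bm_expY y0.
- by move=> n w; have /andP[? ?] := expY w (x0 n); rewrite ger0_norm.
apply: aeW => w; apply: continuous_cvg; first exact: continuous_expR.
by apply: cvgN; apply: cvg_seqM => //; exact: cvg_seq_cst.
Qed.

Let cvg_powR1 (x : nat -> R) : (x n @[n --> \oo] --> (1 : R)) ->
  x n `^ alpha @[n --> \oo] --> (1 : R).
Proof.
move=> x1; have x_gt0 : \forall n \near \oo, 0 < x n.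
  by apply: (cvgr_gt 1) => //; exact: ltr01.
have : expR (alpha * ln (x n)) @[n --> \oo] --> expR (alpha * ln 1).
  apply: continuous_cvg; first exact: continuous_expR.
  apply: cvg_seqM; first exact: cvg_seq_cst.
  by apply: continuous_cvg => //; exact: continuous_ln.
rewrite ln1 mulr0 expR0; apply: cvg_eventually_eq.
by apply: filterS x_gt0 => n x0; rewrite /powR gt_eqF.
Qed.

(** The rate is bounded below by c0 in order that kappa < 1, which makes the
    moment series summable under the exponential mean. *)
Lemma tauberian_mittag_leffler (v : nat -> nat -> R) (hb lambda : R) :
  0 <= hb <= 1 -> 0 < lambda ->
  (forall n m, 0 <= v n m <= 1) ->
  (forall n m k, (m <= k)%N -> v n k <= v n m) ->
  (forall c, 0 < c -> wmean c (step n (v n)) @[n --> \oo] -->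
    hb / (1 + lambda * (gamma_fun (1 + alpha) * c `^ (- alpha)))) ->
  v n n @[n --> \oo] --> hb * mgf Y (- lambda).
Proof.
move=> /andP[hb0 hb1] l0 v01 vn cv.
have [F FE] : exists F : R -> R, forall t, F t = hb * mgf Y (- (lambda * t `^ alpha)).
  by eexists.
pose G := gamma_fun (1 + alpha) : R.
have G0 : 0 < G by rewrite gamma_fun_gt0 ?ltW.
have lG : 0 < lambda * G by rewrite mulr_gt0.
(* Solves lambda G c ^ (- alpha) = 1 / 2. *)
pose c0 := (2 * (lambda * G)) `^ alpha^-1.
have c00 : 0 < c0 by rewrite powR_gt0 ?mulr_gt0.
have kappa c : c0 <= c -> lambda * (G * c `^ (- alpha)) < 1.
  move=> cc; have cc2 : 2 * (lambda * G) <= c `^ alpha.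
    have -> : 2 * (lambda * G) = c0 `^ alpha.
      by rewrite /c0 -powRrM mulVf ?gt_eqF// powRr1// mulr_ge0 ?ltW.
    by rewrite ge0_ler_powR// ?nnegrE ?ltW// (lt_le_trans c00).
  have ca : 0 < c `^ alpha by rewrite powR_gt0// (lt_le_trans c00).
  by rewrite powRN mulrA ltr_pdivrMr// mul1r; lra.
have t0 t : 0 <= lambda * t `^ alpha by rewrite mulr_ge0 ?powR_ge0// ltW.
have -> : hb * mgf Y (- lambda) = F 1 by rewrite FE powR1 mulr1.
have mE A : measurable_fun A (fun t => mgf Y (- (lambda * t `^ alpha))).
  rewrite (_ : (fun t => _) = (fun t => mgf Y (- lambda * t `^ alpha))).
    exact: (measurable_mgf Y_ML).
  by apply/funext => t; rewrite mulNr.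
apply: (@tauberian _ v F c0 c00 v01 vn).
- rewrite (funext FE).
  exact: (@measurable_funM _ _ _ _ (cst hb) (fun t => mgf Y (- (lambda * t `^ alpha)))).
- move=> t _; have /andP[? ?] := mgfN01 (t0 t).
  by rewrite FE mulr_ge0//= mulr_ile1.
- move=> t t' t_ge0 tt'; rewrite !FE; apply: (ler_wpM2l hb0).
  apply: mgfN_nonincreasing; first exact: t0.
  apply: ler_wpM2l; first exact: ltW.
  by apply: ge0_ler_powR; rewrite ?nnegrE ?(ltW alpha_gt0)// (le_trans t_ge0).
- have cvF (x : nat -> R) : x n @[n --> \oo] --> (1 : R) -> F (x n) @[n --> \oo] --> F 1.
    move=> x1; rewrite FE; under eq_fun do rewrite FE.
    apply: cvg_seqM; first exact: cvg_seq_cst.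
    apply: cvg_mgfN => //; rewrite powR1; apply: cvg_seqM; first exact: cvg_seq_cst.
    exact: cvg_powR1.
  have h0 : (@harmonic R) n @[n --> \oo] --> (0 : R) by exact: cvg_harmonic.
  move=> e e0.
  have := cvg_seqB (@cvg_seq_cst R 1) h0; rewrite subr0 => /cvF/cvgrPdist_le/(_ _ e0) hl.
  have := cvg_seqD (@cvg_seq_cst R 1) h0; rewrite addr0 => /cvF/cvgrPdist_le/(_ _ e0) hr.
  have [n [hn1 hn2]] : exists n, `|F 1 - F (1 - harmonic n)| <= e /\ `|F 1 - F (1 + harmonic n)| <= e.
    have : \forall n \near \oo, `|F 1 - F (1 - harmonic n)| <= e /\ `|F 1 - F (1 + harmonic n)| <= e.
      by near=> n; split; [near: n; exact: hl|near: n; exact: hr].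
    by move=> /filter_ex[n hn]; exists n; exact: hn.
  exists (harmonic n / 2); have hn0 : 0 < harmonic n :> R by rewrite invr_gt0.
  have hle1 : harmonic n <= 1 :> R by rewrite invf_le1// ler1n.
  rewrite mulrCA divff// mulr1; move: hn1 hn2; rewrite !ler_norml; split; lra.
- move=> c cc; have c_gt0 : 0 < c by exact: lt_le_trans cc.
  have -> : wmean c F = hb / (1 + lambda * (G * c `^ (- alpha))).
    rewrite (funext FE) wmeanZ//; last first.
      apply: (@tame_bounded _ _ 1) => // t _.
      by have /andP[? ?] := mgfN01 (t0 t); rewrite ger0_norm.
    rewrite -[(_ + _)^-1](mittag_leffler_laplace alpha_gt0 Y_ML l0 c_gt0 (kappa _ cc)).
    by congr (_ * wmean _ _); apply/funext => t; rewrite mulNr.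
  exact: cv.
Unshelve. all: by end_near. Qed.

End mittag_leffler_mgf.

(** * Independence of the initial density *)

Lemma exprn_dist (R : realType) (x : R) (p q C : nat) : 0 <= x <= 1 ->
  (p <= q + C)%N -> (q <= p + C)%N -> `|x ^+ p - x ^+ q| <= C%:R * (1 - x).
Proof.
move=> x01; have /andP[x0 x1] := x01.
wlog pq : p q / (p <= q)%N.
  move=> wl h1 h2; have [pq|/ltnW qp] := leqP p q; first exact: wl.
  by rewrite distrC; apply: wl.
move=> _ qC; rewrite -(subnKC pq) exprD -[X in X - _]mulr1 -mulrBr normrM ger0_norm ?exprn_ge0//.
have xk : 0 <= 1 - x ^+ (q - p) by rewrite subr_ge0 exprn_ile1.
rewrite (ger0_norm xk) (le_trans (_ : _ <= 1 - x ^+ (q - p)))//.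
  by rewrite ler_piMl// exprn_ile1.
apply: (le_trans (bernoulli_ineq _ x01)); rewrite ler_wpM2r ?subr_ge0//.
by rewrite ler_nat leq_subLR.
Qed.

Section density_independence.
Context d (T : measurableType d) (R : realType) (P : probability T R).
Variables (s : T -> T) (z : nat -> T -> bool).
Hypothesis ms : measurable_fun setT s.
Hypothesis sP : forall A, measurable A -> P (s @^-1` A) = P A.
Hypothesis mz : forall i, measurable [set w | z i w].
Hypothesis zD : forall i j w, z i w -> z (i + j) w = z j (iter i s w).
Hypothesis zB : forall i j w, z (i + j) w -> z j (iter i s w) -> z i w.
Hypothesis nr0 : prob P (never_returns z) = 0.
Variables (x : nat -> R) (m : R).
Hypothesis x01 : forall n, 0 <= x n <= 1.
Hypothesis x_to1 : x n @[n --> \oo] --> (1 : R).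
Local Notation ret := (return_map s z).
Local Notation G n := (fun w => x n ^+ visits s z setT n w).
Hypothesis invariant_case : forall h : T -> R, measurable_fun setT h ->
  (forall w, 0 <= h w <= 1) -> (forall w, h (ret w) = h w) ->
  \int[P]_w (h w * G n w) @[n --> \oo] --> (\int[P]_w h w) * m.

Let mret : measurable_fun setT ret := measurable_return_map ms sP mz.
Let retP A : measurable A -> P (ret @^-1` A) = P A.
Proof. exact: return_map_preserving. Qed.

Let bG n : bounded_measurable (G n).
Proof. exact: (bounded_measurable_exp_visits ms sP mz (x01 n)). Qed.

Let G01 n w : 0 <= G n w <= 1.
Proof. by have /andP[x0 x1] := x01 n; rewrite exprn_ge0//= exprn_ile1. Qed.

Let G_iter j w : G n w - G n (iter j ret w) @[n --> \oo] --> (0 : R).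
Proof.
elim: j => [|j IH].
  by apply: cvg_near_cst; apply: nearW => n; rewrite /= subrr.
have step v : G n v - G n (ret v) @[n --> \oo] --> (0 : R).
  have [C hC] := visits_of_return_map zD v.
  have lim0 : C%:R * (1 - x n) @[n --> \oo] --> (0 : R).
    rewrite -(mulr0 C%:R); apply: cvg_seqM; first exact: cvg_seq_cst.
    by rewrite -(subrr (1 : R)); apply: cvg_seqB => //; exact: cvg_seq_cst.
  apply/cvgrPdist_le => e e0; move/cvgrPdist_le : lim0 => /(_ _ e0) lim0; near=> n.
  have h : `|0 - C%:R * (1 - x n)| <= e by near: n.
  have [h1 h2] := hC n; have := exprn_dist (x01 n) h2 h1.
  rewrite sub0r normrN => /le_trans; apply.
  by apply: le_trans h; rewrite sub0r normrN ler_norm.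
have := cvg_seqD IH (step (iter j ret w)); rewrite addr0.
apply: cvg_eventually_eq; apply: nearW => n; rewrite iterS; ring.
Unshelve. all: by end_near. Qed.

(** P is invariant under the return map, so moving H along the orbit is the same
    as moving G n, and G n changes along the orbit by at most a constant times
    1 - x n. *)
Lemma cvg_mean_iter (H : T -> R) j : bounded_measurable H ->
  \int[P]_w (H (iter j ret w) * G n w) - \int[P]_w (H w * G n w) @[n --> \oo] --> (0 : R).
Proof.
move=> bH; have [mit itP] := iter_preserving (P := P) mret retP j.
have bHj := bounded_measurable_comp mit bH.
have bGj n := bounded_measurable_comp mit (bG n).
have [_ [M HM]] := bH.
have : \int[P]_w (H (iter j ret w) * (G n w - G n (iter j ret w))) @[n --> \oo] -->
    \int[P]_w (0 : R).
  apply: (mean_cvg (M := M)) => //.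
  - by move=> n; have [] := bounded_measurableM bHj (bounded_measurableB (bG n) (bGj n)).
  - move=> n w; rewrite normrM -[leRHS]mulr1 ler_pM// ler_norml.
    by have := G01 n w; have := G01 n (iter j ret w); lra.
  apply: aeW => w; rewrite -[X in _ --> X](mulr0 (H (iter j ret w))).
  by apply: cvg_seqM; [exact: cvg_seq_cst|exact: G_iter].
rewrite mean_cst; apply: cvg_eventually_eq; apply: nearW => n.
rewrite -(mean_preserving mit itP (bounded_measurableM bH (bG n))) -meanB.
- by apply: eq_Rintegral => w _; ring.
- exact: bounded_measurableM.
- exact: (bounded_measurable_comp mit (bounded_measurableM bH (bG n))).
Qed.

(** H may be replaced by its averages along the orbit, and these are close in
    mean to an invariant function, to which [invariant_case] applies. *)
Lemma cvg_mean_unit (H : T -> R) : measurable_fun setT H -> (forall w, 0 <= H w <= 1) ->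
  \int[P]_w (H w * G n w) @[n --> \oo] --> (\int[P]_w H w) * m.
Proof.
move=> mH H01.
have bH : bounded_measurable H.
  by split=> //; exists 1 => w; have /andP[? ?] := H01 w; rewrite ger0_norm.
have [fs [mfs fs01 fsr fsae]] := birkhoff mret retP mH H01.
have bfs : bounded_measurable fs.
  by split=> //; exists 1 => w; have /andP[? ?] := fs01 w; rewrite ger0_norm.
pose Am k := orbit_mean ret H k.
have bA k : bounded_measurable (Am k) by exact: (bounded_measurable_orbit_mean mret retP mH H01).
have AE k n : \int[P]_w (Am k w * G n w) =
    k.+1%:R^-1 * \sum_(i < k.+1) \int[P]_w (H (iter i ret w) * G n w).
  have bi i : bounded_measurable (fun w => H (iter i ret w) * G n w).
    apply: bounded_measurableM => //; apply: (bounded_measurable_comp _ bH).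
    by have [] := iter_preserving (P := P) mret retP i.
  rewrite -mean_sum// -meanZ; last exact: bounded_measurable_sum.
  by apply: eq_Rintegral => w _; rewrite /Am /orbit_mean /orbit_sum -mulrA mulr_suml.
have intA k : \int[P]_w Am k w = \int[P]_w H w.
  rewrite /Am /orbit_mean meanZ; last first.
    apply: bounded_measurable_sum => i; apply: (bounded_measurable_comp _ bH).
    by have [] := iter_preserving (P := P) mret retP i.
  rewrite mean_sum; last first.
    move=> i; apply: (bounded_measurable_comp _ bH).
    by have [] := iter_preserving (P := P) mret retP i.
  rewrite (eq_bigr (fun=> \int[P]_w H w)).
    by rewrite sumr_const card_ord -[X in _ * X]mulr_natl mulrA mulVf ?mul1r.
  move=> i _; have [mit itP] := iter_preserving (P := P) mret retP i.
  exact: mean_preserving.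
have intfs : \int[P]_w fs w = \int[P]_w H w.
  have h1 : \int[P]_w Am k w @[k --> \oo] --> \int[P]_w fs w.
    apply: (mean_cvg (M := 1)) => //; first by move=> k; have [] := bA k.
    by move=> k w; exact: (norm_orbit_mean ret H01).
  have h2 : \int[P]_w Am k w @[k --> \oo] --> \int[P]_w H w.
    by apply: cvg_near_cst; exact: nearW.
  exact: (cvg_unique (@Rhausdorff R) h1 h2).
have L1 : \int[P]_w `|Am k w - fs w| @[k --> \oo] --> (0 : R).
  have : \int[P]_w `|Am k w - fs w| @[k --> \oo] --> \int[P]_w (0 : R).
    apply: (mean_cvg (M := 2)) => //.
    - by move=> k; have [] := bounded_measurable_norm (bounded_measurableB (bA k) bfs).
    - move=> k w; rewrite normr_id (le_trans (ler_normB _ _))//.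
      have := norm_orbit_mean ret H01 k w; have /andP[? ?] := fs01 w.
      rewrite (@ger0_norm _ (fs w))// -/(Am k w); lra.
    apply: filterS fsae => w hw; rewrite -[X in _ --> X](@normr0 _ R) -(subrr (fs w)).
    by apply: cvg_seq_norm; apply: cvg_seqB => //; exact: cvg_seq_cst.
  by rewrite mean_cst.
have hfs := invariant_case mfs fs01 fsr; rewrite intfs in hfs.
apply/cvgrPdist_le => e e0; have e30 : 0 < e / 3 by rewrite divr_gt0.
move/cvgrPdist_le : L1 => /(_ _ e30) /filter_ex[k hk].
rewrite sub0r normrN in hk.
have close n : `|\int[P]_w (Am k w * G n w) - \int[P]_w (fs w * G n w)| <= e / 3.
  apply: le_trans (_ : \int[P]_w `|Am k w - fs w| <= _); last first.
    by apply: le_trans hk; exact: ler_norm.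
  rewrite -meanB; [|exact: bounded_measurableM|exact: bounded_measurableM].
  apply: (le_trans (mean_norm P _)).
    by apply: bounded_measurableB; exact: bounded_measurableM.
  apply: mean_le => [||w].
  - by apply: bounded_measurable_norm; apply: bounded_measurableB; exact: bounded_measurableM.
  - by apply: bounded_measurable_norm; exact: bounded_measurableB.
  - rewrite -mulrBl normrM; have /andP[? ?] := G01 n w.
    by rewrite [X in _ * X]ger0_norm// ler_piMr.
(* For fixed k the average has finitely many terms, each handled by
   cvg_mean_iter. *)
have Ak : \int[P]_w (Am k w * G n w) - \int[P]_w (H w * G n w) @[n --> \oo] --> (0 : R).
  have : k.+1%:R^-1 * \sum_(i < k.+1)
      (\int[P]_w (H (iter i ret w) * G n w) - \int[P]_w (H w * G n w)) @[n --> \oo] -->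
      k.+1%:R^-1 * \sum_(i < k.+1) (0 : R).
    apply: cvg_seqM; first exact: cvg_seq_cst.
    by apply: cvg_finite_sum => i; exact: cvg_mean_iter.
  rewrite big1// mulr0; apply: cvg_eventually_eq; apply: nearW => n.
  rewrite AE sumrB sumr_const card_ord mulrBr -[X in _ - _ * X]mulr_natl mulrA mulVf ?mul1r// pnatr_eq0.
move/cvgrPdist_le : Ak => /(_ _ e30) Ak; move/cvgrPdist_le : hfs => /(_ _ e30) hfs.
near=> n.
have h1 := close n.
have h2 : `|0 - (\int[P]_w (Am k w * G n w) - \int[P]_w (H w * G n w))| <= e / 3 by near: n.
have h3 : `|(\int[P]_w H w) * m - \int[P]_w (fs w * G n w)| <= e / 3 by near: n.
by move: h1 h2 h3; rewrite !ler_norml; lra.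
Unshelve. all: by end_near. Qed.

(** Truncating H at height M loses a mass which is small uniformly in n. *)
Lemma cvg_mean_density (H : T -> R) : measurable_fun setT H -> (forall w, 0 <= H w) ->
  P.-integrable setT (EFin \o H) ->
  \int[P]_w (H w * G n w) @[n --> \oo] --> (\int[P]_w H w) * m.
Proof.
move=> mH H0 iH.
pose HM (M : nat) w := Num.min (H w) M.+1%:R.
have HM0 M w : 0 <= HM M w by rewrite le_min H0/=.
have HMM M w : HM M w <= M.+1%:R by rewrite ge_min lexx orbT.
have HMH M w : HM M w <= H w by rewrite ge_min lexx.
have mHM M : measurable_fun setT (HM M) by apply: measurable_minr => //; exact: measurable_cst.
have bHM M : bounded_measurable (HM M).
  by split=> //; exists M.+1%:R => w; rewrite ger0_norm.
have trunc M : \int[P]_w (HM M w * G n w) @[n --> \oo] --> (\int[P]_w HM M w) * m.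
  pose h w := M.+1%:R^-1 * HM M w.
  have bh : bounded_measurable h by exact: bounded_measurableZ.
  have hE w : HM M w = M.+1%:R * h w by rewrite /h mulrA divff ?mul1r// pnatr_eq0.
  have mh : measurable_fun setT h by case: bh.
  have h01 w : 0 <= h w <= 1.
    by rewrite /h mulr_ge0 ?invr_ge0//= mulrC ler_pdivrMr// mul1r.
  have := cvg_seqM (@cvg_seq_cst R M.+1%:R) (cvg_mean_unit mh h01).
  rewrite mulrA -meanZ//; under [in X in _ --> X]eq_Rintegral do rewrite -hE.
  apply: cvg_eventually_eq; apply: nearW => n.
  rewrite -meanZ; last exact: bounded_measurableM.
  by apply: eq_Rintegral => w _; rewrite mulrA -hE.
have intHM : \int[P]_w HM M w @[M --> \oo] --> \int[P]_w H w.
  have := @dominated_convergence _ T R P setT measurableT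
     (fun M => EFin \o HM M) (EFin \o H) (EFin \o H).
  case=> //.
  - by move=> M; exact/measurable_EFinP.
  - exact/measurable_EFinP.
  - apply: aeW => w _; apply: cvg_EFin; first exact: nearW.
    apply: cvg_near_cst; near=> M; rewrite /= /HM min_l//.
    have : H w <= M%:R by near: M; exact: nbhs_infty_ger.
    by move=> /le_trans; apply; rewrite ler_nat.
  - by apply: aeW => w M _ /=; rewrite lee_fin ger0_norm.
  move=> _ _ cv; apply: (@fine_cvg _ _ _ _ (fun M => (\int[P]_w (HM M w)%:E)%E)).
  by rewrite /Rintegral fineK//; exact: integrable_fin_num.
have iG n : P.-integrable setT (EFin \o (fun w => H w * G n w)).
  apply: le_integrable iH => //.
    by apply/measurable_EFinP; apply: measurable_funM => //; have [] := bG n.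
  move=> w _ /=; rewrite lee_fin; have /andP[? ?] := G01 n w.
  by rewrite !ger0_norm ?mulr_ge0// ler_piMr.
have close M n : `|\int[P]_w (H w * G n w) - \int[P]_w (HM M w * G n w)| <=
    \int[P]_w H w - \int[P]_w HM M w.
  have iM := bounded_measurable_integrable P (bHM M).
  have iMG := bounded_measurable_integrable P (bounded_measurableM (bHM M) (bG n)).
  rewrite -!RintegralB// ger0_norm.
    apply: le_Rintegral => //; [exact: (integrableB _ (iG n) iMG)|exact: (integrableB _ iH iM)|].
    move=> w _; have /andP[? ?] := G01 n w.
    by rewrite -mulrBl ler_piMr// subr_ge0.
  apply: Rintegral_ge0 => w _; have /andP[? ?] := G01 n w.
  by rewrite -mulrBl mulr_ge0// subr_ge0.
apply/cvgrPdist_le => e e0; have e30 : 0 < e / 3 by rewrite divr_gt0.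
have intHMm : (\int[P]_w HM M w) * m @[M --> \oo] --> (\int[P]_w H w) * m.
  by apply: cvg_seqM => //; exact: cvg_seq_cst.
have [M [hM1 hM2]] : exists M, `|\int[P]_w H w - \int[P]_w HM M w| <= e / 3 /\
    `|(\int[P]_w H w) * m - (\int[P]_w HM M w) * m| <= e / 3.
  have : \forall M \near \oo, `|\int[P]_w H w - \int[P]_w HM M w| <= e / 3 /\
    `|(\int[P]_w H w) * m - (\int[P]_w HM M w) * m| <= e / 3.
    move/cvgrPdist_le : intHM => /(_ _ e30) a1; move/cvgrPdist_le : intHMm => /(_ _ e30) a2.
    by near=> M; split; near: M.
  by move=> /filter_ex[M]; exists M.
move/cvgrPdist_le : (trunc M) => /(_ _ e30) tr; near=> n.
have h1 : `|(\int[P]_w HM M w) * m - \int[P]_w (HM M w * G n w)| <= e / 3 by near: n.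
by have := close M n; move: h1 hM1 hM2; rewrite !ler_norml; lra.
Unshelve. all: by end_near. Qed.

End density_independence.

(** * The limit law of the number of visits *)

Lemma positive_functional_mean d (T : measurableType d) (R : realType)
    (P : probability T R) (X H : T -> R) :
  measurable_fun setT X -> (forall w, 0 <= X w) ->
  measurable_fun setT H -> (forall w, 0 <= H w) -> P.-integrable setT (EFin \o H) ->
  positive_functional (fun g => \int[P]_w (g (X w) * H w)).
Proof.
move=> mX X0 mH H0 iH.
have ig g : half_line_bounded g -> P.-integrable setT (EFin \o (fun w => g (X w) * H w)).
  move=> [cg [M gM]]; apply: (@le_integrable _ _ _ _ _ _ _ (fun w => (M * H w)%:E)) => //.
  - apply/measurable_EFinP; apply: measurable_funM => //.
    by apply: measurableT_comp => //; exact: continuous_measurable_fun.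
  - move=> w _ /=; rewrite lee_fin !normrM (ger0_norm (H0 w)) ler_wpM2r//.
    by rewrite (le_trans (gM _ (X0 w)))// ler_norm.
  - by apply: (@integrableZl _ _ _ _ _ _ M _ iH).
split=> [f g hf hg|c f hf|f g hf hg fg].
- rewrite -RintegralD//; [|exact: ig|exact: ig].
  by apply: eq_Rintegral => w _; rewrite mulrDl.
- rewrite -RintegralZl//; last exact: ig.
  by apply: eq_Rintegral => w _; rewrite mulrA.
- apply: le_Rintegral => //; [exact: ig|exact: ig|].
  by move=> w _; rewrite ler_wpM2r// fg.
Qed.

Section visits_limit_law.
Context d (T : measurableType d) (R : realType) (P : probability T R).
Variables (s : T -> T) (z : nat -> T -> bool).
Hypothesis ms : measurable_fun setT s.
Hypothesis sP : forall A, measurable A -> P (s @^-1` A) = P A.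
Hypothesis mz : forall i, measurable [set w | z i w].
Hypothesis zD : forall i j w, z i w -> z (i + j) w = z j (iter i s w).
Hypothesis zB : forall i j w, z (i + j) w -> z j (iter i s w) -> z i w.
Variables (u : nat -> R) (alpha : R).
Hypothesis u_gt0 : forall i, 0 < u i.+1.
Hypothesis alpha_gt0 : 0 < alpha.
Hypothesis alpha_lt1 : alpha < 1.
Hypothesis u_succ : u n.+1 / u n @[n --> \oo] --> (1 : R).
Hypothesis u_dilation : forall k, (0 < k)%N ->
  u (k * n)%N / u n @[n --> \oo] --> k%:R `^ (alpha - 1).
Hypothesis u_visits : forall delta, 0 < delta -> exists A N,
  [/\ measurable A, prob P (~` A) <= delta &
  forall i, (N <= i)%N -> uniform_arrivals P s z A i.+1 (u i.+1) delta].
Context d' (T' : measurableType d') (Q : probability T' R) (Y : {RV Q >-> R}).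
Hypothesis Y_ML : mittag_leffler Y alpha.
Local Notation a := (partial_sums u).

Let a_ge0 n : 0 <= a n.
Proof. by apply: sumr_ge0 => i _; exact: ltW. Qed.

Let a_div : a n @[n --> \oo] --> +oo.
Proof. exact: (partial_sums_diverge u_gt0 alpha_gt0 alpha_lt1 u_succ u_dilation). Qed.

Lemma cvg_laplace_visits (H : T -> R) lambda : 0 < lambda ->
  measurable_fun setT H -> (forall w, 0 <= H w) -> P.-integrable setT (EFin \o H) ->
  \int[P]_w (H w * expR (- (lambda / a n)) ^+ visits s z setT n w) @[n --> \oo] -->
  (\int[P]_w H w) * mgf Y (- lambda).
Proof.
move=> l0 mH H0 iH; pose x n := expR (- (lambda / a n)).
have x01 n : 0 <= x n <= 1.
  by rewrite expR_ge0/= -[leRHS]expR0 ler_expR oppr_le0 divr_ge0// ltW.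
have x_to1 : x n @[n --> \oo] --> (1 : R).
  have y0 : - (lambda / a n) @[n --> \oo] --> (0 : R).
    rewrite -[X in _ --> X]oppr0; apply: cvgN; rewrite -[X in _ --> X](mulr0 lambda).
    apply: cvg_seqM; first exact: cvg_seq_cst.
    apply: ((gtr0_cvgV0 _).2 a_div); near=> n; apply: partial_sums_gt0 => //.
    by near: n; exact: nbhs_infty_gt.
  have : expR (- (lambda / a n)) @[n --> \oo] --> expR 0.
    by apply: continuous_cvg; [exact: continuous_expR|exact: y0].
  by rewrite expR0; exact.
have nr0 := prob_never_returns ms sP mz zD u_gt0 a_div u_visits.
apply: (cvg_mean_density ms sP mz zD zB nr0 x01 x_to1 _ mH H0 iH).
move=> h mh h01 h_ret.
have hb01 : 0 <= \int[P]_w h w <= 1.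
  have bh : bounded_measurable h.
    by split=> //; exists 1 => w; have /andP[? ?] := h01 w; rewrite ger0_norm.
  rewrite Rintegral_ge0/= => [|w _]; last by case/andP: (h01 w).
  rewrite -[leRHS](mean_cst P); apply: mean_le => //; first exact: bounded_measurable_cst.
  by move=> w; case/andP: (h01 w).
apply: (@tauberian_mittag_leffler _ _ _ _ _ _ alpha_gt0 Y_ML
  (fun n => laplace_visits P s z h setT (x n))) => //.
- by move=> n m; exact: laplace_visits01.
- by move=> n m k mk; exact: laplace_visits_nonincreasing.
- by move=> c c0; exact: (cvg_visits_transform ms sP mz zD zB u_gt0).
Unshelve. all: by end_near. Qed.

(** The means of exp (- k x) converge for every integer k: for k = 0 because H is
    a density, otherwise by [cvg_laplace_visits]. *)
Theorem cvg_visits_law (H : T -> R) (f : R -> R) :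
  measurable_fun setT H -> (forall w, 0 <= H w) -> P.-integrable setT (EFin \o H) ->
  \int[P]_w H w = 1 -> half_line_bounded f ->
  \int[P]_w (f ((visits s z setT n w)%:R / a n) * H w) @[n --> \oo] -->
  \int[Q]_w f (positive_part_of Y w).
Proof.
move=> mH H0 iH H1 bf.
pose J g := \int[Q]_w (g (positive_part_of Y w) * 1).
have JE g : \int[Q]_w g (positive_part_of Y w) = J g.
  by apply: eq_Rintegral => w _; rewrite mulr1.
rewrite JE; have mY := measurable_positive_part_of Y.
apply: (laplace_continuity (I := fun n g =>
  \int[P]_w (g ((visits s z setT n w)%:R / a n) * H w)) (J := J)) => //.
- move=> n; apply: positive_functional_mean => //; last by move=> w; rewrite divr_ge0.
  have [mv _] := bounded_measurable_visits (P := P) ms sP mz n measurableT.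
  exact: measurable_funM.
- apply: positive_functional_mean => //; first exact: positive_part_of_ge0.
  exact: (bounded_measurable_integrable Q (bounded_measurable_cst _ 1)).
- under eq_fun do rewrite -JE; rewrite -(mean_cst Q 0).
  apply: (mean_cvg (M := 1)) => //.
  + by move=> K; apply: measurableT_comp => //; apply: continuous_measurable_fun; exact: continuous_ramp.
  + by move=> K w; have /andP[? ?] := ramp01 K (positive_part_of Y w); rewrite ger0_norm.
  + apply: aeW => w; apply: cvg_near_cst; near=> K.
    have tK : positive_part_of Y w <= K%:R by near: K; exact: nbhs_infty_ger.
    rewrite /ramp max_l// ge_min; apply/orP; right; lra.
- move=> [|k].
    rewrite (_ : J _ = 1); last by rewrite -JE -[RHS](mean_cst Q); apply: eq_Rintegral => w _; rewrite /exp_decay expr0.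
    apply: cvg_near_cst; apply: nearW => n.
    by rewrite -[RHS]H1; apply: eq_Rintegral => w _; rewrite /exp_decay expr0 mul1r.
  have k0 : 0 < (k.+1%:R : R) by rewrite ltr0n.
  have := cvg_laplace_visits k0 mH H0 iH; rewrite H1 mul1r (mgfN Y_ML) => cv.
  have expE y : exp_decay k.+1 y = expR (- (k.+1%:R * y)).
    by rewrite /exp_decay -expRM_natl mulrN.
  rewrite -JE; under eq_Rintegral do rewrite expE.
  apply: cvg_eventually_eq cv; apply: nearW => n.
  apply: eq_Rintegral => w _; rewrite mulrC expE -expRM_natl; congr (expR _ * _).
  ring.
Unshelve. all: by end_near. Qed.

End visits_limit_law.

(** * Sums of the coordinates, local limits and norming constants *)

Section random_walk.
Implicit Type w : path_space.

Lemma iter_path_shift i w k : iter i path_shift w k = w (i + k)%N.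
Proof. by elim: i k => //= i IH k; rewrite /path_shift IH addSnnS. Qed.

Lemma sum_SE n w : sum_S n w = \sum_(i < n) w i.
Proof.
rewrite /sum_S big_add1 /= big_mkord; apply: eq_bigr => i _.
by rewrite /coord_X /phi/= iter_path_shift addn0.
Qed.

Lemma sum_SD i j w : sum_S (i + j) w = sum_S i w + sum_S j (iter i path_shift w).
Proof.
rewrite !sum_SE big_split_ord/=; congr (_ + _); apply: eq_bigr => k _.
by rewrite iter_path_shift.
Qed.

Lemma futureE n : future n = iter n path_shift.
Proof.
apply/funext => w; apply/funext => k.
by rewrite /future /coord_X /phi !iter_path_shift addn0 addnS.
Qed.

Lemma ellE n w : ell n w = visits path_shift (fun i v => sum_S i v == 0) setT n w.
Proof.
elim: n => [|n IH]; first by rewrite /visits big_ord0.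
rewrite visitsS -IH /ell -[in LHS](addn1 n) iotaD count_cat/= addn0 in_setT andbT.
by rewrite add1n.
Qed.

Lemma measurable_coordinate k (A : set int) : measurable [set w : path_space | A (w k)].
Proof.
apply: sub_sigma_algebra; exists k => //; exists A => //.
by rewrite setTI.
Qed.

Lemma measurable_path_shift : measurable_fun setT path_shift.
Proof.
apply: (@measurability _ _ path_space path_space setT path_shift coordinate_sets) => // _ [_ [k _ [A _ <-]] <-].
rewrite !setTI; exact: measurable_coordinate k.+1 A.
Qed.

Lemma measurable_sum_S n x : measurable [set w | sum_S n w = x].
Proof.
elim: n x => [|n IH] x.
  have [<-|x0] := eqVneq 0 x.
    rewrite (_ : [set w | _] = setT)//; apply/seteqP; split=> // w _ /=.
    by rewrite sum_SE big_ord0.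
  rewrite (_ : [set w | _] = set0)//; apply/seteqP; split=> // w /=.
  by rewrite sum_SE big_ord0; move/eqP: x0.
have -> : [set w | sum_S n.+1 w = x] =
    \bigcup_(y : int) ([set w | sum_S n w = y] `&` [set w | w n = x - y]).
  apply/seteqP; split=> w /=; rewrite sum_SE big_ord_recr/= -sum_SE.
    by move=> <-; exists (sum_S n w) => //; split => //=; rewrite addrAC subrr add0r.
  by move=> [y _ [/= <- ->]]; rewrite addrC subrK.
apply: countable_bigcupT_measurable; first exact: countableP.
move=> y; apply: measurableI => //.
exact: (measurable_coordinate n [set x - y]).
Qed.

End random_walk.

Section local_limit.
Context d (T : measurableType d) (R : realType) (P : probability T R).
Variables (s : T -> T) (z : nat -> T -> bool).
Hypothesis ms : measurable_fun setT s.
Hypothesis sP : forall A, measurable A -> P (s @^-1` A) = P A.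
Variables (u : nat -> R) (q : nat -> T -> R).
Hypothesis u_gt0 : forall i, 0 < u i.+1.
Hypothesis mq : forall i, measurable_fun setT (q i.+1).
Hypothesis q_arrival : forall i A, measurable A ->
  (\int[P]_(w in iter i.+1 s @^-1` A) (q i.+1 (iter i.+1 s w))%:E = P (arrival s z A i.+1))%E.
Hypothesis q_equiv : {ae P, forall w, q n.+1 w / u n.+1 @[n --> \oo] --> (1 : R)}.

(** Egorov's argument: the points at which q i / u i is within delta of 1 for all
    i >= N form sets that increase to a set of full probability. *)
Lemma local_limit_uniform_arrivals delta : 0 < delta -> exists A N,
  [/\ measurable A, prob P (~` A) <= delta &
  forall i, (N <= i)%N -> uniform_arrivals P s z A i.+1 (u i.+1) delta].
Proof.
move=> d0.
pose A N := \bigcap_(i in [set i | (N <= i)%N]) [set w | `|q i.+1 w - u i.+1| <= delta * u i.+1].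
have mA N : measurable (A N).
  apply: bigcap_measurable; first by exists N => /=.
  move=> i _.
  have mi : measurable_fun setT (fun w => `|q i.+1 w - u i.+1|).
    by apply: measurableT_comp => //; apply: measurable_funB => //; exact: mq.
  rewrite -[X in measurable X]setTI.
  exact: measurable_fun_le.
have indic0 : prob P (~` (A N)) @[N --> \oo] --> (0 : R).
  have : \int[P]_w (\1_(~` (A N)) w : R) @[N --> \oo] --> \int[P]_w (0 : R).
    apply: (mean_cvg (M := 1)) => //.
    - by move=> N; apply: measurable_indic; exact: measurableC.
    - by move=> N w; rewrite indicE; case: (_ \in _); rewrite ?normr1 ?normr0.
    apply: filterS q_equiv => w /cvgrPdist_le/(_ _ d0) [N _ hN].
    apply: cvg_near_cst; exists N => // M /= NM; rewrite indicE memNset// => nA; apply: nA.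
    move=> i /= Mi; have := hN i (leq_trans NM Mi).
    have ui := u_gt0 i; rewrite /= distrC -{1}(divff (lt0r_neq0 ui)) -mulrBl normrM.
    by rewrite (gtr0_norm (_ : 0 < (u i.+1)^-1)) ?invr_gt0// ler_pdivrMr.
  rewrite mean_cst; apply: cvg_eventually_eq; apply: nearW => N.
  by rewrite mean_indic//; exact: measurableC.
move/cvgrPdist_le : indic0 => /(_ _ d0) [N _ hN].
have {hN} := hN N (leqnn N); rewrite /= sub0r normrN ger0_norm ?prob_ge0// => PN.
exists (A N), N; split => // i Ni B mB BA.
have hB w : B w -> `|q i.+1 w - u i.+1| <= delta * u i.+1 by move=> /BA; exact.
have [mi iP] := iter_preserving (P := P) ms sP i.+1.
(* q i.+1 is close to u i.+1 on B, so this product is bounded even if q i.+1 is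
   not. *)
pose g w := q i.+1 w * \1_B w.
have ui := u_gt0 i.
have bg : bounded_measurable g.
  split; first by apply: measurable_funM => //; exact: measurable_indic.
  exists (delta * u i.+1 + u i.+1) => w; rewrite /g indicE.
  have [Bw|nBw] := pselect (B w); last by rewrite memNset// mulr0 normr0 addr_ge0 ?mulr_ge0 ?ltW.
  rewrite mem_set// mulr1 -[q i.+1 w](subrK (u i.+1)) (le_trans (ler_normD _ _))//.
  by rewrite lerD ?hB// gtr0_norm.
have -> : prob P (arrival s z B i.+1) = \int[P]_w g w.
  rewrite -(mean_preserving mi iP bg) /prob -q_arrival// /Rintegral; congr fine.
  rewrite [LHS]integral_mkcond; apply: eq_integral => w _ /=.
  rewrite patchE /g indicE; have [Bw|nBw] := pselect (B (iter i.+1 s w)).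
    by rewrite !mem_set//= mulr1.
  by rewrite !memNset//= mulr0.
have iB : bounded_measurable (\1_B : T -> R) by exact: bounded_measurable_indic.
have -> : u i.+1 * prob P B = \int[P]_w (u i.+1 * \1_B w).
  by rewrite meanZ// mean_indic.
have -> : delta * u i.+1 * prob P B = \int[P]_w (delta * u i.+1 * \1_B w).
  by rewrite meanZ// mean_indic.
have bu k : bounded_measurable (fun w => k * \1_B w : R) by exact: bounded_measurableZ.
rewrite -meanB//; apply: (le_trans (mean_norm P _)); first exact: bounded_measurableB.
apply: mean_le => //; first by apply: bounded_measurable_norm; exact: bounded_measurableB.
move=> w; rewrite /g -mulrBl indicE.
have [Bw|nBw] := pselect (B w); last by rewrite memNset// !mulr0 normr0.
by rewrite mem_set// !mulr1 hB.
Qed.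

End local_limit.

Section regular_variation.
Context {R : realType}.
Variables (L : R -> R) (B : nat -> R) (beta : R).
Hypothesis L_slow : slowly_varying L.
Hypothesis B_gt0 : forall n, (0 < n)%N -> 0 < B n.
Hypothesis B_eq : forall n, (0 < n)%N -> B n = n%:R `^ beta * L n%:R.

Let L_gt0 n : (0 < n)%N -> 0 < L n%:R.
Proof.
by move=> n0; have := B_gt0 n0; rewrite B_eq// pmulr_rgt0// powR_gt0 ?ltr0n.
Qed.

(** The powers satisfy this by continuity, and L by [slowly_varying_ratio]. *)
Lemma norming_succ : B n / B n.+1 @[n --> \oo] --> (1 : R).
Proof.
have [[x0 [mL Lx0]] Ls] := L_slow.
have LL := slowly_varying_ratio mL Lx0 Ls.
have h0 : (@harmonic R) n @[n --> \oo] --> (0 : R) by exact: cvg_harmonic.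
have pw : (1 - harmonic n) `^ beta @[n --> \oo] --> (1 : R).
  have h1 : 1 - harmonic n @[n --> \oo] --> (1 : R).
    by have := cvg_seqB (@cvg_seq_cst R 1) h0; rewrite subr0.
  have : expR (beta * ln (1 - harmonic n)) @[n --> \oo] --> expR (beta * ln 1).
    apply: continuous_cvg; first exact: continuous_expR.
    apply: cvg_seqM; first exact: cvg_seq_cst.
    by apply: continuous_cvg; [exact: continuous_ln|exact: h1].
  rewrite ln1 mulr0 expR0; apply: cvg_eventually_eq; near=> n.
  have hn : 0 < 1 - harmonic n :> R.
    by near: n; apply: (cvgr_gt (1 : R)) => //; exact: ltr01.
  by rewrite /powR gt_eqF.
have := cvg_seqM pw (cvg_seqV (@oner_neq0 R) LL); rewrite invr1 mulr1.
apply: cvg_eventually_eq; near=> n.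
have n0 : (0 < n)%N by near: n; exact: nbhs_infty_gt.
have Ln := L_gt0 n0; have Ln1 := L_gt0 (ltn0Sn n).
have -> : 1 - harmonic n = n%:R / n.+1%:R :> R.
  by rewrite /harmonic/= -[X in X - _](@divff _ n.+1%:R)// -natr1; field; rewrite natr1.
have n1 : 0 < (n.+1%:R : R) `^ beta by rewrite powR_gt0.
rewrite !B_eq// powRM ?invr_ge0// -powR_inv1// -powRrM mulN1r powRN.
by field; rewrite !gt_eqF.
Unshelve. all: by end_near. Qed.

Lemma norming_dilation k : (0 < k)%N ->
  B n / B (k * n)%N @[n --> \oo] --> k%:R `^ (- beta).
Proof.
move=> k0; have [_ Ls] := L_slow.
have kR : 0 < k%:R :> R by rewrite ltr0n.
have Lk : L (k%:R * n%:R) / L n%:R @[n --> \oo] --> (1 : R).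
  exact: (cvg_comp (fun n : nat => n%:R : R) (fun x : R => L (k%:R * x) / L x) (@cvgr_idn R) (Ls _ kR)).
have := cvg_seqM (@cvg_seq_cst R (k%:R `^ (- beta))) (cvg_seqV (@oner_neq0 R) Lk).
rewrite invr1 mulr1; apply: cvg_eventually_eq; near=> n.
have n0 : (0 < n)%N by near: n; exact: nbhs_infty_gt.
have kn0 : (0 < k * n)%N by rewrite muln_gt0 k0.
have Ln := L_gt0 n0; have Lkn := L_gt0 kn0.
rewrite !B_eq// -natrM powRN natrM powRM// -natrM.
have n1 : 0 < (n%:R : R) `^ beta by rewrite powR_gt0 ?ltr0n.
have k1 : 0 < (k%:R : R) `^ beta by rewrite powR_gt0.
by field; rewrite !gt_eqF.
Unshelve. all: by end_near. Qed.

End regular_variation.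

(** * The number of zeros *)

Theorem theorem1p2 (R : realType) (P : probability path_space R)
  (g0 beta : R) (L : R -> R) (B : nat -> R)
  (P_stationary : stationary P)
  (P_centered : centered P)
  (g0_gt0 : 0 < g0)
  (beta_ge : 1 / 2 <= beta) (beta_lt1 : beta < 1)
  (L_slow : slowly_varying L)
  (B_gt0 : forall n : nat, (0 < n)%N -> 0 < B n)
  (B_eq : forall n : nat, (0 < n)%N -> B n = n%:R `^ beta * L n%:R)
  (LLT : conditional_LLT P B g0)
  (d : measure_display) (T : measurableType d) (Q : probability T R)
  (Y : {RV Q >-> R}) (Y_ML : mittag_leffler Y (1 - beta))
  (f : R -> R) (f_cont : continuous f)
  (f_bounded : exists M : R, forall x : R, `|f x| <= M)
  (H : path_space -> R) (H_density : probability_density P H) :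
  let a (n : nat) : R := g0 * \sum_(1 <= k < n.+1) (B k)^-1 in
  (\int[P]_w (f ((ell n w)%:R / a n) * H w)%:E)%E @[n --> \oo]
    --> 'E_Q[f \o Y]%E.
Proof.
move=> a.
pose z i (w : path_space) := sum_S i w == 0.
pose u n := g0 / B n.
have ms := measurable_path_shift.
have mz i : measurable [set w | z i w].
  rewrite (_ : [set w | z i w] = [set w | sum_S i w = 0]); first exact: measurable_sum_S.
  by apply/seteqP; split=> w /eqP.
have zD i j w : z i w -> z (i + j)%N w = z j (iter i path_shift w).
  by rewrite /z sum_SD => /eqP ->; rewrite add0r.
have zB i j w : z (i + j)%N w -> z j (iter i path_shift w) -> z i w.
  by rewrite /z sum_SD => /eqP h /eqP h'; rewrite -h h' addr0.
have u_gt0 i : 0 < u i.+1 by rewrite divr_gt0// B_gt0.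
have alpha_gt0 : 0 < 1 - beta by rewrite subr_gt0.
have alpha_lt1 : 1 - beta < 1 by lra.
have uE m n : (0 < n)%N -> (0 < m)%N -> B n / B m = u m / u n.
  by move=> n0 m0; rewrite /u; field; rewrite !gt_eqF ?B_gt0.
have u_succ : u n.+1 / u n @[n --> \oo] --> (1 : R).
  apply: cvg_eventually_eq (norming_succ L_slow B_gt0 B_eq); near=> n.
  by rewrite uE//; near: n; exact: nbhs_infty_gt.
have u_dilation k : (0 < k)%N -> u (k * n)%N / u n @[n --> \oo] --> k%:R `^ (1 - beta - 1).
  move=> k0; rewrite (_ : 1 - beta - 1 = - beta); last by lra.
  apply: cvg_eventually_eq (norming_dilation L_slow B_gt0 B_eq k0); near=> n.
  have n0 : (0 < n)%N by near: n; exact: nbhs_infty_gt.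
  by rewrite uE// muln_gt0 k0.
have [q [hq qlim]] := LLT.
have u_visits delta : 0 < delta -> exists A N,
    [/\ measurable A, prob P (~` A) <= delta &
    forall i, (N <= i)%N -> uniform_arrivals P path_shift z A i.+1 (u i.+1) delta].
  apply: (local_limit_uniform_arrivals ms P_stationary (q := fun n => q n 0)) => //.
  - by move=> i; have [] := hq i.+1 0 isT.
  - move=> i A mA; have [_ _ /(_ _ mA)] := hq i.+1 0 isT; rewrite futureE => ->.
    congr (P (_ `&` _)); by apply/seteqP; split=> w /eqP.
  apply: filterS (qlim 0) => w hw.
  have := cvg_seqM (@cvg_seq_cst R g0^-1) hw; rewrite mulVf ?gt_eqF//.
  rewrite -(cvg_shiftS (fun n => g0^-1 * (B n * q n 0 w))); apply: cvg_eventually_eq; apply: nearW => n.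
  by rewrite /u; field; rewrite !gt_eqF ?B_gt0.
have aE n : a n = partial_sums u n.
  by rewrite /a /partial_sums big_add1/= big_mkord mulr_sumr.
have [mH H0 H1] := H_density.
have iH : P.-integrable setT (EFin \o H).
  apply/integrableP; split; first exact/measurable_EFinP.
  rewrite (_ : (\int[P]_w _)%E = 1%E) ?ltry// -H1.
  by apply: eq_integral => w _ /=; rewrite ger0_norm.
have H1R : \int[P]_w H w = 1 by rewrite /Rintegral H1.
have bf : half_line_bounded f.
  by split=> //; have [M fM] := f_bounded; exists M.
have cv := cvg_visits_law ms P_stationary mz zD zB u_gt0 alpha_gt0 alpha_lt1
  u_succ u_dilation u_visits Y_ML mH H0 iH H1R bf.
have bE : bounded_measurable (fun w => f (positive_part_of Y w)).
  have [M fM] := f_bounded; split; last by exists M.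
  apply: measurableT_comp; first exact: continuous_measurable_fun.
  exact: measurable_positive_part_of.
rewrite unlock (mean_positive_part Y_ML f_cont).
rewrite -(fineK (integrable_fin_num _ (bounded_measurable_integrable Q bE)))//.
have {}cv : (\int[P]_w (f ((visits path_shift z setT n w)%:R / partial_sums u n) * H w))%:E
   @[n --> \oo] --> (\int[Q]_w f (positive_part_of Y w))%:E.
  by apply: cvg_EFin; [exact: nearW|exact: cv].
apply: cvg_trans cv; apply: near_eq_cvg; apply: nearW => n.
rewrite /Rintegral fineK.
  by apply: eq_integral => w _; rewrite ellE aE.
apply: integrable_fin_num => //.
have [M fM] := f_bounded.
apply: (@le_integrable _ _ _ _ _ _ _ (fun w => (M * H w)%:E)) => //.
- apply/measurable_EFinP; apply: measurable_funM => //.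
  apply: measurableT_comp; first exact: continuous_measurable_fun.
  have [mv _] := bounded_measurable_visits (P := P) ms P_stationary mz n measurableT.
  exact: measurable_funM.
- move=> w _ /=; rewrite lee_fin !normrM (ger0_norm (H0 w)) ler_wpM2r//.
  by rewrite (le_trans (fM _))// ler_norm.
- by apply: (@integrableZl _ _ _ _ _ _ M _ iH).
Unshelve. all: by end_near. Qed.
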